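(* Let $k$ be any field of characteristic $p$ ($p=0$ allowed), let $d>1$ and $n\ge 1$ be integers, and let $s_0,\dots,s_{d-1},u_0,\dots,u_d,x$ be independent indeterminates over $k$. Put $$\mathfrak G(x)=x^d+s_{d-1}x^{d-1}+\dots+s_0,\qquad \Phi(x)=\frac{x^d+s_{d-1}x^{d-1}+\dots+s_0}{u_dx^d+u_{d-1}x^{d-1}+\dots+u_0}.$$ Then $\operatorname{Gal}(\Phi^n(x)/k(s_0,\dots,s_{d-1},u_0,\dots,u_d))\cong [S_d]^n$, and if $(d,p)\neq(2,2)$ then $\operatorname{Gal}(\mathfrak G^n(x)/k(s_0,\dots,s_{d-1}))\cong [S_d]^n$.
   Context: $\mathfrak G^n$ and $\Phi^n$ denote $n$-fold composition. For a rational function $\psi(x)$ over a field $K$, $\operatorname{Gal}(\psi(x)/K)$ denotes the Galois group over $K$ of the splitting field of $\psi(x)$, i.e. of the field generated by the zeros of $\psi$ (the roots of its numerator). Wreath products: if $G$ acts on $\{\alpha_1,\dots,\alpha_m\}$ and $H$ on $\{\beta_1,\dots,\beta_\ell\}$, then $G[H]$ is the set of tuples $(\pi,\tau_1,\dots,\tau_m)$ with $\pi\in G$, $\tau_i\in H$, acting on $\{\alpha_i\}\times\{\beta_r\}$ by $(\alpha_i,\beta_r)\mapsto(\alpha_{\pi(i)},\beta_{\tau_i(r)})$. The $n$-th wreath power is defined by $[S_d]^1=S_d$ and $[S_d]^n=[S_d]^{n-1}[S_d]$; equivalently it is the automorphism group of the $d$-ary rooted tree truncated at level $n$. *)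

(* Defs.v *)
From HB Require Import structures.
From mathcomp Require Import all_boot all_order all_algebra all_fingroup all_field.
From mathcomp Require Import fraction.
From mathcomp Require Import mpoly.
Set Implicit Arguments. Unset Strict Implicit. Unset Printing Implicit Defensive.
Import GRing.Theory.
Local Open Scope ring_scope.

Definition ratfield (k : fieldType) (m : nat) : fieldType :=
  {fraction {mpoly k[m]}}.

Definition indet (k : fieldType) (m : nat) (i : 'I_m) : ratfield k m :=
  tofrac (mpolyX k U_(i)%MM).

(* Homogenization in degree d of a polynomial P (deg P <= d) evaluated at (A, B):
   B^d * P(A/B) = \sum_i P_i A^i B^(d-i). *)
Definition homogAt (K : fieldType) (d : nat) (P A B : {poly K}) : {poly K} :=
  \sum_(i < d.+1) P`_i *: (A ^+ i * B ^+ (d - i)).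

Definition Gpoly (k : fieldType) (d : nat) : {poly ratfield k d} :=
  'X^d + \sum_(i < d) (indet k i)%:P * 'X^i.

Definition Giter (k : fieldType) (d n : nat) : {poly ratfield k d} :=
  iter n (fun q => Gpoly k d \Po q) 'X.

Definition PhiField (k : fieldType) (d : nat) : fieldType := ratfield k (d + d.+1).

Definition s_ (k : fieldType) (d : nat) (i : 'I_d) : PhiField k d :=
  indet k (lshift d.+1 i).
Definition u_ (k : fieldType) (d : nat) (j : 'I_d.+1) : PhiField k d :=
  indet k (rshift d j).

Definition PhiNum (k : fieldType) (d : nat) : {poly PhiField k d} :=
  'X^d + \sum_(i < d) (s_ k i)%:P * 'X^i.
Definition PhiDen (k : fieldType) (d : nat) : {poly PhiField k d} :=
  \sum_(j < d.+1) (u_ k j)%:P * 'X^j.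

(* (A_n, B_n) with Phi^n(x) = A_n(x) / B_n(x):  A_0 = x, B_0 = 1,
   A_{n+1} = B_n^d * PhiNum(A_n/B_n), B_{n+1} = B_n^d * PhiDen(A_n/B_n). *)
Definition PhiIterPair (k : fieldType) (d n : nat) :
    {poly PhiField k d} * {poly PhiField k d} :=
  iter n (fun ab => (homogAt d (PhiNum k d) ab.1 ab.2,
                     homogAt d (PhiDen k d) ab.1 ab.2)) ('X, 1).

(* numerator of Phi^n(x) written in lowest terms; its roots are the zeros of Phi^n *)
Definition PhiIterNumer (k : fieldType) (d n : nat) : {poly PhiField k d} :=
  let ab := PhiIterPair k d n in ab.1 %/ gcdp ab.1 ab.2.

(* automorphism group of the d-ary rooted tree truncated at level n, acting
   faithfully on its leaves (words of length n over 'I_d): permutations of the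
   leaves preserving, for every level k <= n, the relation "same ancestor at
   level k" (i.e. equal length-k prefixes). *)
Definition wreath_power (d n : nat) : {set {perm n.-tuple 'I_d}} :=
  [set g : {perm n.-tuple 'I_d} | [forall t1 : n.-tuple 'I_d, forall t2 : n.-tuple 'I_d,
     forall l : 'I_n.+1,
       (take l t1 == take l t2) == (take l (g t1) == take l (g t2))]].

(* Main.v *)
(** Write [f] for the generic map. Its iterated preimages of [0] form a [d]-ary tree, with [f]
    sending a node to its parent, so the Galois group embeds in the automorphism group of the
    tree. It is the whole group as soon as, for any two siblings of any level [l], it contains an
    element exchanging them and fixing the other nodes of level [l]. This follows from two facts.

    The group is transitive on ordered pairs of siblings. By interpolation, the generic map can be
    specialized into one over [K(X, X', y)] for which [X] and [X'] have the same image [y];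
    translating by [t = f^n(X)] (that is, replacing [f] by [f(x + t) - t]) makes [X - t] and
    [X' - t] siblings of level [n], and every algebraic relation that this pair satisfies over [K]
    specializes to every pair of siblings.

    The group contains a transposition of two nodes of level [l]. Take a special map [f] for which
    [0] is a simple critical point whose orbit hits [f^l(0)] only at time [l], while the orbit of
    no other finite critical point hits it. Then [f^l(x) = f^l(0)] has one double root and
    otherwise simple roots, and the inertia group at [eps = 0] of [f^l(x) = f^l(0) + eps] is
    generated by a transposition. Such an [f] is [mu^(d-1) x^2 h(x) + mu] for a suitable [h] of
    degree [d - 2], or [(x^2 + a nu x + a) / (nu x + 1)] when [d = p = 2]; the orbits are told
    apart by their degrees in the parameters. *)
Require Import Defs.
From HB Require Import structures.
From mathcomp Require Import all_boot all_order all_algebra all_fingroup all_field.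
From mathcomp Require Import fraction generic_quotient.
From mathcomp Require Import mpoly ring zify.
From Stdlib Require Import Classical ClassicalEpsilon.
Set Implicit Arguments. Unset Strict Implicit. Unset Printing Implicit Defensive.
Import GRing.Theory.
Local Open Scope ring_scope.

(** Specialization is expressed through kernels: two morphisms [f] and [g] out of one ring with
    [f r = 0 -> g r = 0]. This replaces extensions of places, and Galois elements are produced from
    the polynomial relations among roots. The embedding of [K] into the field of a special family
    comes from the same principle: if the family specializes back to the generic map, no algebraic
    relation can hold among its coefficients. For this reason both constructions keep a fibre equal
    to the generic map.

    The inertia argument needs an integrally closed base with a chosen point. It is run over
    [F[eps]], and the transposition found there is carried back because the roots over [K] and their
    images satisfy the same relations over [K].

    A transposition of two nodes necessarily exchanges siblings: a node sent to a non-sibling would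
    have a fixed sibling, hence a fixed parent. Conjugation and transitivity on sibling pairs then
    give every swap.

    That the levels are full, with simple roots and no poles, is seen on the map [x^d + mu], or
    [x^d + x + mu] when [p] divides [d]. *)

Lemma mpoly_rmorphE n (R : nzRingType) (S : comNzRingType)
    (g : {rmorphism {mpoly R[n]} -> S}) (f : R -> S) (h : 'I_n -> S) p :
    (forall c, g c%:MP = f c) -> (forall i, g 'X_i = h i) -> g p = mmap f h p.
Proof.
move=> gC gX; rewrite {1}[p]mpolyE rmorph_sum; apply: eq_bigr => m _.
rewrite -mul_mpolyC rmorphM gC mpolyXE_id rmorph_prod; congr (_ * _).
by apply: eq_bigr => i _; rewrite rmorphXn gX.
Qed.

Lemma mmap_msym n (R : nzRingType) (S : comNzRingType) (f : {rmorphism R -> S})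
    (h : 'I_n -> S) (s : 'S_n) p :
  mmap f h (msym s p) = mmap f (fun i => h (s i)) p.
Proof.
apply: (mpoly_rmorphE (g := GRing.RMorphism.clone _ _ (mmap f h \o msym s) _)).
- by move=> c; rewrite /= /msym mmapC mmapC.
- by move=> i; rewrite /= /msym mmapX mmap1U mmapX mmap1U.
Qed.

Lemma mmap_comp_mpoly n k (R : comNzRingType) (S : comNzRingType)
    (f : {rmorphism R -> S}) (h : 'I_k -> S) (lq : n.-tuple {mpoly R[k]}) p :
  mmap f h (p \mPo lq) = mmap f (fun i => mmap f h (tnth lq i)) p.
Proof.
apply: (mpoly_rmorphE (g := GRing.RMorphism.clone _ _ (mmap f h \o comp_mpoly lq) _)).
- by move=> c; rewrite /= comp_mpolyC mmapC.
- by move=> i; rewrite /= comp_mpolyXU -tnth_nth.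
Qed.

Lemma rmorph_mmap n (R : nzRingType) (S T : comNzRingType) (g : {rmorphism S -> T})
    (f : {rmorphism R -> S}) (h : 'I_n -> S) p :
  g (mmap f h p) = mmap (g \o f) (g \o h) p.
Proof.
apply: (mpoly_rmorphE (g := GRing.RMorphism.clone _ _ (g \o mmap f h) _)).
- by move=> c; rewrite /= mmapC.
- by move=> i; rewrite /= mmapX mmap1U.
Qed.

Lemma eq_mmap n (R S : nzRingType) (f f' : R -> S) (h h' : 'I_n -> S) p :
  f =1 f' -> h =1 h' -> mmap f h p = mmap f' h' p.
Proof.
move=> ef eh; apply: eq_bigr => m _; rewrite ef; congr (_ * _).
exact: mmap1_eq.
Qed.

(** * Specializing the roots of a polynomial *)

Section RootSpecialization.
Variables (R : comNzRingType) (Z W : fieldType).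
Variables (f : {rmorphism R -> Z}) (g : {rmorphism R -> W}).
Hypothesis fg0 : forall r, f r = 0 -> g r = 0.
Variables (N : nat) (P : {poly R}) (x : 'I_N -> Z) (y : 'I_N -> W).
Hypothesis Px : map_poly f P = \prod_i ('X - (x i)%:P).
Hypothesis Py : map_poly g P = \prod_i ('X - (y i)%:P).

(** Vieta's formulas, lifted to [{poly R}] because the symmetrization below carries an auxiliary
    variable. *)
Lemma mmap_mesym (T : fieldType) (e : {rmorphism R -> T}) (z : 'I_N -> T) :
    map_poly e P = \prod_i ('X - (z i)%:P) -> forall k, (k <= N)%N ->
  mmap (map_poly e) (fun i => (z i)%:P) (mesym N {poly R} k) =
  map_poly e ((-1) ^+ k * P`_(N - k)%N)%:P.
Proof.
move=> Pz k lekN.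
have := mroots_coeff [tuple z i | i < N] (Ordinal (lekN : (k < N.+1)%N)).
rewrite big_tuple; under eq_bigr do rewrite tnth_mktuple.
rewrite -Pz coef_map /= => eN.
have em : (mesym N T k).@[tnth [tuple z i | i < N]] = (-1) ^+ k * e P`_(N - k)%N.
  by rewrite eN mulrA -exprMn mulrNN mul1r expr1n mul1r.
rewrite map_polyC /= rmorphM rmorphXn rmorphN1 -em.
rewrite /mesym rmorph_sum [meval _ _]rmorph_sum [RHS]rmorph_sum; apply: eq_bigr => h _.
rewrite !rmorph_prod; apply: eq_bigr => i _.
by rewrite /= mmapX mmap1U /= mevalXU tnth_mktuple.
Qed.

(** If every [tau] failed on some relation [Q tau] of [x], all these could be packed into one
    polynomial and multiplied over its conjugates. The product [G] is symmetric, hence computed from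
    the coefficients of [P], so its vanishing at [x] passes to [y]. One factor then vanishes at [y],
    against the choice of the [Q tau]. *)
Lemma roots_specialization :
  exists tau : 'S_N, forall Q : {mpoly R[N]},
    mmap f x Q = 0 -> mmap g (fun i => y (tau i)) Q = 0.
Proof.
apply: NNPP => noT.
have badQ (tau : 'S_N) : {Q : {mpoly R[N]} |
    mmap f x Q = 0 /\ mmap g (fun i => y (tau i)) Q <> 0}.
  apply: constructive_indefinite_description; apply: NNPP => noQ; apply: noT.
  by exists tau => Q Qx; apply: NNPP => Qy; apply: noQ; exists Q.
pose Q tau := sval (badQ tau).
pose up : {mpoly R[N]} -> {mpoly {poly R}[N]} := map_mpoly (@polyC R).
(* Distinct powers of the auxiliary variable keep the [Q tau] apart: the sum vanishes at a point
   only if each of them does. *)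
pose QQ : {mpoly {poly R}[N]} :=
  \sum_(tau : 'S_N) ('X^(enum_rank tau))%:MP * up (Q tau).
have QQE (T : fieldType) (e : {rmorphism R -> T}) (z : 'I_N -> T) :
    mmap (map_poly e) (fun i => (z i)%:P) QQ =
    \sum_(tau : 'S_N) (mmap e z (Q tau))%:P * 'X^(enum_rank tau).
  rewrite rmorph_sum; apply: eq_bigr => tau _.
  rewrite rmorphM /= mmapC /= map_polyXn mulrC; congr (_ * _).
  have -> : up (Q tau) = mmap (@mpolyC N _ \o @polyC R) (fun i => 'X_i) (Q tau) by [].
  rewrite 2!rmorph_mmap /=; apply: eq_mmap => [c|i] /=.
    by rewrite mmapC /= map_polyC.
  by rewrite mmapX mmap1U.
pose G : {mpoly {poly R}[N]} := \prod_(s : 'S_N) msym s QQ.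
have GE (T : fieldType) (e : {rmorphism R -> T}) (z : 'I_N -> T) :
    mmap (map_poly e) (fun i => (z i)%:P) G =
    \prod_(s : 'S_N) \sum_(tau : 'S_N)
       (mmap e (fun i => z (s i)) (Q tau))%:P * 'X^(enum_rank tau).
  rewrite rmorph_prod; apply: eq_bigr => s _.
  by rewrite /= mmap_msym QQE.
have symG : G \is symmetric.
  apply/issymP => s; rewrite /G rmorph_prod [RHS](reindex_inj (mulIg s)) /=.
  by apply: eq_bigr => t _; rewrite msymMm.
have [H [HG _]] := sym_fundamental symG.
pose c := fun i : 'I_N => ((-1) ^+ i.+1 * P`_(N - i.+1)%N)%:P : {poly R}.
have GH (T : fieldType) (e : {rmorphism R -> T}) (z : 'I_N -> T) :
    map_poly e P = \prod_i ('X - (z i)%:P) ->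
    mmap (map_poly e) (fun i => (z i)%:P) G = map_poly e (mmap idfun c H).
  move=> Pz; rewrite -HG mmap_comp_mpoly rmorph_mmap; apply: eq_mmap => // i.
  by rewrite tnth_mktuple mmap_mesym //= ?ltn_ord.
(* The factor of the identity permutation vanishes at [x]. *)
have Gx0 : mmap (map_poly f) (fun i => (x i)%:P) G = 0.
  rewrite GE (bigD1 1%g) //= big1 ?mul0r // => tau _.
  rewrite (_ : mmap _ _ _ = mmap f x (Q tau)); last first.
    by apply: eq_mmap => // i; rewrite perm1.
  by case: (svalP (badQ tau)) => ->; rewrite mul0r.
have Gy0 : mmap (map_poly g) (fun i => (y i)%:P) G = 0.
  rewrite GH //; apply/polyP => i; rewrite coef_map coef0 /=; apply: fg0.
  by move: Gx0; rewrite GH // => /polyP/(_ i); rewrite coef_map coef0.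
(* In the vanishing factor, of index [s], the coefficient at the rank of [s] is the value of [Q s]
   at [y] permuted by [s], which is nonzero. *)
move: Gy0; rewrite GE => /eqP/prodf_eq0[s _ /eqP/polyP/(_ (enum_rank s))].
rewrite coef0 coef_sum (bigD1 s) //= big1 => [|t neq_ts].
  rewrite addr0 coefCM coefXn eqxx mulr1 => Qs0.
  by case: (svalP (badQ s)).
rewrite coefCM coefXn (inj_eq val_inj) (inj_eq enum_rank_inj).
by rewrite eq_sym (negbTE neq_ts) mulr0.
Qed.

End RootSpecialization.

(** With [a] the inverse of [f s], [{poly R}] stands for the localization of [R] at [s]: its
    variable plays [1 / s], and no quotient ring has to be built. *)
Definition eval_ext (R S : comNzRingType) (f : {rmorphism R -> S}) (a : S)
  (q : {poly R}) : S := (map_poly f q).[a].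

HB.instance Definition _ R S f a := GRing.RMorphism.copy (@eval_ext R S f a)
  (horner_eval a \o map_poly f).

Lemma eval_extC (R S : comNzRingType) (f : {rmorphism R -> S}) a c :
  eval_ext f a c%:P = f c.
Proof. by rewrite /eval_ext map_polyC hornerC. Qed.

Lemma eval_extX (R S : comNzRingType) (f : {rmorphism R -> S}) a :
  eval_ext f a 'X = a.
Proof. by rewrite /eval_ext map_polyX hornerX. Qed.

(** A large power of [s] clears the denominators of a value at [1 / s], leaving the image of a
    single element [r] of [R], the same one for [f] and [g]. *)
Lemma invert_specialization (R : comNzRingType) (Z W : fieldType)
    (f : {rmorphism R -> Z}) (g : {rmorphism R -> W}) (s : R) :
    (forall r, f r = 0 -> g r = 0) -> g s != 0 ->
  forall q, eval_ext f (f s)^-1 q = 0 -> eval_ext g (g s)^-1 q = 0.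
Proof.
move=> fg0 gs0 q; pose n := size q.
have fs0 : f s != 0 by apply: contraNneq gs0 => /fg0->.
pose r := \sum_(i < n) q`_i * s ^+ (n - i).
have clear_den (T : fieldType) (h : {rmorphism R -> T}) : h s != 0 ->
    h s ^+ n * eval_ext h (h s)^-1 q = h r.
  move=> hs0; rewrite /eval_ext (@horner_coef_wide _ n) ?size_poly // mulr_sumr.
  rewrite rmorph_sum; apply: eq_bigr => i _; rewrite coef_map rmorphM rmorphXn.
  rewrite /= mulrCA; congr (_ * _).
  by rewrite exprVn -expfB // ltn_ord.
by move=> fq0; apply/eqP; move: (clear_den _ f fs0) (clear_den _ g gs0);
   rewrite fq0 mulr0 => /esym/fg0-> /eqP; rewrite mulf_eq0 expf_eq0 (negPf gs0) andbF.
Qed.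

(** * Splitting fields, and Galois elements obtained from polynomial relations *)

Lemma irreducible_factor (F : fieldType) (p : {poly F}) :
  (1 < size p)%N -> exists2 r, r %| p & irreducible_poly r.
Proof.
move: {2}(size p) (leqnn (size p)) => n; elim: n p => [|n IHn] p szp p_gt1.
  by rewrite leqNgt ltnW in szp.
have [irr_p|] := classic (irreducible_poly p); first by exists p.
move=> red_p; have [q [szq qp Nqp]] :
    exists q : {poly F}, [/\ size q != 1%N, q %| p & ~~ (q %= p)].
  apply: NNPP => noq; apply: red_p; split=> // q szq qp; apply/negPn/negP => Nqp.
  by apply: noq; exists q.
have p0 : p != 0 by rewrite -size_poly_gt0 ltnW.
have q0 : q != 0 by apply: dvdpN0 qp p0.
have ltqp : (size q < size p)%N.
  by rewrite ltn_neqAle dvdp_leq // andbT dvdp_size_eqp.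
have [||r rq irr_r] := IHn q; first by rewrite -ltnS (leq_trans ltqp).
  by rewrite ltn_neqAle eq_sym szq size_poly_gt0.
by exists r => //; apply: dvdp_trans rq qp.
Qed.

Lemma splits_in_extension (F : fieldType) (p : {poly F}) : p != 0 ->
  exists (L : fieldExtType F) (rs : seq L),
    map_poly (in_alg L) p %= \prod_(z <- rs) ('X - z%:P).
Proof.
move: {2}(size p) (leqnn (size p)) => n; elim: n F p => [|n IHn] F p szp p0.
  by rewrite leqn0 size_poly_eq0 (negPf p0) in szp.
have [p_le1|p_gt1] := leqP (size p) 1.
  exists F^o, [::].
  by rewrite big_nil -size_poly_eq1 size_map_poly eqn_leq p_le1 size_poly_gt0.
have [r rp irr_r] := irreducible_factor p_gt1.
have [K _ [x rx0 _]] := irredp_FAdjoin irr_r.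
have /factor_theorem[q Dp] : root (map_poly (in_alg K) p) x.
  by rewrite -(divpK rp) rmorphM rootM rx0 orbT.
have szpq : size p = size (q * ('X - x%:P)) by rewrite -Dp size_map_poly.
have q0 : q != 0.
  by apply: contraNneq p0 => q0; rewrite -size_poly_eq0 szpq q0 mul0r size_poly0.
have [|L [rs Dq]] := IHn K q _ q0.
  by move: szp; rewrite szpq size_mul ?polyXsubC_eq0 // size_XsubC addn2.
exists (baseFieldType L), (x%:A :: rs).
have -> : map_poly (in_alg (baseFieldType L)) p =
          map_poly (in_alg L) (map_poly (in_alg K) p).
  rewrite -map_poly_comp; apply: eq_map_poly => a /=.
  exact: (baseField_scaleE a 1).
rewrite Dp rmorphM rmorphB /= map_polyX map_polyC big_cons mulrC.
exact: eqp_mull.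
Qed.

(** The subfield generated by the roots inside an extension where [p] splits, made into a type of
    its own. *)
Lemma splitting_field_exists (F : fieldType) (p : {poly F}) : p != 0 ->
  exists L : splittingFieldType F,
    splittingFieldFor 1 (map_poly (in_alg L) p) {:L}.
Proof.
move=> p0; have [L [ys Dp]] := splits_in_extension p0.
pose Lp := subvs_of <<1 & ys>>; pose toL := linfun (vsval : Lp -> L).
have [zs Dys] : exists zs, map toL zs = ys.
  exists (map (vsproj _) ys); rewrite -map_comp map_id_in // => y ys_y.
  by rewrite /= lfunE /= vsprojK ?seqv_sub_adjoin.
have splitLp : splittingFieldFor 1 (map_poly (in_alg Lp) p) {:Lp}.
  exists zs.
    rewrite -(eqp_map toL).
    have -> : map_poly toL (map_poly (in_alg Lp) p) = map_poly (in_alg L) p.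
      by rewrite -map_poly_comp; apply: eq_map_poly => a; apply: rmorph_alg.
    apply: eqp_trans Dp _; apply: eqpW.
    rewrite rmorph_prod -[in LHS]Dys big_map.
    by apply: eq_bigr => z _; rewrite rmorphB /= map_polyX map_polyC.
  apply/vspaceP => u; rewrite memvf.
  have : val u \in (toL @: <<1 & zs>>)%VS.
    by rewrite aimg_adjoin_seq aimg1 Dys (valP u).
  by case/memv_imgP=> v vzs; rewrite lfunE => /val_inj ->.
have ax : splitting_field_axiom Lp.
  exists (map_poly (in_alg Lp) p) => //.
  by apply/polyOverP => i; rewrite coef_map /= rpredZ ?rpred1.
pose M := FieldExt_isSplittingField.Build F Lp ax.
by exists (HB.pack_for (splittingFieldType F) Lp M).
Qed.

Lemma mpoly_descent (F : fieldType) (L : fieldExtType F) n (p : {mpoly L[n]}) :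
  (forall m, p@_m \in 1%VS) -> exists Q : {mpoly F[n]}, map_mpoly (in_alg L) Q = p.
Proof.
move=> p1.
have c_ m : {c : F | p@_m = c%:A}.
  apply: constructive_indefinite_description.
  by have /vlineP[c Dc] := p1 m; exists c.
exists (\sum_(m <- msupp p) sval (c_ m) *: 'X_[m]).
rewrite rmorph_sum [RHS]mpolyE; apply: eq_bigr => m _.
rewrite [LHS](map_mpolyZ (in_alg L)) map_mpolyX; congr (_ *: _).
by rewrite [RHS](svalP (c_ m)).
Qed.

Lemma meval_map_mpoly (R S : comNzRingType) (f : {rmorphism R -> S}) n
    (x : 'I_n -> S) Q : (map_mpoly f Q).@[x] = mmap f x Q.
Proof.
rewrite [LHS]rmorph_mmap; apply: eq_mmap => [c|i] /=; first exact: mevalC.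
exact: mevalXU.
Qed.

(* The witness relation is the norm of [sum_i (Y_i - r_i) X^i] over the Galois
   group: it vanishes at [r], hence at [r'], and then one factor vanishes. *)
Lemma gal_extends_relations (F : fieldType) (L : splittingFieldType F) n
    (r r' : 'I_n -> L) :
    galois 1 {:L} ->
    (forall Q : {mpoly F[n]}, mmap (in_alg L) r Q = 0 -> mmap (in_alg L) r' Q = 0) ->
  exists2 s, s \in 'Gal({:L} / 1%VS)%g & forall i, s (r i) = r' i.
Proof.
move=> galL rel.
pose fac (s : gal_of {:L}) : {poly {mpoly L[n]}} :=
  \sum_(i < n) ('X_i - (s (r i))%:MP)%:P * 'X^i.
pose T := \prod_(s in 'Gal({:L} / 1%VS)%g) fac s.
have TE z : map_poly (meval z) T =
    \prod_(s in 'Gal({:L} / 1%VS)%g) \sum_(i < n) (z i - s (r i))%:P * 'X^i.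
  rewrite rmorph_prod; apply: eq_bigr => s _; rewrite rmorph_sum.
  apply: eq_bigr => i _; rewrite rmorphM /= map_polyC map_polyXn /=.
  by rewrite mevalB mevalXU mevalC.
have Tinv s : s \in 'Gal({:L} / 1%VS)%g -> map_poly (map_mpoly s) T = T.
  move=> sG; rewrite rmorph_prod [RHS](reindex_inj (mulIg s)) /=.
  apply: eq_big => [t|t _]; first by rewrite groupMr.
  rewrite rmorph_sum; apply: eq_bigr => i _; rewrite rmorphM /= map_polyC map_polyXn.
  by rewrite /= rmorphB /= map_mpolyX map_mpolyC /= galM ?memvf.
have [Q QT] : exists Q : nat -> {mpoly F[n]},
    forall j, map_mpoly (in_alg L) (Q j) = T`_j.
  apply: (choice (fun j (Q : {mpoly F[n]}) => map_mpoly (in_alg L) Q = T`_j)) => j.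
  apply: mpoly_descent => m; rewrite -(galois_fixedField galL).
  apply/fixedFieldP => [|s sG]; first exact: memvf.
  have /(congr1 (fun p : {poly _} => (p`_j)@_m)) := Tinv s sG.
  by rewrite coef_map /= mcoeff_map_mpoly.
have Tr0 : map_poly (meval r) T = 0.
  rewrite TE (bigD1 1%g) ?group1 //= big1 ?mul0r // => i _.
  by rewrite gal_id subrr mul0r.
have : map_poly (meval r') T = 0.
  apply/polyP => j; rewrite coef_map coef0 /= -QT meval_map_mpoly; apply: rel.
  by rewrite -meval_map_mpoly QT; move/polyP/(_ j): Tr0; rewrite coef_map coef0.
rewrite TE => /eqP/prodf_eq0[s sG /eqP s0]; exists s => // i.
move/polyP/(_ i): s0; rewrite coef0 coef_sum (bigD1 i) //= big1 => [|j nji].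
  by rewrite addr0 coefCM coefXn eqxx mulr1 => /eqP; rewrite subr_eq0 => /eqP.
by rewrite coefCM coefXn (inj_eq val_inj) eq_sym (negPf nji) mulr0.
Qed.

(** Turns the nonvanishing of an algebraic element into an equation over [K], which can be
    transported like any other relation. *)
Lemma algebraic_inverse (K : fieldType) (L : fieldExtType K) (z : L) :
  z != 0 -> exists p : {poly K}, z * (map_poly (in_alg L) p).[z] = 1.
Proof.
move=> z0; have : z^-1 \in <<1; z>>%VS by rewrite rpredV memv_adjoin.
case/Fadjoin_polyP => q q1 Dz.
have [p Dp] : exists p : {poly K}, map_poly (in_alg L) p = q.
  have c_ i : {c : K | q`_i = c%:A}.
    apply: constructive_indefinite_description.
    by have /vlineP[c Dc] := polyOverP q1 i; exists c.
  exists (\poly_(i < size q) sval (c_ i)); apply/polyP => i.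
  rewrite coef_map coef_poly /=; case: ltnP => [_|le]; last by rewrite scale0r nth_default.
  by rewrite -(svalP (c_ i)).
by exists p; rewrite Dp -Dz mulfV.
Qed.

(** Over a field the specialization of roots is reversible: if [Q] does not vanish at [x], its value
    has an inverse that is a polynomial in it, and this relation [Q'] also forbids [Q] to vanish at
    the permuted [y]. *)
Lemma embed_roots (K : fieldType) (L : fieldExtType K) (W : fieldType)
    (psi : {rmorphism K -> W}) N (P : {poly K}) (x : 'I_N -> L) (y : 'I_N -> W) :
    map_poly (in_alg L) P = \prod_i ('X - (x i)%:P) ->
    map_poly psi P = \prod_i ('X - (y i)%:P) ->
  exists tau : 'S_N, forall Q : {mpoly K[N]},
    mmap (in_alg L) x Q = 0 <-> mmap psi (fun i => y (tau i)) Q = 0.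
Proof.
move=> Px Py; have [|tau tauP] := roots_specialization _ Px Py.
  by move=> r /eqP; rewrite fmorph_eq0 => /eqP->; rewrite rmorph0.
exists tau => Q; split=> [|Q0]; first exact: tauP.
apply/eqP; apply: contraT => z0; have [p pz] := algebraic_inverse z0.
pose Q' := Q * (map_poly (@mpolyC N K) p).[Q] - 1.
have Q'E (T : fieldType) (e : {rmorphism K -> T}) (h : 'I_N -> T) :
    mmap e h Q' = mmap e h Q * (map_poly e p).[mmap e h Q] - 1.
  rewrite rmorphB rmorph1 rmorphM -horner_map /= -map_poly_comp.
  congr (_ * _.[_] - 1); apply: eq_map_poly => c /=; exact: mmapC.
have /tauP : mmap (in_alg L) x Q' = 0 by rewrite Q'E pz subrr.
by rewrite Q'E Q0 mul0r sub0r => /eqP; rewrite oppr_eq0 oner_eq0.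
Qed.

Lemma root_prod_ord (R : idomainType) N (x : 'I_N -> R) z :
  root (\prod_i ('X - (x i)%:P)) z -> exists i, z = x i.
Proof.
rewrite -big_enum -(big_map x predT (fun a => 'X - a%:P)) root_prod_XsubC.
by case/mapP => i _ ->; exists i.
Qed.

Lemma gal_eq1_on_generators (E : fieldType) (W : splittingFieldType E) (rs : seq W)
    (s : gal_of {:W}) :
  <<1 & rs>>%VS = {:W}%VS -> {in rs, forall z, s z = z} -> s = 1%g.
Proof.
move=> gen fix_s; apply/eqP/gal_eqP => a _; rewrite gal_id.
have /subvP/(_ a) : (<<1 & rs>> <= fixedField [set s])%VS.
  apply/Fadjoin_seqP; split=> [|z rz]; first exact: sub1v.
  by apply/fixedFieldP => [|t /set1P->]; rewrite ?memvf ?fix_s.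
by rewrite gen memvf => /(_ isT)/fixedFieldP-> //; rewrite ?memvf ?set11.
Qed.

(** * Fractions, and the integral closedness of [F[X]] *)

Lemma fraction_repr (R : idomainType) (z : {fraction R}) :
  exists n d : R, d != 0 /\ z = tofrac n / tofrac d.
Proof.
elim/quotW: z => z; case: z => -[n d] /= d0; exists n, d; split=> //.
rewrite -[_^-1]/(FracField.inv _) -[_ * _]/(FracField.mul _ _) /tofrac -lock.
rewrite -FracField.pi_inv -FracField.pi_mul; apply/eqP; rewrite piE.
rewrite /FracField.equivf /FracField.mulf /FracField.invf /=.
by rewrite !numden_Ratio ?mulf_neq0 ?oner_eq0 //= mul1r mulr1 mulrC.
Qed.

Lemma clear_denominators (R : comNzRingType) (E : fieldType) (f : {rmorphism R -> E})
    (p : {poly R}) n d (m := (size p).-1) :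
    f d != 0 -> root (map_poly f p) (f n / f d) ->
  f (\sum_(i < m.+1) p`_i * (n ^+ i * d ^+ (m - i))) = 0.
Proof.
move=> fd0 /rootP pt0; rewrite -[RHS](mulr0 (f d ^+ m)) -pt0.
rewrite (@horner_coef_wide _ m.+1); last first.
  by apply: leq_trans (size_poly _ _) _; rewrite /m; case: (size p).
rewrite mulr_sumr rmorph_sum; apply: eq_bigr => i _.
rewrite !rmorphM !rmorphXn coef_map [RHS]mulrCA expr_div_n; congr (_ * _).
rewrite [RHS]mulrCA; congr (_ * _).
by apply/(canRL (mulfK _)); rewrite ?expf_neq0 // -exprD subnK // -ltnS.
Qed.

(** The rational root argument: in lowest terms the denominator divides a power of the numerator, so
    it is a constant. *)
Lemma polynomials_integrally_closed (F : fieldType) (t : {fraction {poly F}}) :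
  integralOver (@tofrac {poly F}) t -> exists r, t = tofrac r.
Proof.
case=> p mp pt0; have [n0 [d0 [d0_neq0 Dt]]] := fraction_repr t.
pose g := gcdp n0 d0; pose n := n0 %/ g; pose d := d0 %/ g.
have g0 : g != 0 by rewrite gcdp_eq0 negb_and d0_neq0 orbT.
have Dn0 : n0 = n * g by rewrite divpK // dvdp_gcdl.
have Dd0 : d0 = d * g by rewrite divpK // dvdp_gcdr.
have d_neq0 : d != 0 by apply: contraNneq d0_neq0 => d0'; rewrite Dd0 d0' mul0r.
have nd : coprimep n d by rewrite coprimep_div_gcd // d0_neq0 orbT.
clearbody n d; have fd0 : tofrac d != 0 by rewrite tofrac_eq0.
have {}Dt : t = tofrac n / tofrac d.
  apply/eqP; rewrite Dt eqr_div ?tofrac_eq0 // -!tofracM tofrac_eq.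
  by rewrite Dn0 Dd0 mulrA mulrAC.
have p_gt0 : (0 < size p)%N by rewrite size_poly_gt0 monic_neq0.
pose m := (size p).-1.
have Dp : size p = m.+1 by rewrite prednK.
have dn : d %| n ^+ m.
  have := clear_denominators fd0 (eq_ind _ (root _) pt0 _ Dt).
  move/eqP; rewrite tofrac_eq0 big_ord_recr /= subnn expr0 mulr1.
  have -> : p`_m = 1 by move/monicP: mp; rewrite lead_coefE.
  rewrite mul1r addrC addr_eq0 => /eqP->; rewrite dvdpNr.
  elim/big_rec: _ => [|i q _ dq]; first exact: dvdp0.
  rewrite dvdp_addr // !dvdp_mull //.
  by rewrite -subnSK // exprS dvdp_mulIl.
have : coprimep d (n ^+ m) by rewrite coprimep_sym coprimep_expl.
move/coprimepP/(_ d (dvdpp d) dn); rewrite -size_poly_eq1 => /size_poly1P[c c0 Dd].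
exists (c^-1 *: n); rewrite Dt Dd -mul_polyC tofracM mulrC; congr (_ * _).
apply: (mulIf (x := tofrac c%:P)); first by rewrite tofrac_eq0 polyC_eq0.
by rewrite mulVf ?tofrac_eq0 ?polyC_eq0 // -tofracM -polyCM mulVf.
Qed.

Lemma big_split2 (R : comNzRingType) N (i1 i2 : 'I_N) (G : 'I_N -> R) : i1 != i2 ->
  \prod_i G i = G i1 * G i2 * \prod_(i | (i != i1) && (i != i2)) G i.
Proof. by move=> n12; rewrite (bigD1 i1) // (bigD1 i2) 1?eq_sym //= mulrA. Qed.

(** * A uniformizer at a point where exactly two roots meet *)

Section LocalParameter.
Variables (F W : fieldType) (S : comNzRingType) (N : nat).
Variables (vx : {rmorphism S -> W}) (vy : {rmorphism S -> F}).
Variables (C : {rmorphism {poly F} -> S}) (X : 'I_N -> S).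
Variables (P : {poly {poly F}}) (c : F) (i1 i2 : 'I_N).

Hypothesis S_ind : forall D : S -> Prop, (forall r, D (C r)) -> (forall i, D (X i)) ->
  (forall a b, D a -> D b -> D (a + b)) -> (forall a b, D a -> D b -> D (a * b)) ->
  forall Q, D Q.
Hypothesis vC_inj : forall r, vx (C r) = 0 -> r = 0.
Hypothesis vyC : forall r, vy (C r) = r.[0].
Hypothesis Px : map_poly (vx \o C) P = \prod_i ('X - (vx (X i))%:P).
Hypothesis Py : map_poly (vy \o C) P = \prod_i ('X - (vy (X i))%:P).
Hypothesis y1 : vy (X i1) = c.
Hypothesis y2 : vy (X i2) = c.
Hypothesis neq_i12 : i1 != i2.
Hypothesis y_inj : forall i j, i != j -> vy (X i) = vy (X j) ->
  (i = i1 /\ j = i2) \/ (i = i2 /\ j = i1).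
Hypothesis Pc1 : (P.[c%:P])`_1 != 0.

(** [S] stands for a polynomial ring over [F[eps]] in variables for the roots, [vx] for its generic
    point and [vy] for its point over [eps = 0]. This element vanishes at the latter and turns out
    to generate the maximal ideal there. *)
Definition unif : S := X i1 - C c%:P.
Local Notation pi1 := unif.
Local Notation cst a := (C a%:P).
Local Notation eps := (C 'X).

Let vycst a : vy (cst a) = a. Proof. by rewrite vyC hornerC. Qed.

Let vxM a b : vx (a * b) = vx a * vx b. Proof. exact: rmorphM. Qed.
Let vxD a b : vx (a + b) = vx a + vx b. Proof. exact: rmorphD. Qed.
Let vxB a b : vx (a - b) = vx a - vx b. Proof. exact: rmorphB. Qed.
Let vxN a : vx (- a) = - vx a. Proof. exact: rmorphN. Qed.
Let vyM a b : vy (a * b) = vy a * vy b. Proof. exact: rmorphM. Qed.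
Let vyD a b : vy (a + b) = vy a + vy b. Proof. exact: rmorphD. Qed.
(* [near p Q]: [Q] lies in the ideal generated by [p] in the local ring of
   [F[eps][x_1, ..., x_N]] at the point [y] over [eps = 0]. *)
Definition near (p Q : S) := exists u w, vy u != 0 /\ vx (u * Q) = vx (p * w).

Lemma near_add p Q Q' : near p Q -> near p Q' -> near p (Q + Q').
Proof.
case=> u [w [u0 e]] [u' [w' [u'0 e']]]; exists (u * u'), (w * u' + w' * u).
split; first by rewrite vyM mulf_neq0.
have -> : u * u' * (Q + Q') = u * Q * u' + u' * Q' * u.
  by ring.
by rewrite vxD (vxM _ u') (vxM _ u) e e' !vxM vxD !vxM; ring.
Qed.

Lemma near_mul p Q Q' : near p Q -> near p (Q * Q').
Proof.
case=> u [w [u0 e]]; exists u, (w * Q'); split=> //.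
by rewrite !mulrA vxM e -vxM.
Qed.

Let near_unit p u Q : vy u != 0 -> near p (u * Q) -> near p Q.
Proof.
move=> u0 [u' [w [u'0 e]]]; exists (u' * u), w; split; last by rewrite -mulrA.
by rewrite vyM mulf_neq0.
Qed.

Lemma near_vx p Q Q' : vx Q = vx Q' -> near p Q -> near p Q'.
Proof.
move=> QQ' [u [w [u0 e]]]; exists u, w; split=> //.
by rewrite -e !vxM QQ'.
Qed.

Lemma near_self p : near p p.
Proof. by exists 1, 1; rewrite rmorph1 oner_neq0 mul1r mulr1. Qed.

Let near0 p : near p 0.
Proof. by exists 1, 0; rewrite rmorph1 oner_neq0 !mulr0. Qed.

Lemma near_sum p (I : finType) (A : pred I) (G : I -> S) :
  (forall i, A i -> near p (G i)) -> near p (\sum_(i | A i) G i).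
Proof. by move=> nG; elim/big_ind: _ => //; apply: near_add. Qed.

Lemma near_opp p Q : near p Q -> near p (- Q).
Proof. by move=> nQ; rewrite -mulrN1; apply: near_mul. Qed.

Lemma near_prod p Q Q' : near p Q -> near p Q' -> near (p ^+ 2) (Q * Q').
Proof.
case=> u [w [u0 e]] [u' [w' [u'0 e']]]; exists (u * u'), (w * w').
split; first by rewrite vyM mulf_neq0.
have -> : u * u' * (Q * Q') = (u * Q) * (u' * Q') by rewrite mulrACA.
have -> : p ^+ 2 * (w * w') = (p * w) * (p * w') by rewrite mulrACA.
by rewrite vxM (vxM (p * w)) e e'.
Qed.

Let oth := [pred i : 'I_N | (i != i1) && (i != i2)].
Let G : {poly S} := \prod_(i | oth i) ('X - (X i)%:P).
Let PP : {poly S} := ('X - (X i1)%:P) * ('X - (X i2)%:P) * G.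
Let R0 := \prod_(i | oth i) (cst c - X i).

Let PPx : map_poly vx PP = map_poly (vx \o C) P.
Proof.
have vxXX i : map_poly vx ('X - (X i)%:P) = 'X - (vx (X i))%:P.
  by rewrite rmorphB /= map_polyX map_polyC.
rewrite Px (big_split2 _ neq_i12) /PP rmorphM; congr (_ * _).
  by rewrite rmorphM; congr (_ * _); apply: vxXX.
by rewrite rmorph_prod; apply: eq_bigr => i _; apply: vxXX.
Qed.

Let vxCP (Q : {poly {poly F}}) r : (map_poly (vx \o C) Q).[vx (C r)] = vx (C Q.[r]).
Proof. by rewrite (horner_map (vx \o C)). Qed.

Let eval_PP (r : {poly F}) : vx PP.[C r] = vx (C P.[r]).
Proof. by rewrite -vxCP -PPx horner_map. Qed.

Let eval_PP' (r : {poly F}) : vx (PP^`()).[C r] = vx (C P^`().[r]).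
Proof. by rewrite -vxCP -deriv_map -PPx deriv_map horner_map. Qed.

Let eps_dvd (r : {poly F}) : r.[0] = 0 -> exists b, r = 'X * b.
Proof.
move=> r0; have /factor_theorem[b ->] : root r 0 by apply/rootP.
by exists b; rewrite subr0 mulrC.
Qed.

Let vyCP (Q : {poly {poly F}}) a : (Q.[a%:P]).[0] = (map_poly (vy \o C) Q).[a].
Proof. by rewrite -vyC -[a in RHS]vycst (horner_map (vy \o C)). Qed.

Let oth_y i : oth i -> vy (X i) != c.
Proof.
case/andP=> n1 n2; apply/eqP => yc.
have [|[e _]|[e _]] := y_inj n1; first by rewrite y1.
  by rewrite e eqxx in n1.
by rewrite e eqxx in n2.
Qed.

Let unit_prod (B : pred 'I_N) a : (forall i, B i -> vy (X i) != a) ->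
  vy (\prod_(i | B i) (cst a - X i)) != 0.
Proof.
move=> ya; rewrite rmorph_prod; apply/prodf_neq0 => i Bi.
by rewrite rmorphB vycst subr_eq0 eq_sym ya.
Qed.

Let R0_unit : vy R0 != 0. Proof. exact: unit_prod oth_y. Qed.

Let hornerG : G.[cst c] = R0.
Proof. by rewrite horner_prod; apply: eq_bigr => i _; rewrite hornerXsubC. Qed.

Let PP_c : PP.[cst c] = pi1 * (X i2 - cst c) * R0.
Proof. by rewrite !hornerM !hornerXsubC hornerG /unif; ring. Qed.

Let PP'_c : PP^`().[cst c] =
  - ((X i2 - cst c) + pi1) * R0 + pi1 * (X i2 - cst c) * G^`().[cst c].
Proof.
rewrite /PP derivM derivM !derivXsubC mul1r mulr1.
by rewrite !(hornerD, hornerM, hornerN, hornerX, hornerC) hornerG /unif; ring.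
Qed.

Let root_c : (P.[c%:P]).[0] = 0.
Proof. by rewrite vyCP Py horner_prod (bigD1 i1) //= hornerXsubC y1 subrr mul0r. Qed.

Let root'_c : (P^`().[c%:P]).[0] = 0.
Proof.
rewrite vyCP -deriv_map Py (big_split2 _ neq_i12) y1 y2.
by rewrite derivM derivM !derivXsubC !(hornerD, hornerM, hornerN, hornerX, hornerC); ring.
Qed.

(** Two equations are read in the local ring. [P(c) = pi1 * (X i2 - c) * R0] is [eps] times a unit
    by [Pc1], so [eps] is a multiple of [pi1]. [P'(c)] is a multiple of [eps] because [c] is a
    double root at [eps = 0], and its expansion then makes [X i2 - c] a multiple of [pi1]. Back in
    the first equation, [eps] is a multiple of [pi1 ^+ 2]. *)
Lemma unif_ramified : [/\ near pi1 (X i2 - cst c), near (pi1 ^+ 2) eps & vx pi1 != 0].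
Proof.
have [a Da] := eps_dvd root_c.
have a0 : a.[0] != 0 by rewrite horner_coef0; move: Pc1; rewrite Da mulrC coefMX.
have Ea : vx (eps * C a) = vx (pi1 * (X i2 - cst c) * R0).
  by rewrite -PP_c eval_PP Da (rmorphM C).
have ua : vy (C a) != 0 by rewrite vyC.
have near_eps : near pi1 eps.
  exists (C a), ((X i2 - cst c) * R0); split=> //.
  by rewrite mulrC Ea mulrA.
have n2 : near pi1 (X i2 - cst c).
  have [b Db] := eps_dvd root'_c.
  apply: (near_unit R0_unit).
  have e : vx (C b * eps) = vx PP^`().[cst c] by rewrite eval_PP' Db mulrC (rmorphM C).
  apply: (near_vx (Q := - (eps * C b) - pi1 * R0 + pi1 * ((X i2 - cst c) * G^`().[cst c]))).
    rewrite vxD vxB vxN mulrC e PP'_c -vxN -vxB -vxD; congr (vx _); ring.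
  apply: near_add; last exact/near_mul/near_self.
  apply: near_add; apply: near_opp; first exact: near_mul.
  exact/near_mul/near_self.
split=> //.
  apply: (near_unit ua); rewrite mulrC.
  apply: (near_vx (esym Ea)); apply: near_mul; exact: near_prod (near_self _) n2.
apply/eqP => p0; have /eqP : vx (eps * C a) = 0 by rewrite Ea !vxM p0 !mul0r.
rewrite vxM mulf_eq0 => /orP[] /eqP/vC_inj => [/eqP|a00].
  by rewrite polyX_eq0.
by rewrite a00 horner0 eqxx in a0.
Qed.

Let near_eps : near pi1 eps.
Proof.
have [_ [u [w [u0 e]]] _] := unif_ramified.
by exists u, (pi1 * w); rewrite mulrA.
Qed.

Let near_root i : near pi1 (X i - cst (vy (X i))).
Proof.
have [n2 _ _] := unif_ramified.
have [->|ni1] := eqVneq i i1; first by rewrite y1; apply: near_self.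
have [->|ni2] := eqVneq i i2; first by rewrite y2.
set a := vy (X i).
have [b Db] : exists b, P.[a%:P] = 'X * b.
  by apply: eps_dvd; rewrite vyCP Py horner_prod (bigD1 i) //= hornerXsubC subrr mul0r.
(* The root is simple, so [Ri] is a unit, and [Ri * (a - X i) = P(a)] is a multiple of [eps]. *)
pose Ri := \prod_(j | j != i) (cst a - X j).
have Ri_unit : vy Ri != 0.
  apply: unit_prod => j nji; apply/eqP => yji.
  by have [[_ e]|[_ e]] := y_inj nji yji; [move: ni2|move: ni1]; rewrite e eqxx.
apply: (near_unit Ri_unit).
have e : vx (C b * eps) = vx (Ri * (cst a - X i)).
  rewrite mulrC -rmorphM -Db -vxCP Px horner_prod (bigD1 i) //=.
  rewrite hornerXsubC mulrC vxM vxB rmorph_prod; congr (_ * _).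
  by apply: eq_bigr => j _; rewrite hornerXsubC vxB.
apply: (near_vx (Q := - (eps * C b))); last exact/near_opp/near_mul.
by rewrite vxN mulrC e -vxN; congr (vx _); ring.
Qed.

(** The residue field is [F] itself, so after subtracting the constant [vy Q] it is enough to treat
    [eps] and the differences between the roots and their values. *)
Lemma near_unif Q : vy Q = 0 -> near pi1 Q.
Proof.
suff DQ : near pi1 (Q - cst (vy Q)).
  by move=> Q0; move: DQ; rewrite Q0 !rmorph0 subr0.
elim/S_ind: Q => [r|i|a b Da Db|a b Da Db]; last 2 first.
- rewrite vyD !rmorphD opprD addrACA; exact: near_add.
- have -> : a * b - cst (vy (a * b)) =
      (a - cst (vy a)) * b + (b - cst (vy b)) * cst (vy a).
    by rewrite vyM polyCM rmorphM; ring.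
  by apply: near_add; apply: near_mul.
- rewrite vyC -rmorphB.
  have [|b ->] := @eps_dvd (r - r.[0]%:P); first by rewrite !hornerE subrr.
  by rewrite rmorphM; apply: near_mul.
- exact: near_root.
Qed.

End LocalParameter.

(** * The inertia group at the double root *)

Section InertiaTransposition.
Variables (F E : fieldType) (f0 : {rmorphism {poly F} -> E}).
Hypothesis f0_inj : forall r, f0 r = 0 -> r = 0.
Hypothesis f0_closed : forall t, integralOver f0 t -> exists r, t = f0 r.
Variables (W : splittingFieldType E) (N : nat) (P : {poly {poly F}}).
Variables (x : 'I_N -> W) (y : 'I_N -> F) (c : F) (i1 i2 : 'I_N).

Let f : {rmorphism {poly F} -> W} := in_alg W \o f0.
Let ev0 : {rmorphism {poly F} -> F} := horner_eval 0.

Hypothesis galW : galois 1 {:W}.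
Hypothesis P_monic : P \is monic.
Hypothesis Px : map_poly f P = \prod_i ('X - (x i)%:P).
Hypothesis x_inj : injective x.
Hypothesis x_gen : <<1 & codom x>>%VS = {:W}%VS.
Hypothesis Py : map_poly ev0 P = \prod_i ('X - (y i)%:P).
Hypothesis y1 : y i1 = c.
Hypothesis y2 : y i2 = c.
Hypothesis neq_i12 : i1 != i2.
Hypothesis y_inj : forall i j, i != j -> y i = y j ->
  (i = i1 /\ j = i2) \/ (i = i2 /\ j = i1).
Hypothesis Pc1 : (P.[c%:P])`_1 != 0.
Hypothesis xy : forall Q : {mpoly {poly F}[N]}, mmap f x Q = 0 -> mmap ev0 y Q = 0.

Local Notation S := {mpoly {poly F}[N]}.
Let vx : {rmorphism S -> W} := mmap f x.
Let vy : {rmorphism S -> F} := mmap ev0 y.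
Let C : {rmorphism {poly F} -> S} := @mpolyC N {poly F}.
Let X (i : 'I_N) : S := 'X_i.

Let vxC r : vx (C r) = f r. Proof. exact: mmapC. Qed.
Let vyC r : vy (C r) = r.[0]. Proof. exact: mmapC. Qed.
Let vxX i : vx (X i) = x i. Proof. by rewrite /vx /X /= mmapX mmap1U. Qed.
Let vyX i : vy (X i) = y i. Proof. by rewrite /vy /X /= mmapX mmap1U. Qed.

Let S_ind (D : S -> Prop) : (forall r, D (C r)) -> (forall i, D (X i)) ->
  (forall a b, D a -> D b -> D (a + b)) -> (forall a b, D a -> D b -> D (a * b)) ->
  forall Q, D Q.
Proof.
move=> DC DX DD DM Q; rewrite [Q]mpolyE.
have D0 : D 0 by rewrite -(rmorph0 C); apply: DC.
have D1 : D 1 by rewrite -(rmorph1 C); apply: DC.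
elim/big_ind: _ => [||m _]; [exact: D0| by move=> a b Da Db; exact: (DD a b Da Db)|].
rewrite -mul_mpolyC; apply: (DM); first exact: DC.
rewrite mpolyXE_id; elim/big_ind: _ => [||i _]; [exact: D1| by move=> a b Da Db; exact: (DM a b Da Db)|].
by elim: (m i) => [|k IHk]; rewrite ?expr0 // exprS; apply: (DM) => //; apply: (DX).
Qed.

Let vC_inj r : vx (C r) = 0 -> r = 0.
Proof. by rewrite vxC => /eqP; rewrite fmorph_eq0 => /eqP/f0_inj. Qed.

Let Px' : map_poly (vx \o C) P = \prod_i ('X - (vx (X i))%:P).
Proof.
rewrite (eq_map_poly (g := f)) ?Px; first by apply: eq_bigr => i _; rewrite vxX.
exact: vxC.
Qed.

Let Py' : map_poly (vy \o C) P = \prod_i ('X - (vy (X i))%:P).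
Proof.
rewrite (eq_map_poly (g := ev0)) ?Py; first by apply: eq_bigr => i _; rewrite vyX.
exact: vyC.
Qed.

Let y1' : vy (X i1) = c. Proof. by rewrite vyX. Qed.
Let y2' : vy (X i2) = c. Proof. by rewrite vyX. Qed.
Let y_inj' i j : i != j -> vy (X i) = vy (X j) ->
  (i = i1 /\ j = i2) \/ (i = i2 /\ j = i1).
Proof. by rewrite !vyX; apply: y_inj. Qed.

Let pi1 : S := unif C X c i1.
Let nearS := near vx vy.

Let ramified := unif_ramified vC_inj vyC Px' Py' y1' y2' neq_i12 y_inj' Pc1.
Let maxS := near_unif S_ind vC_inj vyC Px' Py' y1' y2' neq_i12 y_inj' Pc1.

Lemma gal_permutes_roots s : s \in 'Gal({:W} / 1%VS)%g ->
  exists p : 'S_N, forall i, s (x i) = x (p i).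
Proof.
move=> sG; have Psx i : exists j, s (x i) = x j.
  have : root (map_poly f P) (s (x i)).
    have -> : map_poly f P = map_poly s (map_poly f P).
      rewrite -map_poly_comp; apply: eq_map_poly => r /=.
      by rewrite rmorph_alg.
    by rewrite fmorph_root Px (bigD1 i) //= rootM root_XsubC eqxx.
  by rewrite Px => /root_prod_ord.
have [p pP] := choice _ Psx.
have p_inj : injective p.
  by move=> i j e; have := congr1 x e; rewrite -!pP => /fmorph_inj/x_inj.
by exists (perm p_inj) => i; rewrite permE.
Qed.

Let act (p : 'S_N) : {rmorphism S -> S} := @msym N {poly F} p.

Let vx_act s (p : 'S_N) Q : s \in 'Gal({:W} / 1%VS)%g -> (forall i, s (x i) = x (p i)) ->
  vx (act p Q) = s (vx Q).
Proof.
move=> sG sp; rewrite /vx /act /= mmap_msym rmorph_mmap.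
by apply: eq_mmap => [r|i] /=; rewrite ?rmorph_alg.
Qed.

Let vy_act (p : 'S_N) Q : vy (act p Q) = mmap ev0 (fun i => y (p i)) Q.
Proof. exact: mmap_msym. Qed.

Let vx_integral Q : integralOver f (vx Q).
Proof.
elim/S_ind: Q => [r|i|a b|a b]; first by rewrite vxC; apply: integral_id.
- rewrite vxX; exists P => //; rewrite Px (bigD1 i) //=.
  by rewrite rootM root_XsubC eqxx.
- by rewrite rmorphD; apply: integral_add.
- by rewrite rmorphM; apply: integral_mul.
Qed.

Let integral_descent t : integralOver f t%:A -> exists r, t%:A = f r.
Proof.
case=> p mp pt; have [|r Dr] := f0_closed (t := t).
  exists p => //; rewrite -(fmorph_root (in_alg W)) -map_poly_comp.
  by rewrite (eq_map_poly (g := f)).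
by exists r; rewrite Dr.
Qed.

(** Trivial inertia would make the point unramified, whereas [eps] is a multiple of [pi1 ^+ 2].
    Concretely, it would give an [e] that is nonzero at the point while its conjugates by all
    [s != 1] vanish there. The trace of [e ^+ 2 * pi1] lies in [F[eps]] and vanishes at [0], so it
    is a multiple of [eps], hence of [pi1 ^+ 2]. So are its terms with [s != 1], hence also
    [e ^+ 2 * pi1]. Cancelling one [pi1] makes [e] vanish at the point. *)
Lemma nontrivial_inertia : exists s (p : 'S_N),
  [/\ s \in 'Gal({:W} / 1%VS)%g, forall i, s (x i) = x (p i), p != 1%g &
      forall i, y (p i) = y i].
Proof.
apply: NNPP => no_inertia; pose G := 'Gal({:W} / 1%VS)%g.
pose perm_of (s : gal_of {:W}) : 'S_N := odflt 1%g [pick p : 'S_N | [forall i, s (x i) == x (p i)]].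
have perm_ofP s : s \in G -> forall i, s (x i) = x (perm_of s i).
  move=> sG i; rewrite /perm_of; case: pickP => [p /forallP/(_ i)/eqP //|no].
  have [p pP] := gal_permutes_roots sG.
  by have /forallP[] := negbT (no p); move=> j; rewrite pP.
have perm_of1 : perm_of 1%g = 1%g.
  by apply/permP => i; apply: x_inj; rewrite -perm_ofP ?group1 // gal_id perm1.
have perm_of_neq1 s : s \in G -> s != 1%g -> perm_of s != 1%g.
  move=> sG; apply: contraNneq => s1; apply/eqP.
  apply: (gal_eq1_on_generators x_gen) => _ /codomP[i ->].
  by rewrite perm_ofP // s1 perm1.
have sep (s : gal_of {:W}) : exists Q, s \in G -> s != 1%g -> vy Q != vy (act (perm_of s) Q).
  apply: NNPP => noQ; apply: no_inertia.
  have [sG s1] : s \in G /\ s != 1%g.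
    by apply: NNPP => nsG; apply: noQ; exists 0 => sG s1; case: nsG.
  exists s, (perm_of s); split=> //; [exact: perm_ofP|exact: perm_of_neq1|move=> i].
  apply/eqP/negPn/negP => yi; apply: noQ; exists (X i) => _ _.
  by rewrite vy_act mmapX mmap1U vyX eq_sym.
have [Qs QsP] := choice _ sep.
pose e : S := \prod_(s in G | s != 1%g) (Qs s - C (vy (act (perm_of s) (Qs s)))%:P).
have e0 : vy e != 0.
  rewrite rmorph_prod; apply/prodf_neq0 => s /andP[sG s1].
  by rewrite rmorphB vyC hornerC subr_eq0 QsP.
have actC p r : act p (C r) = C r by rewrite /act /= /msym mmapC.
have es s : s \in G -> s != 1%g -> vy (act (perm_of s) e) = 0.
  move=> sG s1; rewrite /e (bigD1 s) ?sG // (rmorphM (act _)) (rmorphM vy).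
  by rewrite (rmorphB (act _)) actC (rmorphB vy) vyC hornerC subrr mul0r.
pose T : S := \sum_(s in G) act (perm_of s) (e ^+ 2 * pi1).
have vxT : vx T = \sum_(s in G) s (vx (e ^+ 2 * pi1)).
  by rewrite rmorph_sum; apply: eq_bigr => s sG; rewrite (vx_act _ sG) //; apply: perm_ofP.
have vyT : vy T = 0.
  rewrite rmorph_sum big1 // => s sG; rewrite (rmorphM (act _)) (rmorphM vy).
  have [->|s1] := eqVneq s 1%g; last first.
    by rewrite (rmorphXn (act _)) (rmorphXn vy) es // expr0n mul0r.
  rewrite perm_of1 [X in _ * X]vy_act.
  by rewrite /pi1 /unif mmapB mmapX mmap1U perm1 mmapC /= y1 /horner_eval hornerC subrr mulr0.
(* Invariance puts the trace in [E]; it is integral over [F[eps]], which is integrally closed. *)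
have [r Dr] : exists r, vx T = f r.
  have : vx T \in fixedField G.
    apply/fixedFieldP => [|t tG]; first exact: memvf.
    rewrite vxT rmorph_sum [RHS](reindex_inj (mulIg t)) /=.
    apply: eq_big => [s|s sG]; first by rewrite groupMr.
    by rewrite galM ?memvf.
  rewrite (galois_fixedField galW) => /vlineP[t Dt].
  by have := vx_integral T; rewrite Dt => /integral_descent.
have [r' Dr'] : exists r', r = 'X * r'.
  have : vy (T - C r) = 0 by apply: xy; rewrite -[LHS]/(vx _) (rmorphB vx) vxC Dr subrr.
  rewrite (rmorphB vy) vyT vyC sub0r => /eqP; rewrite oppr_eq0 => /factor_theorem[b ->].
  by exists b; rewrite subr0 mulrC.
have [n2 neps pi0] := ramified.
(* The square of [e] serves here: a conjugate of [e] vanishing at the point is only known to be a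
   multiple of [pi1]. *)
have : nearS (pi1 ^+ 2) (e ^+ 2 * pi1).
  pose T' : S := \sum_(s in G | s != 1%g) act (perm_of s) (e ^+ 2 * pi1).
  apply: (near_vx (Q := C 'X * C r' - T')).
    rewrite (rmorphB vx) -(rmorphM C) -Dr' vxC -Dr -(rmorphB vx); congr (vx _).
    by rewrite /T (bigD1 1%g) ?group1 //= perm_of1 /act /= msym1m addrK.
  apply: near_add; first exact: near_mul.
  apply/near_opp/near_sum => s /andP[sG s1].
  rewrite (rmorphM (act _)); apply/near_mul; rewrite expr2 (rmorphM (act _)).
  by apply: near_prod; apply: maxS; apply: es.
case=> u [w [u0 eu]].
have /xy : vx (u * e ^+ 2 - pi1 * w) = 0.
  apply: (mulfI pi0); rewrite mulr0 -(rmorphM vx).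
  have -> : pi1 * (u * e ^+ 2 - pi1 * w) = u * (e ^+ 2 * pi1) - pi1 ^+ 2 * w by ring.
  by rewrite (rmorphB vx) eu subrr.
have vpi : vy pi1 = 0 by rewrite /pi1 /unif (rmorphB vy) vyX vyC hornerC y1 subrr.
rewrite -[mmap _ _ _]/(vy _) (rmorphB vy) (rmorphM vy) (rmorphXn vy) (rmorphM vy pi1) vpi mul0r subr0.
by move/eqP; rewrite mulf_eq0 expf_eq0 (negPf u0) (negPf e0) andbF.
Qed.

(** An inertia element preserves the fibres of [y], and [{i1, i2}] is the only one with more than
    one index. *)
Lemma inertia_transposition : exists2 s, s \in 'Gal({:W} / 1%VS)%g &
  [/\ s (x i1) = x i2, s (x i2) = x i1 & forall i, i != i1 -> i != i2 -> s (x i) = x i].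
Proof.
have [s [p [sG sp p1 yp]]] := nontrivial_inertia; exists s => //.
have moved i : p i != i -> (i = i1 /\ p i = i2) \/ (i = i2 /\ p i = i1).
  by move=> pi; apply: y_inj; rewrite ?yp // eq_sym.
have [i pi] : exists i, p i != i.
  apply: NNPP => no; case/eqP: p1; apply/permP => i; rewrite perm1.
  by apply/eqP/negPn/negP => pi; apply: no; exists i.
have fix_oth j : j != i1 -> j != i2 -> p j = j.
  move=> n1 n2; apply/eqP/negPn/negP => /moved[[e _]|[e _]].
    by rewrite e eqxx in n1.
  by rewrite e eqxx in n2.
have [p12 p21] : p i1 = i2 /\ p i2 = i1.
  have swap a b : p a = b -> a != b -> (forall j, j != a -> j != b -> p j = j) -> p b = a.
    move=> pab nab oth; apply/eqP/negPn/negP => nba.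
    have nbb : p b != b by rewrite -{2}pab (inj_eq perm_inj) eq_sym.
    have /oth : p b != a by [].
    by move/(_ nbb)/perm_inj => e; rewrite e eqxx in nbb.
  have [[e pe]|[e pe]] := moved i pi; rewrite e in pe.
    by split=> //; apply: swap.
  split=> //; apply: swap => //; first by rewrite eq_sym.
  by move=> j n2 n1; apply: fix_oth.
by split=> [||j n1 n2]; rewrite sp ?p12 ?p21 ?fix_oth.
Qed.

End InertiaTransposition.

(* The monic polynomial whose roots are those of [P], of degree [N], scaled by
   the leading coefficient of [P]. *)
Definition monicize (R : comNzRingType) N (P : {poly R}) : {poly R} :=
  'X^N + \poly_(i < N) (P`_i * P`_N ^+ (N - i.+1)).

Lemma coef_monicize (R : comNzRingType) N (P : {poly R}) i :
  (monicize N P)`_i = if (i < N)%N then P`_i * P`_N ^+ (N - i.+1) else (i == N)%:R.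
Proof.
rewrite coefD coefXn coef_poly; case: ltnP => [ltiN|leNi]; last by rewrite addr0.
by rewrite (ltn_eqF ltiN) add0r.
Qed.

Lemma map_monicize (R S : comNzRingType) (f : {rmorphism R -> S}) N P :
  map_poly f (monicize N P) = monicize N (map_poly f P).
Proof.
apply/polyP => i; rewrite coef_map !coef_monicize /= !coef_map.
by case: ifP => _; rewrite ?rmorphM ?rmorphXn ?rmorph_nat.
Qed.

Lemma monicize_monic (R : comNzRingType) N (P : {poly R}) : monicize N P \is monic.
Proof.
rewrite monicE lead_coefDl ?lead_coefXn // size_polyXn ltnS.
exact: size_poly.
Qed.

Lemma size_prod_ord (R : idomainType) N (x : 'I_N -> R) :
  size (\prod_i ('X - (x i)%:P)) = N.+1.
Proof. by rewrite size_prod_XsubC -[X in _ = X.+1](card_ord N) cardT enumT. Qed.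

Lemma coefN_prod_ord (R : idomainType) N (x : 'I_N -> R) :
  (\prod_i ('X - (x i)%:P))`_N = 1.
Proof.
have := monicP (monic_prod_XsubC (index_enum 'I_N) predT x).
by rewrite lead_coefE size_prod_ord.
Qed.

Lemma coef_comp_scale (R : comNzRingType) (a : R) p i :
  (p \Po (a *: 'X))`_i = p`_i * a ^+ i.
Proof.
rewrite comp_polyE coef_sum.
have [ltip|leip] := ltnP i (size p).
  rewrite (bigD1 (Ordinal ltip)) //= big1 => [|j nji].
    by rewrite exprZn !coefZ coefXn eqxx mulr1 addr0.
  rewrite exprZn !coefZ coefXn; case: eqP => [ij|_]; last by rewrite !mulr0.
  by case/eqP: nji; apply: val_inj.
rewrite big1 => [|j _]; first by rewrite nth_default ?mul0r.
rewrite exprZn !coefZ coefXn; case: eqP => [ij|_]; last by rewrite !mulr0.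
by move: (ltn_ord j); rewrite -ij ltnNge leip.
Qed.

Lemma monicize_roots (F : fieldType) N (P : {poly F}) (a : F) (x : 'I_N -> F) :
    a != 0 -> P = a *: \prod_i ('X - (x i)%:P) ->
  monicize N P = \prod_i ('X - (a * x i)%:P).
Proof.
move=> a0 DP; have PN : P`_N = a by rewrite DP coefZ coefN_prod_ord mulr1.
apply/polyP => i; rewrite coef_monicize.
case: (ltngtP i N) => [ltiN|ltNi|->]; last by rewrite coefN_prod_ord.
  apply: (mulIf (expf_neq0 i a0)); rewrite -coef_comp_scale rmorph_prod /=.
  have -> : \prod_j (('X - (a * x j)%:P) \Po (a *: 'X)) = \prod_j (a%:P * ('X - (x j)%:P)).
    apply: eq_bigr => j _; rewrite comp_polyB comp_polyX comp_polyC polyCM mulrBr.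
    by rewrite -mul_polyC.
  rewrite big_split /= prodr_const card_ord -polyC_exp mul_polyC PN DP !coefZ.
  have -> : a ^+ N = a * a ^+ (N - i.+1) * a ^+ i.
    by rewrite -exprS -exprD -subSn // subSS subnK // ltnW.
  by ring.
by rewrite nth_default // size_prod_ord.
Qed.

(** Congruence modulo ['X^2]. The variable is the parameter of a family, and ramification only
    depends on the family to first order. *)
Definition cong2 (R : comNzRingType) (p q : {poly R}) := p`_0 = q`_0 /\ p`_1 = q`_1.

Lemma cong2_trans (R : comNzRingType) (p q r : {poly R}) :
  cong2 p q -> cong2 q r -> cong2 p r.
Proof. by case=> e0 e1 [f0 f1]; split; [rewrite e0|rewrite e1]. Qed.

Lemma cong2_sym (R : comNzRingType) (p q : {poly R}) : cong2 p q -> cong2 q p.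
Proof. by case=> e0 e1; split. Qed.

Lemma cong2D (R : comNzRingType) (p q p' q' : {poly R}) :
  cong2 p q -> cong2 p' q' -> cong2 (p + p') (q + q').
Proof. by case=> e0 e1 [f0 f1]; split; rewrite !coefD ?e0 ?e1 ?f0 ?f1. Qed.

Lemma cong2M (R : comNzRingType) (p q p' q' : {poly R}) :
  cong2 p q -> cong2 p' q' -> cong2 (p * p') (q * q').
Proof.
case=> e0 e1 [f0 f1]; split; rewrite !coefM !big_ord_recl !big_ord0 /=.
  by rewrite e0 f0.
by rewrite e0 e1 f0 f1.
Qed.

Lemma cong2X (R : comNzRingType) (p q : {poly R}) n : cong2 p q -> cong2 (p ^+ n) (q ^+ n).
Proof. by move=> pq; elim: n => [|n IHn]; rewrite ?expr0 // !exprS; apply: cong2M. Qed.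

Lemma cong2_sum (R : comNzRingType) I (r : seq I) (P : pred I) (G H : I -> {poly R}) :
  (forall i, P i -> cong2 (G i) (H i)) ->
  cong2 (\sum_(i <- r | P i) G i) (\sum_(i <- r | P i) H i).
Proof. by move=> GH; elim/big_ind2: _ => // *; apply: cong2D. Qed.

Lemma cong2_horner (R : comNzRingType) (P Q : {poly {poly R}}) (a : {poly R}) :
  (forall i, cong2 P`_i Q`_i) -> cong2 P.[a] Q.[a].
Proof.
move=> PQ; pose n := maxn (size P) (size Q).
rewrite (@horner_coef_wide _ n P) ?leq_maxl // (@horner_coef_wide _ n Q) ?leq_maxr //.
by apply: cong2_sum => i _; apply: cong2M.
Qed.

(** * Carrying a transposition from a one-parameter family back to [K] *)

Section TranspositionDescent.
Variables (K : fieldType) (L : splittingFieldType K) (A : {poly K}) (a : K).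
Variables (N : nat) (x : 'I_N -> L).
Hypothesis galL : galois 1 {:L}.
Hypothesis a0 : a != 0.
Hypothesis Ax : map_poly (in_alg L) A = a%:A *: \prod_i ('X - (x i)%:P).
Hypothesis x_inj : injective x.

Variables (F E : fieldType) (f0 : {rmorphism {poly F} -> E}).
Hypothesis f0_inj : forall r, f0 r = 0 -> r = 0.
Hypothesis f0_closed : forall t, integralOver f0 t -> exists r, t = f0 r.
Variables (psi : {rmorphism K -> E}) (P : {poly {poly F}}).
Hypothesis psiA : map_poly psi A = map_poly f0 P.
Hypothesis PN : cong2 P`_N 1.
Hypothesis szP : (size P <= N.+1)%N.

Variables (y : 'I_N -> F) (c : F) (i1 i2 : 'I_N).
Let ev0 : {rmorphism {poly F} -> F} := horner_eval 0.
Hypothesis Py : map_poly ev0 P = \prod_i ('X - (y i)%:P).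
Hypothesis y1 : y i1 = c.
Hypothesis y2 : y i2 = c.
Hypothesis neq_i12 : i1 != i2.
Hypothesis y_inj : forall i j, i != j -> y i = y j ->
  (i = i1 /\ j = i2) \/ (i = i2 /\ j = i1).
Hypothesis Pc1 : (P.[c%:P])`_1 != 0.

Let A1 := monicize N A.
Let P1 := monicize N P.
Let x1 i := a%:A * x i.

Let A1x : map_poly (in_alg L) A1 = \prod_i ('X - (x1 i)%:P).
Proof. by rewrite map_monicize; apply: monicize_roots; rewrite ?Ax // scaler_eq0 oner_eq0 orbF. Qed.

Let x1_inj : injective x1.
Proof.
by move=> i j /mulfI/x_inj; apply; rewrite scaler_eq0 oner_eq0 orbF.
Qed.

Let psiA1 : map_poly psi A1 = map_poly f0 P1.
Proof. by rewrite !map_monicize psiA. Qed.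

Let P1y : map_poly ev0 P1 = \prod_i ('X - (y i)%:P).
Proof.
rewrite map_monicize (@monicize_roots _ _ _ 1 y) ?oner_eq0 ?scale1r //.
by apply: eq_bigr => i _; rewrite mul1r.
Qed.

Let P1c1 : (P1.[c%:P])`_1 != 0.
Proof.
have [_ ->] : cong2 P1.[c%:P] P.[c%:P]; last exact: Pc1.
apply: cong2_horner => i; rewrite coef_monicize.
case: (ltngtP i N) => [ltiN|ltNi|->]; last exact: cong2_sym.
  rewrite -[X in cong2 _ X]mulr1 -(expr1n {poly F} (N - i.+1)).
  by apply: cong2M => //; apply: cong2X.
by rewrite [P`_i]nth_default // (leq_trans szP).
Qed.

Let psi_sep : separable_poly (map_poly psi A1).
Proof.
rewrite separable_map -(separable_map (in_alg L)) A1x.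
rewrite -big_enum -(big_map x1 predT (fun b => 'X - b%:P)) separable_prod_XsubC.
by rewrite map_inj_uniq // enum_uniq.
Qed.

(** The roots are scaled to be integral, then inertia gives a transposition of the roots [z] of the
    family. It preserves the relations of [z] over [K], which by [embed_roots] are those of the
    roots in [L]; hence the same transposition of the latter is realized by a Galois element over
    [K]. *)
Lemma transposition_descent : exists2 s, s \in 'Gal({:L} / 1%VS)%g &
  exists j1 j2, [/\ j1 != j2, s (x j1) = x j2, s (x j2) = x j1 &
    forall j, j != j1 -> j != j2 -> s (x j) = x j].
Proof.
have monA1 : map_poly psi A1 \is monic by rewrite map_monicize monicize_monic.
have [W splitW] := splitting_field_exists (monic_neq0 monA1).
have [rs Drs gen_rs] := splitW.
pose g := [the {rmorphism {poly F} -> W} of in_alg W \o f0].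
have {}Drs : map_poly g P1 = \prod_(z <- rs) ('X - z%:P).
  apply/eqP; rewrite -eqp_monic ?monic_prod_XsubC ?map_monicize ?monicize_monic //.
  by rewrite -map_monicize map_poly_comp -psiA1.
have sz_rs : size rs = N.
  apply: succn_inj; rewrite -(size_prod_XsubC rs id) -Drs.
  have szf := size_prod_ord y; rewrite -P1y in szf.
  rewrite -szf !size_map_poly_id0 //.
    by rewrite (monicP (monicize_monic _ _)) rmorph1 oner_eq0.
  by rewrite (monicP (monicize_monic _ _)) rmorph1 oner_eq0.
pose z (i : 'I_N) := rs`_i.
have Pz : map_poly g P1 = \prod_i ('X - (z i)%:P).
  by rewrite Drs (big_nth 0) sz_rs big_mkord.
have uniq_rs : uniq rs.
  rewrite -separable_prod_XsubC -Drs map_poly_comp -psiA1.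
  by rewrite separable_map.
have z_inj : injective z.
  by move=> i j /eqP; rewrite nth_uniq ?sz_rs // => /eqP/val_inj.
have codom_z : codom z =i rs.
  move=> u; apply/codomP/idP => [[i ->]|/(nthP 0)[i]]; first by rewrite mem_nth ?sz_rs.
  by rewrite sz_rs => ltiN <-; exists (Ordinal ltiN).
have gen_z : <<1 & codom z>>%VS = {:W}%VS.
  rewrite -gen_rs; apply/eqP; rewrite eqEsubv.
  by apply/andP; split; apply/adjoin_seqSr => u; rewrite codom_z.
have galW : galois 1 {:W}.
  apply/splitting_galoisField; exists (map_poly (in_alg W) (map_poly psi A1)).
  split=> //; first by apply/polyOverP => i; rewrite coef_map /= rpredZ ?rpred1.
  by rewrite separable_map.
have [|tau tauP] := roots_specialization _ Pz P1y.
  by move=> r /eqP; rewrite fmorph_eq0 => /eqP/f0_inj ->; rewrite rmorph0.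
(* Renumbering the special roots makes the relations of [z] specialize to [y'], as the inertia
   argument requires. *)
pose y' i := y (tau i).
have P1y' : map_poly ev0 P1 = \prod_i ('X - (y' i)%:P).
  by rewrite P1y (reindex_inj (@perm_inj _ tau)).
pose k1 := (tau^-1)%g i1; pose k2 := (tau^-1)%g i2.
have [|||||s sG [s1 s2 sother]] := @inertia_transposition _ _ f0 f0_inj f0_closed W N P1 z y'
  c k1 k2 galW _ Pz z_inj gen_z P1y' _ _ _ _ P1c1 tauP.
- exact: monicize_monic.
- by rewrite /y' permKV.
- by rewrite /y' permKV.
- by rewrite (inj_eq perm_inj).
- move=> i j nij /y_inj; rewrite (inj_eq perm_inj) => /(_ nij).
  by case=> -[e1 e2]; [left|right]; rewrite /k1 /k2 -e1 -e2 !permK.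
pose psiW := [the {rmorphism K -> W} of in_alg W \o psi].
have A1z : map_poly psiW A1 = \prod_i ('X - (z i)%:P).
  by rewrite -Pz map_poly_comp psiA1 -map_poly_comp.
have [rho rhoP] := embed_roots A1x A1z.
pose j1 := (rho^-1)%g k1; pose j2 := (rho^-1)%g k2.
have nj12 : j1 != j2 by rewrite !(inj_eq perm_inj).
have [|t tG tP] := @gal_extends_relations _ _ _ x1 (fun i => x1 (tperm j1 j2 i)) galL.
  move=> Q /rhoP Q0.
  have Qz : mmap psiW (fun i => z (rho (tperm j1 j2 i))) Q = 0.
    have := congr1 s Q0; rewrite rmorph0 rmorph_mmap => <-.
    apply: eq_mmap => [b|i] /=; first by rewrite rmorph_alg.
    case: tpermP => [->|->|/eqP n1 /eqP n2]; rewrite ?permKV ?s1 ?s2 //.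
    by rewrite sother // -1?(permKV rho k1) -1?(permKV rho k2) (inj_eq perm_inj).
  pose Q' := msym (tperm j1 j2) Q.
  have := rhoP Q'; rewrite /Q' mmap_msym => -[_ <-] //.
  by rewrite mmap_msym.
have tx i : t (x i) = x (tperm j1 j2 i).
  have aa0 : a%:A != 0 :> L by rewrite scaler_eq0 oner_eq0 orbF.
  have ta : t a%:A = a%:A by apply: rmorph_alg.
  by apply: (mulfI aa0); rewrite -[RHS]tP /x1 rmorphM /= ta.
exists t => //; exists j1, j2; split=> //; rewrite ?tx ?tpermL ?tpermR //.
by move=> j n1 n2; rewrite tx tpermD // eq_sym.
Qed.

End TranspositionDescent.

(** * Homogeneous iteration of a fraction *)

Section HomogeneousIteration.
Variable R : comNzRingType.
Implicit Types (P N D : {poly R}) (a b x t : R).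

Definition hval d P a b : R := \sum_(i < d.+1) P`_i * (a ^+ i * b ^+ (d - i)).

(** Numerator and denominator of the iterates as ring elements, so that they can be specialized
    before the denominators are known not to vanish. *)
Definition ipair d N D n x : R * R :=
  iter n (fun ab => (hval d N ab.1 ab.2, hval d D ab.1 ab.2)) (x, 1).

Lemma hvalD d P Q a b : hval d (P + Q) a b = hval d P a b + hval d Q a b.
Proof. by rewrite -big_split; apply: eq_bigr => i _; rewrite coefD mulrDl. Qed.

Lemma hvalCM d c P a b : hval d (c%:P * P) a b = c * hval d P a b.
Proof. by rewrite mulr_sumr; apply: eq_bigr => i _; rewrite coefCM mulrA. Qed.

Lemma hval0 d a b : hval d 0 a b = 0.
Proof. by rewrite /hval big1 // => i _; rewrite coef0 mul0r. Qed.

Lemma hval_sum d (I : finType) (Q : I -> {poly R}) a b :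
  hval d (\sum_i Q i) a b = \sum_i hval d (Q i) a b.
Proof. by elim/big_rec2: _ => [|i u v _ <-]; rewrite ?hval0 ?hvalD. Qed.

Lemma hvalXn d j a b : (j <= d)%N -> hval d 'X^j a b = a ^+ j * b ^+ (d - j).
Proof.
move=> lejd; rewrite /hval (bigD1 (Ordinal (lejd : (j < d.+1)%N))) //= coefXn eqxx mul1r.
rewrite big1 ?addr0 // => i; rewrite -val_eqE /= => nij.
by rewrite coefXn (negPf nij) mul0r.
Qed.

Lemma hvalC d c a b : hval d c%:P a b = c * b ^+ d.
Proof. by rewrite -[c%:P]mulr1 hvalCM -(expr0 'X) hvalXn // expr0 mul1r subn0. Qed.

Lemma hvalS d P a b : (size P <= d.+1)%N -> hval d.+1 P a b = b * hval d P a b.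
Proof.
move=> szP; rewrite /hval big_ord_recr /= nth_default // mul0r addr0 mulr_sumr.
apply: eq_bigr => i _; rewrite subSn -1?ltnS // exprS.
by rewrite !mulrA [b * _]mulrC -!mulrA [b * (_ * _)]mulrCA.
Qed.

Lemma hvalMX d P a b : hval d.+1 (P * 'X) a b = a * hval d P a b.
Proof.
rewrite /hval big_ord_recl coefMX mul0r add0r mulr_sumr; apply: eq_bigr => i _.
by rewrite coefMX /= subSS exprS -!mulrA mulrCA.
Qed.

Lemma poly_widen P n : (size P <= n)%N -> P = \sum_(j < n) (P`_j)%:P * 'X^j.
Proof.
move=> szP; under eq_bigr do rewrite mul_polyC; rewrite -poly_def.
apply/polyP => i; rewrite coef_poly; case: ltnP => // le.
by rewrite nth_default // (leq_trans szP).
Qed.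

(* [B^d P(A/B)] is unchanged under [P -> P(x + t)], [A/B -> A/B - t]. *)
Lemma hval_shift d P t a b : (size P <= d.+1)%N ->
  hval d (P \Po ('X + t%:P)) (a - t * b) b = hval d P a b.
Proof.
move=> szP; rewrite {1}(poly_widen szP) rmorph_sum [in RHS](poly_widen szP) !hval_sum.
apply: eq_bigr => j _.
rewrite rmorphM rmorphXn /= comp_polyC comp_polyX !hvalCM; congr (_ * _).
have lejd : (j <= d)%N by rewrite -ltnS.
rewrite hvalXn //; move: (nat_of_ord j) lejd => {}j; elim: j d {P szP} => [|j IHj] d.
  by move=> _; rewrite expr0 -(expr0 'X) hvalXn // !expr0.
case: d => // d lejd; rewrite exprSr mulrDr hvalD hvalMX subSS.
have szX : (size (('X + t%:P) ^+ j : {poly R}) <= d.+1)%N.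
  by apply: leq_trans (size_poly_exp_leq _ _) _; rewrite size_XaddC mul1n.
by rewrite [_ * t%:P]mulrC hvalCM hvalS // IHj // exprS; ring.
Qed.

(** Conjugating by the translation [x -> x + t] commutes with iteration and leaves the denominators
    unchanged. *)
Lemma ipair_shift d N D t n x : (size N <= d.+1)%N -> (size D <= d.+1)%N ->
  let: (A, B) := ipair d N D n (x + t) in
  ipair d ((N - t%:P * D) \Po ('X + t%:P)) (D \Po ('X + t%:P)) n x = (A - t * B, B).
Proof.
move=> szN szD; elim: n => [|n IHn]; first by rewrite /= mulr1 addrK.
rewrite /ipair !iterS -/(ipair _ _ _ _ _); move: IHn; rewrite -/(ipair _ _ _ _ _).
case: (ipair d N D n (x + t)) => A B -> /=; congr (_, _); last exact: hval_shift.
have szND : (size (N - t%:P * D)%R <= d.+1)%N.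
  rewrite (leq_trans (size_polyD _ _)) // geq_max szN size_polyN mul_polyC.
  exact: leq_trans (size_scale_leq _ _) szD.
by rewrite hval_shift // -mulNr -polyCN hvalD hvalCM mulNr.
Qed.

End HomogeneousIteration.

Lemma rmorph_hval (R S : comNzRingType) (f : {rmorphism R -> S}) d P a b :
  f (hval d P a b) = hval d (map_poly f P) (f a) (f b).
Proof.
rewrite rmorph_sum; apply: eq_bigr => i _.
by rewrite !rmorphM !rmorphXn coef_map.
Qed.

Lemma rmorph_ipair (R S : comNzRingType) (f : {rmorphism R -> S}) d N D n x :
  ipair d (map_poly f N) (map_poly f D) n (f x) =
  (f (ipair d N D n x).1, f (ipair d N D n x).2).
Proof.
elim: n => [|n IHn]; first by rewrite /= rmorph1.
by rewrite /ipair !iterS -!/(ipair _ _ _ _ _) IHn /= !rmorph_hval.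
Qed.

Definition iterpoly (R : comNzRingType) d (N D : {poly R}) n : {poly R} * {poly R} :=
  ipair d (map_poly polyC N) (map_poly polyC D) n 'X.

Lemma horner_iterpoly (R : comNzRingType) d (N D : {poly R}) n x :
  ((iterpoly d N D n).1.[x], (iterpoly d N D n).2.[x]) = ipair d N D n x.
Proof.
have ev P : map_poly (horner_eval x) (map_poly polyC P) = P.
  by rewrite -map_poly_comp map_poly_id // => c _ /=; rewrite /horner_eval hornerC.
have := rmorph_ipair (horner_eval x) d (map_poly polyC N) (map_poly polyC D) n 'X.
by rewrite !ev /= /horner_eval hornerX => ->.
Qed.

Lemma horner_iterpoly1 (R : comNzRingType) d (N D : {poly R}) n x :
  (iterpoly d N D n).1.[x] = (ipair d N D n x).1.
Proof. by rewrite -horner_iterpoly. Qed.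

Lemma horner_iterpoly2 (R : comNzRingType) d (N D : {poly R}) n x :
  (iterpoly d N D n).2.[x] = (ipair d N D n x).2.
Proof. by rewrite -horner_iterpoly. Qed.

Lemma map_iterpoly (R S : comNzRingType) (f : {rmorphism R -> S}) d N D n :
  iterpoly d (map_poly f N) (map_poly f D) n =
  (map_poly f (iterpoly d N D n).1, map_poly f (iterpoly d N D n).2).
Proof.
rewrite -(rmorph_ipair (map_poly f)) /iterpoly /= map_polyX.
by congr (ipair d _ _ n 'X); rewrite -!map_poly_comp; apply: eq_map_poly => c /=;
   rewrite map_polyC.
Qed.

Lemma iterpolyS (R : comNzRingType) d (N D : {poly R}) n :
  iterpoly d N D n.+1 =
    (hval d (map_poly polyC N) (iterpoly d N D n).1 (iterpoly d N D n).2,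
     hval d (map_poly polyC D) (iterpoly d N D n).1 (iterpoly d N D n).2).
Proof. by []. Qed.

Lemma size_hval (R : comNzRingType) d m (P A B : {poly R}) :
    (size A <= m.+1)%N -> (size B <= m.+1)%N ->
  (size (hval d (map_poly polyC P) A B) <= (d * m).+1)%N.
Proof.
move=> szA szB; apply: leq_trans (size_sum _ _ _) _; apply/bigmax_leqP => i _.
rewrite coef_map /= mul_polyC.
apply: leq_trans (size_scale_leq _ _) _; apply: leq_trans (size_polyMleq _ _) _.
have szX (C : {poly R}) k : (size C <= m.+1)%N -> (size (C ^+ k) <= (m * k).+1)%N.
  move=> szC; apply: leq_trans (size_poly_exp_leq _ _) _.
  by rewrite ltnS leq_mul2r orbC -subn1 leq_subLR szC.
have := leq_add (szX _ i szA) (szX _ (d - i)%N szB).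
rewrite addSn addnS -mulnDr subnKC -1?ltnS // [(m * d)%N]mulnC.
by rewrite -subn1 leq_subLR.
Qed.

Lemma size_iterpoly (R : comNzRingType) d (N D : {poly R}) n :
  (size (iterpoly d N D n).1 <= (d ^ n).+1)%N /\ (size (iterpoly d N D n).2 <= (d ^ n).+1)%N.
Proof.
elim: n => [|n [IH1 IH2]]; first by rewrite /= size_polyX size_poly1 expn0.
by rewrite iterpolyS expnS; split; apply: size_hval.
Qed.

Lemma coefM_top (R : comNzRingType) m l (p q : {poly R}) :
  (size p <= m.+1)%N -> (size q <= l.+1)%N -> (p * q)`_(m + l) = p`_m * q`_l.
Proof.
move=> szp szq; have ltm : (m < (m + l).+1)%N by rewrite ltnS leq_addr.
rewrite coefM (bigD1 (Ordinal ltm)) //= addKn big1 ?addr0 // => i.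
rewrite -val_eqE /= => nim; case: (ltngtP i m) nim => // [ltim|ltmi] _.
  rewrite [X in _ * X]nth_default ?mulr0 // (leq_trans szq) //.
  by lia.
by rewrite nth_default ?mul0r // (leq_trans szp).
Qed.

Lemma coefX_top (R : comNzRingType) m (p : {poly R}) k :
  (size p <= m.+1)%N -> (p ^+ k)`_(m * k) = p`_m ^+ k /\ (size (p ^+ k) <= (m * k).+1)%N.
Proof.
move=> szp; split; last first.
  apply: leq_trans (size_poly_exp_leq _ _) _; rewrite ltnS leq_mul2r.
  by rewrite orbC -subn1 leq_subLR szp.
elim: k => [|k IHk]; first by rewrite !expr0 muln0 coef1.
rewrite !exprS mulnS coefM_top ?IHk //.
apply: leq_trans (size_poly_exp_leq _ _) _; rewrite ltnS leq_mul2r.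
by rewrite orbC -subn1 leq_subLR szp.
Qed.

Lemma coef_hval_top (R : comNzRingType) d m (P A B : {poly R}) :
    (size A <= m.+1)%N -> (size B <= m.+1)%N ->
  (hval d (map_poly polyC P) A B)`_(d * m) = hval d P A`_m B`_m.
Proof.
move=> szA szB; rewrite coef_sum; apply: eq_bigr => i _.
rewrite coef_map coefCM; congr (_ * _).
have [eA sA] := coefX_top i szA; have [eB sB] := coefX_top (d - i) szB.
have -> : (d * m)%N = (m * i + m * (d - i))%N.
  by rewrite -mulnDr subnKC -1?ltnS // mulnC.
by rewrite coefM_top // eA eB.
Qed.

(** The top coefficients follow the orbit of infinity, in homogeneous coordinates [(1, 0)], and the
    hypotheses say that infinity is fixed. *)
Lemma coef_iterpoly_top (R : comNzRingType) d (N D : {poly R}) n :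
    (0 < d)%N -> N`_d = 1 -> D`_d = 0 ->
  (iterpoly d N D n).1`_(d ^ n) = 1 /\ (iterpoly d N D n).2`_(d ^ n) = 0.
Proof.
move=> d_gt0 Nd Dd.
have hv10 P : hval d P (1 : R) 0 = P`_d.
  rewrite /hval (bigD1 ord_max) //= subnn expr0 expr1n !mulr1 big1 ?addr0 // => i.
  rewrite -val_eqE /= => nid; rewrite expr0n subn_eq0 leqNgt ltn_neqAle nid.
  by rewrite -ltnS ltn_ord mulr0 mulr0.
elim: n => [|n [IH1 IH2]]; first by rewrite /= coefX coef1 expn0.
have [szA szB] := size_iterpoly d N D n.
by rewrite iterpolyS expnS !coef_hval_top // IH1 IH2 !hv10.
Qed.

Section FieldIteration.
Variables (K : fieldType) (d : nat) (N D : {poly K}).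
Hypothesis szN : (size N <= d.+1)%N.
Hypothesis szD : (size D <= d.+1)%N.

(** A division by zero returns [0] here, so statements about iterates must also say that no pole is
    met on the way. *)
Definition frac_map z : K := N.[z] / D.[z].

Lemma hval_horner (P : {poly K}) a b : (size P <= d.+1)%N -> b != 0 ->
  hval d P a b = b ^+ d * P.[a / b].
Proof.
move=> szP b0; rewrite (horner_coef_wide _ szP) mulr_sumr; apply: eq_bigr => i _.
have leid : (i <= d)%N by rewrite -ltnS.
rewrite [RHS]mulrCA; congr (_ * _); rewrite expr_div_n mulrCA; congr (_ * _).
by apply/(canRL (mulfK _)); rewrite ?expf_neq0 // -exprD subnK.
Qed.

Lemma ipair_frac_map n x :
    (forall i, (i < n)%N -> D.[iter i frac_map x] != 0) ->
  (ipair d N D n x).2 != 0 /\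
  (ipair d N D n x).1 = (ipair d N D n x).2 * iter n frac_map x.
Proof.
elim: n => [|n IHn] D0; first by rewrite /= mul1r oner_eq0.
have [|B0 EA] := IHn; first by move=> i lti; apply: D0; apply: ltnW.
rewrite /ipair !iterS -!/(ipair _ _ _ _ _) /= !hval_horner // EA.
rewrite [_ * _ / _]mulrAC divff // mul1r.
split; first by rewrite mulf_neq0 ?expf_neq0 ?D0.
by rewrite /frac_map -mulrA [D.[_] * _]mulrC divfK ?D0.
Qed.

Lemma ipair_neq0_frac_map n x :
    (forall i, (i <= n)%N -> (ipair d N D i x).2 != 0) ->
  forall i, (i < n)%N -> D.[iter i frac_map x] != 0.
Proof.
elim: n => [|n IHn] B0 i //; rewrite ltnS leq_eqVlt => /orP[/eqP->|lti]; last first.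
  by apply: IHn lti => j lej; apply: B0; apply: leqW.
have D0 j : (j < n)%N -> D.[iter j frac_map x] != 0.
  by apply: IHn => {}j lej; apply: B0; apply: leqW.
have [Bn En] := ipair_frac_map D0.
have := B0 n.+1 (leqnn _); rewrite /ipair iterS -!/(ipair _ _ _ _ _) /= hval_horner //.
by rewrite En [_ * _ / _]mulrAC divff // mul1r mulf_eq0 negb_or => /andP[].
Qed.

End FieldIteration.

Lemma cong2_hval (R : comNzRingType) d (P Q : {poly {poly R}}) (a b a' b' : {poly R}) :
    (forall i, cong2 P`_i Q`_i) -> cong2 a a' -> cong2 b b' ->
  cong2 (hval d P a b) (hval d Q a' b').
Proof.
move=> PQ aa bb; apply: cong2_sum => i _; apply: cong2M => //.
by apply: cong2M; apply: cong2X.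
Qed.

Lemma cong2_ipair (R : comNzRingType) d (N D N' D' : {poly {poly R}}) n x :
    (forall i, cong2 N`_i N'`_i) -> (forall i, cong2 D`_i D'`_i) ->
  cong2 (ipair d N D n x).1 (ipair d N' D' n x).1 /\
  cong2 (ipair d N D n x).2 (ipair d N' D' n x).2.
Proof.
move=> NN DD; elim: n => [|n [IH1 IH2]]; first by split.
by rewrite /ipair !iterS -!/(ipair _ _ _ _ _); split; apply: cong2_hval.
Qed.

Lemma PhiIterPair_iterpoly (k : fieldType) d n :
  PhiIterPair k d n = iterpoly d (PhiNum k d) (PhiDen k d) n.
Proof.
rewrite /PhiIterPair /iterpoly /ipair; apply: eq_iter => -[A B] /=.
by congr (_, _); apply: eq_bigr => i _; rewrite coef_map /= mul_polyC.
Qed.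

Lemma iterpoly_comp (R : comNzRingType) d (N : {poly R}) n : (size N <= d.+1)%N ->
  iterpoly d N 1 n = (iter n (fun q => N \Po q) 'X, 1).
Proof.
move=> szN; elim: n => [|n IHn] //.
rewrite iterpolyS IHn iterS /=; congr (_, _); last first.
  by rewrite map_polyC /= -polyC1 hvalC expr1n mulr1.
set q := iter n _ _.
rewrite /hval [RHS]comp_polyE (big_ord_widen _ (fun i => N`_i *: q ^+ i) szN).
rewrite [RHS]big_mkcond; apply: eq_bigr => i _ /=.
rewrite coef_map expr1n mulr1 mul_polyC; case: ltnP => // le.
by rewrite nth_default // scale0r.
Qed.

Lemma horner_iter_comp (R : comNzRingType) (N : {poly R}) n x :
  (iter n (fun q => N \Po q) 'X).[x] = iter n (horner N) x.
Proof. by elim: n => [|n IHn]; rewrite ?hornerX // !iterS horner_comp IHn. Qed.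

(** * Generic maps and their specializations *)

Lemma fraction_lift (A : idomainType) (Z : fieldType) (g : {rmorphism A -> Z}) :
    (forall a, g a = 0 -> a = 0) ->
  exists psi : {rmorphism {fraction A} -> Z}, forall a, psi (tofrac a) = g a.
Proof.
move=> g_inj; have g0 a : a != 0 -> g a != 0 by apply: contraNneq => /g_inj->.
have rep (z : {fraction A}) : {nd : A * A | nd.2 != 0 /\ z = tofrac nd.1 / tofrac nd.2}.
  apply: constructive_indefinite_description.
  by have [n [d0 [? ?]]] := fraction_repr z; exists (n, d0).
pose f z := let nd := sval (rep z) in g nd.1 / g nd.2.
have fE n d z : d != 0 -> z * tofrac d = tofrac n -> f z = g n / g d.
  move=> d0; rewrite /f; case: (rep z) => -[n' d'] /= [d'0 ->] e.
  apply/eqP; rewrite eqr_div ?g0 // -!rmorphM; apply/eqP; congr (g _); apply/eqP.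
  by rewrite -tofrac_eq !tofracM -e [X in _ == X]mulrAC divfK ?tofrac_eq0.
have fden z : exists n d, [/\ d != 0, z * tofrac d = tofrac n & f z = g n / g d].
  have [n [d [d0 Dz]]] := fraction_repr z; exists n, d.
  have e : z * tofrac d = tofrac n by rewrite Dz divfK ?tofrac_eq0.
  by split=> //; apply: fE.
have fB : zmod_morphism f.
  move=> z1 z2; have [n1 [d1 [d10 e1 ->]]] := fden z1.
  have [n2 [d2 [d20 e2 ->]]] := fden z2.
  rewrite (fE (n1 * d2 - n2 * d1) (d1 * d2)) ?mulf_neq0 //.
    by rewrite rmorphB !rmorphM; field; rewrite !g0.
  by rewrite tofracB !tofracM -e1 -e2; ring.
have fM : monoid_morphism f.
  split=> [|z1 z2].
    by rewrite (fE 1 1) ?oner_neq0 ?tofrac1 ?mulr1 // rmorph1 divr1.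
  have [n1 [d1 [d10 e1 ->]]] := fden z1; have [n2 [d2 [d20 e2 ->]]] := fden z2.
  rewrite (fE (n1 * n2) (d1 * d2)) ?mulf_neq0 //; last first.
    by rewrite !tofracM -e1 -e2; ring.
  by rewrite !rmorphM mulf_div.
pose addM := GRing.isZmodMorphism.Build _ _ f fB.
pose mulM := GRing.isMonoidMorphism.Build _ _ f fM.
exists (HB.pack_for {rmorphism {fraction A} -> Z} f addM mulM) => a /=.
by rewrite (fE a 1) ?oner_neq0 ?tofrac1 ?mulr1 // rmorph1 divr1.
Qed.

Lemma common_denominator (A : idomainType) n (Q : {mpoly {fraction A}[n]}) :
  exists (q : A) (Q' : {mpoly A[n]}), q != 0 /\
    map_mpoly (@tofrac A) Q' = (tofrac q) *: Q.
Proof.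
elim/mpolyind: Q => [|c m p _ _ [q [Q' [q0 e]]]].
  by exists 1, 0; rewrite oner_neq0 rmorph0 scaler0.
have [a [b [b0 Dc]]] := fraction_repr c.
exists (b * q), ((q * a) *: 'X_[m] + b *: Q'); rewrite mulf_neq0 //; split=> //.
rewrite rmorphD /= !map_mpolyZ map_mpolyX e scalerDr; congr (_ + _).
  rewrite scalerA; congr (_ *: _).
  rewrite Dc /= !tofracM [RHS]mulrA; apply/(canRL (mulfK _)); rewrite ?tofrac_eq0 //.
  by rewrite mulrC mulrA.
by rewrite scalerA /= tofracM.
Qed.

Lemma relations_lift (A : idomainType) (R : comNzRingType) (Z W : fieldType)
    (th : {rmorphism A -> R}) (f : {rmorphism R -> Z}) (g : {rmorphism R -> W})
    (psi : {rmorphism {fraction A} -> Z}) (kap : {rmorphism {fraction A} -> W})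
    n (y : 'I_n -> R) (Q : {mpoly {fraction A}[n]}) :
    (forall r, f r = 0 -> g r = 0) ->
    (forall a, psi (tofrac a) = f (th a)) -> (forall a, kap (tofrac a) = g (th a)) ->
  mmap psi (f \o y) Q = 0 -> mmap kap (g \o y) Q = 0.
Proof.
move=> fg psiE kapE Q0; have [q [Q' [q0 e]]] := common_denominator Q.
have clr (T : fieldType) (h : {rmorphism R -> T}) (u : {rmorphism {fraction A} -> T}) :
    (forall a, u (tofrac a) = h (th a)) ->
    h (mmap th y Q') = u (tofrac q) * mmap u (h \o y) Q.
  move=> uE; rewrite -mmapZ -e rmorph_mmap.
  have -> : map_mpoly (@tofrac A) Q' = mmap (@mpolyC n _ \o @tofrac A) (fun i => 'X_i) Q' by [].
  rewrite rmorph_mmap; apply: eq_mmap => [a|i] /=; first by rewrite mmapC /= uE.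
  by rewrite mmapX mmap1U.
have : f (mmap th y Q') = 0 by rewrite (clr _ _ psi) // Q0 mulr0.
move/fg; rewrite (clr _ _ kap) // => /eqP; rewrite mulf_eq0 fmorph_eq0 tofrac_eq0.
by rewrite (negPf q0) => /eqP.
Qed.

(** Common interface of the two maps of the theorem; [sh] marks the polynomial one. [gen_eq] says
    that the coefficients generate the ring of parameters, [gen_lift] that they are free. In
    [gen_lift] the shape is required only after [f], since in applications it holds only once some
    element of [R] is inverted. *)
Record generic_pair (k : fieldType) (d m : nat) (sh : bool) (N D : {poly {mpoly k[m]}}) :
    Prop := GenericPair {
  gen_szN : (size N <= d.+1)%N;
  gen_Nd : N`_d = 1;
  gen_szD : (size D <= d.+1)%N;
  gen_sh : sh -> D = 1;
  gen_eq : forall (Z : comNzRingType) (g h : {rmorphism {mpoly k[m]} -> Z}),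
    (forall c, g c%:MP = h c%:MP) -> map_poly g N = map_poly h N ->
    map_poly g D = map_poly h D -> g =1 h;
  gen_lift : forall (R : comNzRingType) (kap : {rmorphism k -> R}) (N' D' : {poly R}),
    exists th : {rmorphism {mpoly k[m]} -> R}, (forall c, th c%:MP = kap c) /\
      forall (Z : comNzRingType) (f : {rmorphism R -> Z}),
        (size (map_poly f N') <= d.+1)%N -> (map_poly f N')`_d = 1 ->
        (size (map_poly f D') <= d.+1)%N -> (sh -> map_poly f D' = 1) ->
      map_poly (f \o th) N = map_poly f N' /\ map_poly (f \o th) D = map_poly f D'
}.

Section GenericLift.
Variables (k : fieldType) (d m : nat) (sh : bool) (NR DR : {poly {mpoly k[m]}}).
Hypothesis gen : generic_pair d sh NR DR.
Let K : fieldType := ratfield k m.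
Let N : {poly K} := map_poly (@tofrac {mpoly k[m]}) NR.
Let D : {poly K} := map_poly (@tofrac {mpoly k[m]}) DR.

Variables (R : comNzRingType) (kap : {rmorphism k -> R}) (N' D' : {poly R}).
Variables (Z : fieldType) (f : {rmorphism R -> Z}).
Hypothesis szN' : (size (map_poly f N') <= d.+1)%N.
Hypothesis N'd : (map_poly f N')`_d = 1.
Hypothesis szD' : (size (map_poly f D') <= d.+1)%N.
Hypothesis shD' : sh -> map_poly f D' = 1.

(** A fibre at which the family [(N', D')] is the generic map again. *)
Definition good_specialization (W : fieldType) (kW : {rmorphism K -> W})
    (g : {rmorphism R -> W}) :=
  [/\ forall r, f r = 0 -> g r = 0,
      forall c : k, g (kap c) = kW (tofrac c%:MP),
      map_poly g N' = map_poly kW N & map_poly g D' = map_poly kW D].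

(** A polynomial in the indeterminates that dies in the family also dies under [g0], where it is
    evaluated at the generic coefficients; so it is zero, and [K] embeds into [Z]. The same
    inclusion of kernels carries relations to every good fibre. *)
Lemma generic_embedding (W0 : fieldType) (kW0 : {rmorphism K -> W0}) (g0 : {rmorphism R -> W0}) :
  good_specialization kW0 g0 ->
  exists psi : {rmorphism K -> Z},
    [/\ map_poly psi N = map_poly f N', map_poly psi D = map_poly f D' &
     forall (W : fieldType) (kW : {rmorphism K -> W}) (g : {rmorphism R -> W}),
       good_specialization kW g -> forall n (y : 'I_n -> R) (Q : {mpoly K[n]}),
       mmap psi (f \o y) Q = 0 -> mmap kW (g \o y) Q = 0].
Proof.
have [th [thC thP]] := gen_lift gen kap N' D'.
have gth (W : fieldType) (kW : {rmorphism K -> W}) (g : {rmorphism R -> W}) :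
    good_specialization kW g -> forall a, kW (tofrac a) = g (th a).
  move=> [fg gC gN gD] a.
  have [||||gN' gD'] := thP _ g.
  - by rewrite gN /N -map_poly_comp (leq_trans (size_poly _ _)) ?(gen_szN gen).
  - by rewrite gN /N coef_map /= coef_map /= (gen_Nd gen) !rmorph1.
  - by rewrite gD /D -map_poly_comp (leq_trans (size_poly _ _)) ?(gen_szD gen).
  - by move=> s; rewrite gD /D (gen_sh gen s) !rmorph1.
  apply: esym; apply: (gen_eq gen (g := [the {rmorphism _ -> _} of g \o th])
     (h := [the {rmorphism _ -> _} of kW \o (@tofrac {mpoly k[m]})])).
  - by move=> c /=; rewrite thC gC.
  - by rewrite gN' gN /N -map_poly_comp.
  - by rewrite gD' gD /D -map_poly_comp.
move=> good0; have [fg0 _ _ _] := good0.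
have [|psi psiE] := fraction_lift (g := [the {rmorphism _ -> _} of f \o th]).
  move=> a /= /fg0; rewrite -(gth _ _ _ good0) => /eqP.
  by rewrite fmorph_eq0 tofrac_eq0 => /eqP.
have [N'E D'E] := thP _ f szN' N'd szD' shD'.
exists psi; split.
- by rewrite /N -map_poly_comp -N'E; apply: eq_map_poly.
- by rewrite /D -map_poly_comp -D'E; apply: eq_map_poly.
move=> W kW g good n y Q; move=> Q0; apply: (@relations_lift _ R Z W th f g psi kW n y Q) => //.
  by case: good.
exact: gth.
Qed.

End GenericLift.

Lemma splitting_roots (K : fieldType) (p : {poly K}) M : size p = M.+1 ->
  exists (L : fieldExtType K) (x : 'I_M -> L),
    map_poly (in_alg L) p = (lead_coef p)%:A *: \prod_i ('X - (x i)%:P).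
Proof.
move=> szp; have p0 : p != 0 by rewrite -size_poly_eq0 szp.
have [L [rs]] := splits_in_extension p0.
set q := \prod_(_ <- _) _ => Dp; exists L.
have sz_rs : size rs = M.
  by apply: succn_inj; rewrite -(size_prod_XsubC rs id) -(eqp_size Dp) size_map_poly.
exists (fun i => rs`_i).
have /eqp_eq := Dp; rewrite (monicP (monic_prod_XsubC _ _ _)) scale1r lead_coef_map => ->.
by rewrite /q (big_nth 0) sz_rs big_mkord.
Qed.

(** Inverting the leading coefficient, which survives under [g], reduces this to the monic case; [w]
    is the root that [roots_specialization] matches with [z]. *)
Lemma root_specialization (R : comNzRingType) (Z W : fieldType)
    (f : {rmorphism R -> Z}) (g : {rmorphism R -> W}) (M : nat) (P : {poly R}) z :
    (forall r, f r = 0 -> g r = 0) ->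
    (size P <= M.+1)%N -> g P`_M != 0 -> root (map_poly f P) z ->
  exists (W' : fieldType) (j : {rmorphism W -> W'}) (w : W'),
    root (map_poly (j \o g) P) w /\
    forall Q : {poly R}, (map_poly f Q).[z] = 0 -> (map_poly (j \o g) Q).[w] = 0.
Proof.
move=> fg szP gP0 Pz; have fP0 : f P`_M != 0 by apply: contraNneq gP0 => /fg->.
have lead (T : fieldType) (h : {rmorphism R -> T}) : h P`_M != 0 ->
    size (map_poly h P) = M.+1 /\ lead_coef (map_poly h P) = h P`_M.
  move=> hP; have sz : size (map_poly h P) = M.+1.
    apply/eqP; rewrite eqn_leq (leq_trans (size_poly _ _) szP) ltnNge.
    by apply: contra hP => le; rewrite -coef_map nth_default.
  by rewrite lead_coefE sz coef_map.
have [szf lf] := lead _ f fP0; have [szg lg] := lead _ g gP0.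
have [Z' [x Dx]] := splitting_roots szf; have [W' [y Dy]] := splitting_roots szg.
pose i := [the {rmorphism Z -> Z'} of in_alg Z']; pose j := [the {rmorphism W -> W'} of in_alg W'].
pose f1 := [the {rmorphism R -> Z'} of i \o f]; pose g1 := [the {rmorphism R -> W'} of j \o g].
have fg1 r : f1 r = 0 -> g1 r = 0.
  by move/eqP; rewrite /= scaler_eq0 oner_eq0 orbF => /eqP/fg->; rewrite scale0r.
have g10 : g1 P`_M != 0 by rewrite /= scaler_eq0 oner_eq0 orbF.
have f10 : f1 P`_M != 0 by rewrite /= scaler_eq0 oner_eq0 orbF.
have fg2 := invert_specialization fg1 g10.
pose f2 := [the {rmorphism {poly R} -> Z'} of eval_ext f1 (f1 P`_M)^-1].
pose g2 := [the {rmorphism {poly R} -> W'} of eval_ext g1 (g1 P`_M)^-1].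
pose P2 := ('X : {poly R})%:P * map_poly polyC P : {poly {poly R}}.
have P2E (T : fieldType) (h : {rmorphism R -> T}) b :
    map_poly (eval_ext h b) P2 = b *: map_poly h P.
  rewrite rmorphM /= map_polyC /= eval_extX mul_polyC -map_poly_comp; congr (_ *: _).
  by apply: eq_map_poly => c /=; rewrite eval_extC.
have Px : map_poly f2 P2 = \prod_i ('X - (x i)%:P).
  by rewrite P2E map_poly_comp Dx lf scalerA mulVf ?scale1r.
have Py : map_poly g2 P2 = \prod_i ('X - (y i)%:P).
  by rewrite P2E map_poly_comp Dy lg scalerA mulVf ?scale1r.
have [tau tauP] := roots_specialization fg2 Px Py.
have [l Dl] : exists l, i z = x l.
  apply: root_prod_ord; rewrite -Px P2E rootZ ?invr_eq0 // map_poly_comp.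
  by rewrite (fmorph_root i).
exists W', j, (y (tau l)); split.
  rewrite -/g1 -(rootZ _ _ (a := (g1 P`_M)^-1)) ?invr_eq0 // -P2E Py.
  by rewrite (bigD1 (tau l)) //= rootM root_XsubC eqxx.
move=> Q Qz; pose Q' : {mpoly {poly R}[M]} := (map_poly (@mpolyC M _ \o polyC) Q).['X_l].
have Q'E (T : fieldType) (h : {rmorphism R -> T}) b (u : 'I_M -> T) :
    mmap (eval_ext h b) u Q' = (map_poly h Q).[u l].
  rewrite -horner_map /= mmapX mmap1U -map_poly_comp; congr _.[_].
  by apply: eq_map_poly => c /=; rewrite mmapC; apply: eval_extC.
have := tauP Q'; rewrite !Q'E; apply.
by rewrite -Dl map_poly_comp horner_map Qz rmorph0.
Qed.

Lemma size_orbit (F : fieldType) d (g u : {poly F}) :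
    (1 < d)%N -> size g = d.+1 -> (1 < size u)%N ->
  size (g \Po u + 'X) = (d * (size u).-1).+1.
Proof.
move=> d1 szg szu; have e := size_comp_poly g u; rewrite szg /= in e.
have szc : size (g \Po u) = (d * (size u).-1).+1.
  by rewrite -e prednK // lt0n; apply: contraTneq szu => s0; move: e;
    rewrite s0 -leqNgt; case: (size u) => [|[|s]] //=; nia.
by rewrite size_polyDl szc // size_polyX ltnS; nia.
Qed.

(** The variable is a parameter [mu], and the sequence is the orbit of [0] under [g(x) + mu]. The
    degrees in [mu] grow strictly, so the orbit never returns to [0]. *)
Lemma size_orbit0 (F : fieldType) d (g : {poly F}) j :
    (1 < d)%N -> size g = d.+1 -> g.[0] = 0 ->
  size (iter j.+1 (fun u => g \Po u + 'X) 0) = (d ^ j).+1.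
Proof.
move=> d1 szg g0; elim: j => [|j IHj].
  by rewrite /= comp_poly0r -horner_coef0 g0 polyC0 add0r size_polyX.
by rewrite iterS (size_orbit d1 szg) IHj ?expnS // ltnS expn_gt0 ltnW.
Qed.

(** * Simple zeros and absence of poles for the generic iterates *)

Section Nondegeneracy.
Variables (k : fieldType) (d m : nat) (sh : bool) (NR DR : {poly {mpoly k[m]}}).
Hypothesis gen : generic_pair d sh NR DR.
Hypothesis d1 : (1 < d)%N.
Let K : fieldType := ratfield k m.
Let A n := (iterpoly d NR DR n).1.
Let B n := (iterpoly d NR DR n).2.

(** Coefficient of the test map [x^d + e x + mu]. If [p] divides [d], then [e = 1] and the
    derivative is [1]; otherwise [e = 0] and the only critical point is [0], whose orbit never
    returns to [0]. In both cases the iterates have simple zeros. *)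
Let e : k := ((d%:R : k) == 0)%:R.
Let g : {poly k} := 'X^d + e *: 'X.
Let Ns : {poly {poly k}} := map_poly polyC g + ('X : {poly k})%:P.

Let szg : size g = d.+1.
Proof.
rewrite size_polyDl ?size_polyXn // (leq_ltn_trans (size_scale_leq _ _)) //.
by rewrite size_polyX.
Qed.

Let g0 : g.[0] = 0.
Proof. by rewrite !hornerE expr0n -leqn0 leqNgt ltnW //= mulr0 addr0. Qed.

Let szNs : (size Ns <= d.+1)%N.
Proof.
rewrite (leq_trans (size_polyD _ _)) // geq_max (leq_trans (size_poly _ _)) ?szg //.
by rewrite (leq_trans (size_polyC_leq1 _)).
Qed.

Let Nsd : Ns`_d = 1.
Proof.
rewrite coefD coef_map coefC /= coefD coefXn eqxx coefZ coefX.
by rewrite (gtn_eqF d1) (gtn_eqF (ltnW d1)) mulr0 !addr0.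
Qed.

Let special : exists th : {rmorphism {mpoly k[m]} -> {poly k}},
  map_poly th NR = Ns /\ map_poly th DR = 1.
Proof.
have [th [_ thP]] := gen_lift gen (@polyC k) Ns 1.
have [] := thP _ [the {rmorphism {poly k} -> {poly k}} of idfun].
- by rewrite map_poly_id.
- by rewrite map_poly_id.
- by rewrite map_poly_id // size_poly1.
- by rewrite map_poly_id.
rewrite !map_poly_id // => eN eD; exists th; split.
  by rewrite -eN; apply: eq_map_poly.
by rewrite -eD; apply: eq_map_poly.
Qed.

Let Ns_orbit j : iter j.+1 (horner Ns) 0 != 0.
Proof.
have -> : iter j.+1 (horner Ns) 0 = iter j.+1 (fun u => g \Po u + 'X) 0.
  by apply: eq_iter => u; rewrite hornerD hornerC.
by rewrite -size_poly_gt0 (size_orbit0 j d1 szg g0).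
Qed.

Let Ns_critical (W : fieldType) (h : {rmorphism {poly k} -> W}) n w :
    (forall r, h r = 0 -> r = 0) ->
    iter n (horner (map_poly h Ns)) w = 0 ->
  (iter n (fun q => map_poly h Ns \Po q) 'X)^`().[w] != 0.
Proof.
set Nh := map_poly h Ns => h_inj wn.
have crit z : Nh^`().[z] = 0 -> z = 0.
  rewrite /Nh deriv_map /Ns derivD derivC addr0 deriv_map /g derivD derivXn derivZ derivX.
  rewrite rmorphD rmorphMn rmorphD rmorphMn /= !map_polyXn map_polyZ !rmorph1.
  rewrite alg_polyC map_polyC /= hornerD hornerMn hornerXn hornerC /e -mulr_natr.
  have hd : (d%:R : W) = h (d%:R)%:P by rewrite polyC_natr rmorph_nat.
  have [d0|dn0] := eqVneq (d%:R : k) 0.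
    by rewrite hd d0 rmorph0 mulr0 add0r rmorph1 => /eqP; rewrite oner_eq0.
  rewrite polyC0 rmorph0 addr0 => /eqP; rewrite mulf_eq0 expf_eq0 => /orP[/andP[_ /eqP]//|].
  by rewrite hd => /eqP/h_inj/eqP; rewrite polyC_eq0 (negPf dn0).
have nz i : (i < n)%N -> Nh^`().[iter i (horner Nh) w] != 0.
  move=> lti; apply/eqP => /crit w0.
  have : iter (n - i) (horner Nh) 0 = 0.
    by have := wn; rewrite -{1}(subnK (ltnW lti)) iterD w0.
  rewrite -(subnSK lti); set j := (n - i.+1)%N => e0.
  have := Ns_orbit j; rewrite -(inj_eq (f := h)) => [|a b ab]; last first.
    by apply/eqP; rewrite -subr_eq0; apply/eqP/h_inj; rewrite rmorphB ab subrr.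
  rewrite rmorph0 -e0 => /eqP; case; elim: (j.+1) => [|l IHl]; first by rewrite /= rmorph0.
  by rewrite !iterS -IHl horner_map.
elim: n nz {wn} => [|n IHn] nz; first by rewrite derivX hornerC oner_neq0.
rewrite iterS deriv_comp hornerM horner_comp horner_iter_comp mulf_neq0 ?nz //.
by apply: IHn => i lti; apply: nz; apply: ltnW.
Qed.

Lemma generic_lead n : (A n)`_(d ^ n) != 0.
Proof.
have [th [thN thD]] := special.
have [|e1 _] := @coef_iterpoly_top _ d Ns 1 n (ltnW d1) Nsd.
  by rewrite coef1 (gtn_eqF (ltnW d1)).
have := map_iterpoly th d NR DR n; rewrite thN thD => eA.
apply: contraTneq (oner_neq0 {poly k}) => An0; rewrite -e1 eA /= coef_map /=.
by rewrite -/(A n) An0 rmorph0 eqxx.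
Qed.

(** A pole or a multiple root at [z] would specialize to one for the test map, whose denominators
    are [1] and whose iterates have simple zeros. *)
Lemma generic_nondegenerate n (Z : fieldType) (kZ : {rmorphism K -> Z}) z :
    root (map_poly (kZ \o @tofrac _) (A n)) z ->
  (forall l, (map_poly (kZ \o @tofrac _) (B l)).[z] != 0) /\
  (map_poly (kZ \o @tofrac _) (A n))^`().[z] != 0.
Proof.
move=> Anz; have [th [thN thD]] := special.
pose f := [the {rmorphism {mpoly k[m]} -> Z} of kZ \o @tofrac {mpoly k[m]}].
pose h := [the {rmorphism {poly k} -> {fraction {poly k}}} of @tofrac {poly k}].
pose g1 := [the {rmorphism {mpoly k[m]} -> {fraction {poly k}}} of h \o th].
have fg r : f r = 0 -> g1 r = 0.
  by move/eqP; rewrite /= fmorph_eq0 tofrac_eq0 => /eqP->; rewrite !rmorph0.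
have thA l : map_poly th (A l) = (iterpoly d Ns 1 l).1 /\ map_poly th (B l) = 1.
  have := map_iterpoly th d NR DR l; rewrite thN thD => eA.
  have := congr1 snd eA; rewrite /= -/(B l) => <-; rewrite -/(A l).
  have := congr1 fst eA; rewrite /= -/(A l) => <-; split=> //.
  by rewrite iterpoly_comp.
have [||||W' [j [w [w0 wP]]]] := @root_specialization _ _ _ f g1 (d ^ n) (A n) z.
- exact: fg.
- by have [] := size_iterpoly d NR DR n.
- have [|e1 _] := @coef_iterpoly_top _ d Ns 1 n (ltnW d1) Nsd.
    by rewrite coef1 (gtn_eqF (ltnW d1)).
  by rewrite /= -coef_map (thA n).1 e1 tofrac1 oner_neq0.
- exact: Anz.
have jgE Q : map_poly (j \o g1) Q = map_poly (j \o h) (map_poly th Q).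
  by rewrite -map_poly_comp; apply: eq_map_poly.
split=> [l|]; apply/eqP.
  move/wP; rewrite jgE (thA l).2 rmorph1 hornerC => /eqP.
  by rewrite oner_eq0.
rewrite deriv_map => /wP; rewrite jgE -deriv_map (thA n).1.
move: w0; rewrite /root jgE (thA n).1 iterpoly_comp //=.
have iter_map (T : comNzRingType) (u : {rmorphism {poly k} -> T}) :
    map_poly u (iter n (fun q => Ns \Po q) 'X) = iter n (fun q => map_poly u Ns \Po q) 'X.
  elim: n {Anz} => [|n IHn]; first by rewrite map_polyX.
  by rewrite !iterS -IHn map_comp_poly.
rewrite -deriv_map !iter_map horner_iter_comp => /eqP w0 /eqP.
apply/negP; apply: Ns_critical w0 => r /eqP.
by rewrite /= fmorph_eq0 tofrac_eq0 => /eqP.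
Qed.

End Nondegeneracy.

(** * Galois transitivity on pairs of siblings *)

(** Three indeterminates over [K], known to the sequel only through their evaluation morphisms. *)
Lemma polynomial_coordinates (K : fieldType) :
  exists (R : idomainType) (kap : {rmorphism K -> R}) (X1 X2 X3 : R),
  forall (L : fieldType) (f : {rmorphism K -> L}) a1 a2 a3,
  exists g : {rmorphism R -> L},
    [/\ forall c, g (kap c) = f c, g X1 = a1, g X2 = a2 & g X3 = a3].
Proof.
exists ({poly {poly {poly K}}} : idomainType).
exists [the {rmorphism K -> {poly {poly {poly K}}}} of polyC \o (polyC \o polyC)].
exists 'X, ('X)%:P, ('X)%:P%:P => L f a1 a2 a3.
exists [the {rmorphism _ -> _} of eval_ext (eval_ext (eval_ext f a3) a2) a1].
split=> [c|||] /=; rewrite ?eval_extX //.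
- by rewrite eval_extC /= eval_extC /= eval_extC.
- by rewrite eval_extC /= eval_extX.
- by rewrite eval_extC /= eval_extC /= eval_extX.
Qed.

Lemma divided_difference (R : comNzRingType) (P : {poly R}) u v :
  exists e, P.[u] - P.[v] = e * (u - v).
Proof.
have /factor_theorem[q Dq] : root (P - P.[v]%:P) v by rewrite /root !hornerE subrr.
exists q.[u]; move/(congr1 (horner^~ u)): Dq.
by rewrite hornerM hornerXsubC hornerD hornerN hornerC.
Qed.

Lemma comp_poly_shift_top (R : comNzRingType) d (P : {poly R}) t :
  (size P <= d.+1)%N ->
  (size (P \Po ('X + t%:P)) <= d.+1)%N /\ (P \Po ('X + t%:P))`_d = P`_d.
Proof.
move=> szP.
have szX j : (size (('X + t%:P) ^+ j : {poly R}) <= j.+1)%N.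
  by apply: leq_trans (size_poly_exp_leq _ _) _; rewrite size_XaddC mul1n.
have -> : P \Po ('X + t%:P) = \sum_(j < d.+1) P`_j *: ('X + t%:P) ^+ j.
  rewrite comp_polyE (big_ord_widen _ (fun j => P`_j *: ('X + t%:P) ^+ j) szP).
  rewrite big_mkcond; apply: eq_bigr => j _; case: ltnP => // le.
  by rewrite nth_default // scale0r.
split.
  apply: leq_trans (size_sum _ _ _) _; apply/bigmax_leqP => j _.
  exact: leq_trans (size_scale_leq _ _) (leq_trans (szX _) _).
rewrite big_ord_recr coefD coefZ coef_sum big1 => [|j _].
  have -> : (('X + t%:P) ^+ d)`_d = 1.
    have := monicP (monic_exp d (monicXaddC t)).
    by rewrite lead_coefE -[t%:P]opprK -polyCN size_exp_XsubC.
  by rewrite add0r mulr1.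
by rewrite coefZ [X in _ * X]nth_default ?mulr0 // (leq_trans (szX _)) /=.
Qed.

Section GenericRoots.
Variables (k : fieldType) (d m : nat) (sh : bool) (NR DR : {poly {mpoly k[m]}}).
Hypothesis gen : generic_pair d sh NR DR.
Hypothesis d1 : (1 < d)%N.
Let K : fieldType := ratfield k m.
Let N : {poly K} := map_poly (@tofrac {mpoly k[m]}) NR.
Let D : {poly K} := map_poly (@tofrac {mpoly k[m]}) DR.
Let A n : {poly K} := (iterpoly d N D n).1.

Lemma gen_shapeK (Z : comNzRingType) (f : {rmorphism K -> Z}) :
  [/\ (size (map_poly f N) <= d.+1)%N, (map_poly f N)`_d = 1,
      (size (map_poly f D) <= d.+1)%N & sh -> map_poly f D = 1].
Proof.
split.
- by rewrite !(leq_trans (size_poly _ _)) ?(gen_szN gen).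
- by rewrite coef_map /= coef_map /= (gen_Nd gen) !rmorph1.
- by rewrite !(leq_trans (size_poly _ _)) ?(gen_szD gen).
- by move=> s; rewrite /D (gen_sh gen s) !rmorph1.
Qed.

Lemma generic_leadK n : (A n)`_(d ^ n) != 0 /\ size (A n) = (d ^ n).+1.
Proof.
have l0 : (A n)`_(d ^ n) != 0.
  rewrite /A /N /D map_iterpoly coef_map /= tofrac_eq0.
  exact: generic_lead gen d1 n.
split=> //; apply/eqP; rewrite eqn_leq; apply/andP; split.
  by have [] := size_iterpoly d N D n.
by rewrite ltnNge; apply: contra l0 => le; rewrite nth_default.
Qed.

Section Target.
Variables (Z : fieldType) (f : {rmorphism K -> Z}).
Local Notation fz := (frac_map (map_poly f N) (map_poly f D)).

(** Nondegeneracy rules out a zero of the numerator whose orbit meets a pole; the orbit then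
    computes the value of the fraction. *)
Lemma generic_root n z : root (map_poly f (A n)) z <->
  (forall i, (i < n)%N -> (map_poly f D).[iter i fz z] != 0) /\ iter n fz z = 0.
Proof.
have [szN _ szD _] := gen_shapeK f.
have AE : (map_poly f (A n)).[z] = (ipair d (map_poly f N) (map_poly f D) n z).1.
  by rewrite -horner_iterpoly1 map_iterpoly.
rewrite /root AE; split=> [An0|[D0 zn]]; last first.
  by have [_ ->] := ipair_frac_map szN szD D0; rewrite zn mulr0.
have [|nd _] := @generic_nondegenerate _ _ _ _ _ _ gen d1 n Z f z.
  by move: An0; rewrite -AE /A /N /D map_iterpoly -map_poly_comp.
have D0 i : (i < n)%N -> (map_poly f D).[iter i fz z] != 0.
  apply: (ipair_neq0_frac_map szN szD) => l _; have := nd l.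
  by rewrite -horner_iterpoly2 /N /D !map_iterpoly /= -map_poly_comp.
split=> //; have [B0 e] := ipair_frac_map szN szD D0.
by move: An0; rewrite e mulf_eq0 (negPf B0) => /eqP.
Qed.

Lemma generic_separable n z :
  root (map_poly f (A n)) z -> (map_poly f (A n))^`().[z] != 0.
Proof.
move=> An0; have [|_] := @generic_nondegenerate _ _ _ _ _ _ gen d1 n Z f z.
  by move: An0; rewrite /A /N /D map_iterpoly -map_poly_comp.
by rewrite /A /N /D map_iterpoly -map_poly_comp.
Qed.

End Target.
End GenericRoots.

(* Any three ring elements [X, X', y] determine [N + interpolation] mapping both
   [X] and [X'] to [y]: subtract from [N] the line through the values of
   [N - y D] at [X] and [X']. *)
Lemma two_point_correction (R : comNzRingType) d (N D : {poly R}) (u v y : R) :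
    (1 < d)%N -> (size N <= d.+1)%N -> N`_d = 1 ->
  exists N' : {poly R},
    [/\ N'.[u] = y * D.[u], N'.[v] = y * D.[v], (size N' <= d.+1)%N, N'`_d = 1 &
     forall (L : fieldType) (g : {rmorphism R -> L}), g u != g v ->
       (map_poly g N).[g u] = g y * (map_poly g D).[g u] ->
       (map_poly g N).[g v] = g y * (map_poly g D).[g v] ->
       map_poly g N' = map_poly g N].
Proof.
move=> d1 szN Nd.
have [C CE] : exists C : {poly R}, forall z, C.[z] = N.[z] - y * D.[z].
  by exists (N - y%:P * D) => z; rewrite !hornerE.
have [e De] := divided_difference C u v.
pose l := (C.[u])%:P + e%:P * ('X - u%:P).
have szl : (size l <= 2)%N.
  rewrite (leq_trans (size_polyD _ _)) // geq_max (leq_trans (size_polyC_leq1 _)) //=.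
  by rewrite mul_polyC (leq_trans (size_scale_leq _ _)) // size_XsubC.
exists (N - l); split.
- by rewrite !hornerE CE; ring.
- rewrite !hornerE; have -> : e * (v - u) = - (C.[u] - C.[v]) by rewrite De; ring.
  by rewrite !CE; ring.
- by rewrite (leq_trans (size_polyD _ _)) // size_polyN geq_max szN (leq_trans szl) // ltnW.
- by rewrite coefB Nd nth_default ?subr0 // (leq_trans szl).
move=> L g uv gu gv; rewrite rmorphB.
have gC z : (map_poly g N).[g z] = g y * (map_poly g D).[g z] -> g C.[z] = 0.
  by rewrite !horner_map CE rmorphB rmorphM => ->; rewrite subrr.
have ge : g e = 0.
  apply/eqP; have := congr1 g De; rewrite rmorphB gC // gC // subrr rmorphM => /esym/eqP.
  by rewrite mulf_eq0 rmorphB subr_eq0 (negPf uv) orbF.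
by rewrite /l rmorphD rmorphM /= !map_polyC /= gC // ge polyC0 mul0r addr0 subr0.
Qed.

(** The factor [w] cancels in the fraction; it leaves room to make the translated numerator monic
    again. *)
Lemma frac_map_shift (M : fieldType) (N D : {poly M}) w t z :
    w != 0 -> D.[z + t] != 0 ->
  frac_map (w *: ((N - t *: D) \Po ('X + t%:P))) (w *: (D \Po ('X + t%:P))) z =
  frac_map N D (z + t) - t.
Proof.
move=> w0 D0; rewrite /frac_map !hornerZ !horner_comp !hornerE.
by rewrite -mulf_div divff // mul1r mulrBl mulfK.
Qed.

Lemma iter_frac_map_shift (M : fieldType) (N D : {poly M}) w t n z
    (F := frac_map N D)
    (F' := frac_map (w *: ((N - t *: D) \Po ('X + t%:P))) (w *: (D \Po ('X + t%:P)))) :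
    w != 0 -> (forall i, (i < n)%N -> D.[iter i F z] != 0) ->
  iter n F' (z - t) = iter n F z - t /\
  forall i, (i < n)%N -> (w *: (D \Po ('X + t%:P))).[iter i F' (z - t)] != 0.
Proof.
move=> w0; elim: n => [|n IHn] D0 //.
have [|e nz] := IHn; first by move=> i lti; apply: D0; apply: ltnW.
have D0n := D0 n (leqnn _); split.
  by rewrite !iterS e /F' frac_map_shift ?subrK.
move=> i; rewrite ltnS leq_eqVlt => /orP[/eqP->|]; last exact: nz.
by rewrite e hornerZ horner_comp !hornerE subrK mulf_neq0.
Qed.

Lemma map_eval_ext_shift (R : comNzRingType) (T : fieldType) (g : {rmorphism R -> T}) b
    (N D : {poly R}) (w t : {poly R}) (g1 := eval_ext g b) :
  map_poly g1 (w%:P * ((map_poly polyC N - t%:P * map_poly polyC D) \Po ('X + t%:P))) =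
    g1 w *: ((map_poly g N - (g1 t) *: map_poly g D) \Po ('X + (g1 t)%:P)) /\
  map_poly g1 (w%:P * (map_poly polyC D \Po ('X + t%:P))) =
    g1 w *: (map_poly g D \Po ('X + (g1 t)%:P)).
Proof.
have gC Q : map_poly g1 (map_poly polyC Q) = map_poly g Q.
  by rewrite -map_poly_comp; apply: eq_map_poly => c /=; apply: eval_extC.
have gXt : map_poly g1 ('X + t%:P) = 'X + (g1 t)%:P.
  by rewrite rmorphD /= map_polyX map_polyC.
split; rewrite rmorphM /= map_polyC /= mul_polyC map_comp_poly gXt ?gC //.
by rewrite rmorphB rmorphM /= map_polyC /= !gC mul_polyC.
Qed.

Section SiblingTransitivity.
Variables (k : fieldType) (d m : nat) (sh : bool) (NR DR : {poly {mpoly k[m]}}).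
Hypothesis gen : generic_pair d sh NR DR.
Hypothesis d1 : (1 < d)%N.
Let K : fieldType := ratfield k m.
Let N : {poly K} := map_poly (@tofrac {mpoly k[m]}) NR.
Let D : {poly K} := map_poly (@tofrac {mpoly k[m]}) DR.
Let A n : {poly K} := (iterpoly d N D n).1.
Variables (L : splittingFieldType K) (n : nat).
Hypothesis galL : galois 1 {:L}.
Hypothesis n_gt0 : (0 < n)%N.
Variables (x : 'I_(d ^ n) -> L).
Hypothesis Ax : map_poly (in_alg L) (A n) = (lead_coef (A n))%:A *: \prod_i ('X - (x i)%:P).

Let NL := map_poly (in_alg L) N.
Let DL := map_poly (in_alg L) D.
Let fL := frac_map NL DL.

Definition siblings (a b : L) :=
  [/\ root (map_poly (in_alg L) (A n)) a, root (map_poly (in_alg L) (A n)) b,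
      a != b & fL a = fL b].

(* A field over which the generic fraction acquires two generic points
   [X1 - t, X2 - t] forming a pair of siblings: every pair of siblings in [L] is
   a specialization of that one. *)
Lemma generic_siblings a0 b0 : siblings a0 b0 ->
  exists (M : fieldType) (psi : {rmorphism K -> M}) (u v : M),
    [/\ u != v, root (map_poly psi (A n)) u, root (map_poly psi (A n)) v,
        frac_map (map_poly psi N) (map_poly psi D) u =
        frac_map (map_poly psi N) (map_poly psi D) v &
     forall a b, siblings a b -> forall Q : {mpoly K[2]},
       mmap psi (fun i => if i == ord0 then u else v) Q = 0 ->
       mmap (in_alg L) (fun i => if i == ord0 then a else b) Q = 0].
Proof.
move=> sib0; have [R [kap [X1 [X2 [y gP]]]]] := polynomial_coordinates K.
have [szN Nd szD shD] := gen_shapeK gen kap.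
set N0 := map_poly kap _ in szN Nd; set D0 := map_poly kap _ in szD shD.
have [Ns [NsX1 NsX2 szNs Nsd NsE]] := two_point_correction D0 X1 X2 y d1 szN Nd.
(* The translation [t] is to be [P.1 / P.2], the [n]-th image of [X1], and the normalizing factor
   [w] is to be the inverse of [1 - t * D0_d], that is [P.2 / (P.2 - P.1 * D0_d)]. Both have
   denominators dividing [s], and the variable of [{poly R}] stands for [1 / s]. *)
pose P := ipair d Ns D0 n X1.
pose s := P.2 * (P.2 - P.1 * D0`_d).
pose M : fieldType := {fraction R}.
pose i0 := [the {rmorphism R -> M} of @tofrac R].
pose i1 := [the {rmorphism {poly R} -> M} of eval_ext i0 (i0 s)^-1].
pose t : {poly R} := (P.1 * (P.2 - P.1 * D0`_d))%:P * 'X.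
pose w : {poly R} := (P.2 ^+ 2)%:P * 'X.
pose N1 := w%:P * ((map_poly polyC Ns - t%:P * map_poly polyC D0) \Po ('X + t%:P)).
pose D1 := w%:P * (map_poly polyC D0 \Po ('X + t%:P)).
pose kap1 := [the {rmorphism k -> {poly R}} of
   polyC \o (kap \o ((@tofrac {mpoly k[m]}) \o (@mpolyC m k)))].
have evN (T : fieldType) (g : {rmorphism R -> T}) b :=
  map_eval_ext_shift g b Ns D0 w t.
have tw (T : fieldType) (g : {rmorphism R -> T}) (g1 := eval_ext g (g s)^-1) :
    g s != 0 -> [/\ g P.2 != 0, g1 t = g P.1 / g P.2 &
    g1 w * (1 - g1 t * (map_poly g D0)`_d) = 1].
  rewrite rmorphM mulf_eq0 negb_or => /andP[P20]; rewrite rmorphB rmorphM => s20.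
  have Et : g1 t = g P.1 / g P.2.
    rewrite /g1 /t /s [LHS]rmorphM /= eval_extC eval_extX !rmorphM rmorphB rmorphM.
    by field; rewrite P20.
  split=> //; rewrite Et /g1 /w /s rmorphM /= eval_extC eval_extX !rmorphM ?rmorphXn.
  rewrite rmorphB rmorphM (coef_map g); field.
  by apply/andP; split.
have shape (T : fieldType) (g : {rmorphism R -> T}) (g1 := eval_ext g (g s)^-1) :
    g s != 0 -> [/\ (size (map_poly g1 N1) <= d.+1)%N, (map_poly g1 N1)`_d = 1,
      (size (map_poly g1 D1) <= d.+1)%N & sh -> map_poly g1 D1 = 1].
  move=> /tw[P20 Et Ew]; have [-> ->] := evN T g (g s)^-1; rewrite -/g1.
  have szT (Q : {poly R}) : (size Q <= d.+1 -> size (map_poly g Q) <= d.+1)%N.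
    exact: leq_trans (size_poly _ _).
  have szND : (size (map_poly g Ns - g1 t *: map_poly g D0)%R <= d.+1)%N.
    rewrite (leq_trans (size_polyD _ _)) // geq_max szT // size_polyN.
    by rewrite (leq_trans (size_scale_leq _ _)) ?szT.
  have [sz1 c1] := comp_poly_shift_top (g1 t) szND.
  have [sz2 c2] := comp_poly_shift_top (g1 t) (szT _ szD).
  split; rewrite ?(leq_trans (size_scale_leq _ _)) //.
    by rewrite coefZ c1 coefB coefZ [(map_poly g Ns)`_d]coef_map /= Nsd rmorph1 Ew.
  move=> s1; move: Ew; rewrite (shD s1) rmorph1 coef1 (gtn_eqF (ltnW d1)) mulr0 subr0 mulr1.
  by rewrite -/g1 => ->; rewrite scale1r -polyC1 comp_polyC.
have rootL := generic_root gen d1 (in_alg L) n.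
(* At [X1 = a], [X2 = b] and [y] their common image, the interpolation changes nothing, and the
   [n]-th image [0] of [a] makes the translation trivial: this fibre is the generic map. *)
have special a b : siblings a b -> exists g : {rmorphism R -> L},
    [/\ g s != 0, g X1 = a, g X2 = b & [/\ good_specialization NR DR kap1 N1 D1 i1
       (in_alg L) [the {rmorphism {poly R} -> L} of eval_ext g (g s)^-1],
       eval_ext g (g s)^-1 t = 0, g D0.[X2] != 0 &
       forall l, (l <= n)%N -> g (ipair d Ns D0 l X1).2 != 0]].
  move=> [/rootL[a0' fa0] /rootL[b0' fb0] ab fab].
  have [g [gK gX1 gX2 gy]] := gP L (in_alg L) a b (fL a).
  exists g.
  have gN : map_poly g N0 = NL by rewrite -map_poly_comp; apply: eq_map_poly.
  have gD : map_poly g D0 = DL by rewrite -map_poly_comp; apply: eq_map_poly.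
  have gNs : map_poly g Ns = NL.
    rewrite -gN; apply: NsE; first by rewrite gX1 gX2.
      rewrite gN gD gX1 gy /fL /frac_map divfK //; exact: (a0' 0%N).
    by rewrite gN gD gX2 gy fab /fL /frac_map divfK //; apply: (b0' 0%N).
  have [szNL _ szDL _] := gen_shapeK gen (in_alg L).
  have gPl l : (l <= n)%N -> g (ipair d Ns D0 l X1).2 != 0 /\
     g (ipair d Ns D0 l X1).1 = g (ipair d Ns D0 l X1).2 * iter l fL a.
    move=> leln; have := rmorph_ipair g d Ns D0 l X1; rewrite gNs gD gX1 => e.
    have [|B0] := @ipair_frac_map _ d NL DL szNL szDL l a.
      by move=> i lti; apply: a0'; apply: leq_trans leln.
    by rewrite e in B0 *.
  have [P20 P1] := gPl n (leqnn _); rewrite fa0 mulr0 in P1.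
  have gs0 : g s != 0.
    by rewrite /s rmorphM rmorphB rmorphM P1 mul0r subr0 mulf_neq0.
  have [_ Et Ew] := tw L g gs0; rewrite P1 mul0r in Et.
  rewrite Et mul0r subr0 mulr1 in Ew.
  split=> //; split=> //; last 2 first.
  - by rewrite -horner_map gD gX2; apply: (b0' 0%N).
  - by move=> l /gPl[].
  have [eN eD] := evN L g (g s)^-1.
  rewrite Et Ew !scale1r !scale0r subr0 polyC0 addr0 !comp_polyXr in eN eD.
  split=> [||/=|/=]; rewrite ?eN ?eD //.
  - have i0s : i0 s = tofrac s by [].
    apply: invert_specialization => // r /eqP; rewrite tofrac_eq0 => /eqP->.
    exact: rmorph0.
  - by move=> c /=; rewrite eval_extC /= gK.
have [g0 [g0s g0X1 g0X2 [good0 g0t DLb g0B]]] := special _ _ sib0.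
have i0s : i0 s != 0.
  by rewrite tofrac_eq0; apply: contraNneq g0s => ->; rewrite rmorph0.
have [sz1 c1 sz2 c2] := shape M i0 i0s.
have [psi [psiN psiD psiP]] := generic_embedding gen sz1 c1 sz2 c2 good0.
have [P20 Et Ew] := tw M i0 i0s.
have [eN eD] := evN M i0 (i0 s)^-1.
set NM := map_poly i0 Ns in eN; set DM := map_poly i0 D0 in eN eD Ew.
set tM := eval_ext _ _ t in Et Ew eN eD; set wM := eval_ext _ _ w in Ew eN eD.
have wM0 : wM != 0.
  by apply: contraTneq (oner_neq0 M) => w0; rewrite -Ew w0 mul0r eqxx.
pose F := frac_map NM DM.
have i0_neq0 r : g0 r != 0 -> i0 r != 0.
  by rewrite tofrac_eq0; apply: contraNneq => ->; rewrite rmorph0.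
have szM (Q : {poly R}) : (size Q <= d.+1 -> size (map_poly i0 Q) <= d.+1)%N.
  exact: leq_trans (size_poly _ _).
have X1nz i : (i < n)%N -> DM.[iter i F (i0 X1)] != 0.
  apply: (ipair_neq0_frac_map (szM _ szNs) (szM _ szD)) => l leln.
  by rewrite rmorph_ipair /=; apply/i0_neq0/g0B.
have FX1 : iter n F (i0 X1) = tM.
  have [] := ipair_frac_map (szM _ szNs) (szM _ szD) X1nz.
  rewrite rmorph_ipair -/P Et -/F /= => _ ->.
  by rewrite mulrAC divff // mul1r.
have DX1 : DM.[i0 X1] != 0 by apply: (X1nz 0%N).
have DX2 : DM.[i0 X2] != 0.
  by rewrite horner_map; apply: i0_neq0.
have FX12 : F (i0 X2) = F (i0 X1).
  rewrite /F /frac_map /NM /DM !horner_map NsX1 NsX2 !rmorphM.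
  by rewrite -!horner_map !mulfK.
have iterX2 i : iter i.+1 F (i0 X2) = iter i.+1 F (i0 X1) by rewrite !iterSr FX12.
have X2nz i : (i < n)%N -> DM.[iter i F (i0 X2)] != 0.
  by case: i => [//|i] lti; rewrite iterX2; apply: X1nz.
have FX2 : iter n F (i0 X2) = tM.
  by rewrite -FX1 -(prednK n_gt0) iterX2.
have [f1 nz1] := iter_frac_map_shift tM wM0 X1nz.
have [f2 nz2] := iter_frac_map_shift tM wM0 X2nz.
have psiN' := etrans psiN eN; have psiD' := etrans psiD eD.
exists M, psi, (i0 X1 - tM), (i0 X2 - tM).
have rootM := generic_root gen d1 psi n.
split.
- rewrite (inj_eq (addIr _)) /= tofrac_eq; case: sib0 => _ _ + _.
  by apply: contraNneq => X12; rewrite -g0X1 -g0X2 X12.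
- apply/(rootM (i0 X1 - tM)); rewrite psiN' psiD'; split; first exact: nz1.
  by rewrite [LHS]f1 FX1 subrr.
- apply/(rootM (i0 X2 - tM)); rewrite psiN' psiD'; split; first exact: nz2.
  by rewrite [LHS]f2 FX2 subrr.
- rewrite psiN' psiD' !frac_map_shift ?subrK //.
  by rewrite -/F FX12.
move=> a b /special[g [gs gX1 gX2 [good gt _ _]]] Q Q0.
pose z (i : 'I_2) : {poly R} := (if i == ord0 then X1%:P else X2%:P) - t.
have := psiP _ _ _ good _ z Q.
have -> : mmap psi (i1 \o z) Q = 0.
  rewrite -Q0; apply: eq_mmap => // i /=; rewrite rmorphB.
  by case: (i == ord0); rewrite /= eval_extC.
move/(_ erefl) => <-; apply: eq_mmap => // i /=; rewrite rmorphB /= gt subr0.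
by case: (i == ord0); rewrite eval_extC ?gX1 ?gX2.
Qed.

(** It is enough that one pair be sent to every pair of siblings. The generic pair, transported into
    [L] by matching the roots of [A n], is such a pair. *)
Lemma sibling_transitivity a b a' b' : siblings a b -> siblings a' b' ->
  exists2 s, s \in 'Gal({:L} / 1%VS)%g & s a = a' /\ s b = b'.
Proof.
move=> sib sib'.
suff [a0 [b0 tr]] : exists a0 b0, forall c e, siblings c e ->
    exists2 s, s \in 'Gal({:L} / 1%VS)%g & s a0 = c /\ s b0 = e.
  have [s1 s1G [s1a s1b]] := tr _ _ sib; have [s2 s2G [s2a s2b]] := tr _ _ sib'.
  exists (s1^-1 * s2)%g; first by rewrite groupM ?groupV.
  have V z : (s1^-1)%g (s1 z) = z by rewrite -galM ?memvf // mulgV gal_id.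
  by rewrite !galM ?memvf // -s1a -s1b !V.
have [M [psi [u [v [uv Au Av fuv rel]]]]] := generic_siblings sib.
have [An0 szA] := generic_leadK gen d1 n.
have lA : lead_coef (A n) != 0 by rewrite lead_coefE szA.
have sz_psi : size (map_poly psi (A n)) = (d ^ n).+1 by rewrite size_map_poly.
have [W [y Dy]] := splitting_roots sz_psi.
pose P := (lead_coef (A n))^-1 *: A n.
have Px : map_poly (in_alg L) P = \prod_i ('X - (x i)%:P).
  rewrite map_polyZ Ax scalerA -[X in X *: _]rmorphM mulVf // rmorph1 scale1r.
  by [].
pose psiW := [the {rmorphism K -> W} of in_alg W \o psi].
have Py : map_poly psiW P = \prod_i ('X - (y i)%:P).
  rewrite map_poly_comp map_polyZ /= map_polyZ Dy lead_coef_map /= scalerA.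
  by rewrite -[X in X *: _](rmorphM (in_alg W)) -rmorphM mulVf // !rmorph1 scale1r.
have [tau tauP] := embed_roots Px Py.
have root_y z : root (map_poly psi (A n)) z -> exists i, z%:A = y (tau i).
  move=> Az; have [|i Di] := @root_prod_ord _ _ y z%:A.
    by rewrite -Py map_poly_comp map_polyZ (fmorph_root (in_alg W)) rootZ ?fmorph_eq0 ?invr_eq0.
  by exists ((tau^-1)%g i); rewrite permKV.
have [i Di] := root_y _ Au; have [j Dj] := root_y _ Av.
exists (x i), (x j) => c e sib_ce.
pose r (l : 'I_2) := if l == ord0 then x i else x j.
pose r' (l : 'I_2) := if l == ord0 then c else e.
have [|s sG sP] := @gal_extends_relations _ _ _ r r' galL.
  move=> Q Q0; apply: (rel _ _ sib_ce).
  pose Q' : {mpoly K[d ^ n]} := mmap (@mpolyC _ K) (fun l => 'X_(if l == ord0 then i else j)) Q.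
  have Q'E (T : fieldType) (h : {rmorphism K -> T}) (z : 'I_(d ^ n) -> T) :
      mmap h z Q' = mmap h (fun l => if l == ord0 then z i else z j) Q.
    rewrite rmorph_mmap; apply: eq_mmap => [b0|l] /=; first exact: mmapC.
    by rewrite mmapX mmap1U; case: ifP.
  have /tauP : mmap (in_alg L) x Q' = 0 by rewrite Q'E.
  rewrite Q'E -Di -Dj => Qy; apply: (fmorph_inj (in_alg W)); rewrite rmorph0 -Qy.
  by rewrite rmorph_mmap; apply: eq_mmap => // l /=; case: ifP.
by exists s => //; split; [apply: (sP ord0)|apply: (sP (lift ord0 ord0))].
Qed.

End SiblingTransitivity.

(** * Recognizing the full automorphism group of a tree from sibling swaps *)

Section WreathGalois.
Variables (K : fieldType) (L : splittingFieldType K) (d n : nat).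
Variables (f : L -> L) (lam : seq 'I_d -> L).
Let G := 'Gal({:L} / 1%VS)%g.
Hypothesis fG : forall s, s \in G -> forall z, s (f z) = f (s z).
Hypothesis lamS : forall w i, (size w < n)%N -> f (lam (rcons w i)) = lam w.
Hypothesis lam_inj : forall w w', size w = size w' -> (size w <= n)%N ->
  lam w = lam w' -> w = w'.
Hypothesis lam_perm : forall s, s \in G -> forall w, size w = n ->
  exists2 w', size w' = n & s (lam w) = lam w'.
Hypothesis lam_swap : forall w i j, (size w < n)%N -> i != j -> exists2 s, s \in G &
  [/\ s (lam (rcons w i)) = lam (rcons w j), s (lam (rcons w j)) = lam (rcons w i) &
   forall v, size v = (size w).+1 -> v != rcons w i -> v != rcons w j -> s (lam v) = lam v].
Hypothesis lam_gen : forall s, s \in G -> (forall w, size w = n -> s (lam w) = lam w) -> s = 1%g.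

Let lt (t : n.-tuple 'I_d) := lam t.

Let lt_inj : injective lt.
Proof. by move=> t t' /lam_inj e; apply/val_inj/e; rewrite ?size_tuple. Qed.

Let lam_take (w : seq 'I_d) l : size w = n -> (l <= n)%N ->
  iter (n - l) f (lam w) = lam (take l w).
Proof.
move=> sw len; rewrite -{2}(subKn len); elim: (n - l)%N (leq_subr l n) => [|j IHj] lej.
  by rewrite subn0 take_oversize ?sw.
rewrite iterS IHj 1?ltnW //; set i := (n - j.+1)%N.
have -> : (n - j = i.+1)%N by rewrite subnSK.
have lti : (i < size w)%N by rewrite sw /i; lia.
have a : 'I_d by case: (w) lti => [|a] //.
by rewrite (take_nth a) // lamS // size_takel -?sw // ltnW.
Qed.

Let iter_f s : s \in G -> forall j z, s (iter j f z) = iter j f (s z).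
Proof. by move=> sG; elim=> [|j IHj] z //; rewrite !iterS fG ?IHj. Qed.

Let act_ex s : exists p : {perm n.-tuple 'I_d}, s \in G -> forall t, s (lt t) = lt (p t).
Proof.
case: (boolP (s \in G)) => [sG|_]; last by exists 1%g.
have im t : exists t', s (lt t) = lt t'.
  have [w sw e] := lam_perm sG (size_tuple t).
  by exists (Tuple (introT eqP sw)).
have [p pP] := choice _ im.
have p_inj : injective p.
  by move=> t t' e; have := congr1 lt e; rewrite -!pP => /fmorph_inj/lt_inj.
by exists (perm p_inj) => _ t; rewrite permE.
Qed.

Let act s : {perm n.-tuple 'I_d} := projT1 (constructive_indefinite_description _ (act_ex s)).

Let actP s : s \in G -> forall t, s (lt t) = lt (act s t).
Proof. exact: projT2 (constructive_indefinite_description _ (act_ex s)). Qed.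

Let act_morph : {in G &, {morph act : s u / (s * u)%g >-> (s * u)%g}}.
Proof.
move=> s u sG uG; apply/permP => t; apply: lt_inj.
by rewrite -actP ?groupM // permM galM ?memvf // !actP.
Qed.

Let act_inj : {in G &, injective act}.
Proof.
move=> s u sG uG e; apply/eqP; rewrite eq_mulgV1; apply/eqP.
apply: lam_gen => [|w sw]; first by rewrite groupM ?groupV.
have -> : lam w = lt (Tuple (introT eqP sw)) by [].
have uV : (u^-1)%g \in G by rewrite groupV.
rewrite galM ?memvf // actP // e -actP // -galM ?memvf // mulgV gal_id //.
Qed.

Let act_wreath s : s \in G -> act s \in wreath_power d n.
Proof.
move=> sG; rewrite inE; apply/forallP => t1; apply/forallP => t2; apply/forallP => l.
have len : (l <= n)%N by rewrite -ltnS.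
have eq_take (t t' : n.-tuple 'I_d) :
    (take l t == take l t') = (iter (n - l) f (lt t) == iter (n - l) f (lt t')).
  rewrite !lam_take ?size_tuple //; apply/eqP/eqP => [->//|]; apply: lam_inj.
    by rewrite !size_takel ?size_tuple.
  by rewrite size_takel ?size_tuple.
by rewrite !eq_take -!actP // -!iter_f // (inj_eq (fmorph_inj s)).
Qed.

(** Induction on the level. Among the elements that agree with [g] at level [l], take one that
    agrees for the most leaves at level [l.+1]. If some leaf disagreed, composing with a swap of two
    siblings would correct it and spoil none of the others. *)
Lemma wreath_swap_extension (g : {perm n.-tuple 'I_d}) : g \in wreath_power d n ->
  forall l, (l <= n)%N -> exists2 s, s \in G &
    forall t : n.-tuple 'I_d, s (lam (take l t)) = lam (take l (g t)).
Proof.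
rewrite inE => /forallP gW.
have gtake l (t t' : n.-tuple 'I_d) : (l <= n)%N ->
    (take l t == take l t') = (take l (g t) == take l (g t')).
  by move=> len; have /forallP/(_ t')/forallP/(_ (Ordinal (len : (l < n.+1)%N)))/eqP := gW t.
have szt l (t : n.-tuple 'I_d) : (l <= n)%N -> size (take l t) = l.
  by move=> len; rewrite size_takel ?size_tuple.
elim=> [|l IHl] ltn; first by exists 1%g; rewrite ?group1 // => t; rewrite !take0 gal_id.
have len := ltnW ltn; have [s0 s0G s0P] := IHl len.
pose good (s : gal_of {:L}) := (s \in G) && [forall t : n.-tuple 'I_d,
   s (lam (take l t)) == lam (take l (g t))].
pose agree (s : gal_of {:L}) := [set t : n.-tuple 'I_d |
   s (lam (take l.+1 t)) == lam (take l.+1 (g t))].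
have good0 : good s0 by rewrite /good s0G; apply/forallP => t; rewrite s0P.
case: (@arg_maxnP _ s0 good (fun s => #|agree s|) good0) => s /andP[sG /forallP sl] smax.
exists s => // t; apply/eqP; apply: contraT => nt.
have takeS (u : n.-tuple 'I_d) : exists i, take l.+1 u = rcons (take l u) i.
  by exists (tnth u (Ordinal ltn)); rewrite (tnth_nth (tnth u (Ordinal ltn))) -take_nth ?size_tuple.
have im (u : n.-tuple 'I_d) : exists t' : n.-tuple 'I_d, s (lam (take l.+1 u)) = lam (take l.+1 t').
  exists (act s u); rewrite -!lam_take ?size_tuple // iter_f //.
  by congr iter; rewrite actP.
have [t1 Dt1] := im t; have [i Di] := takeS t1; have [j Dj] := takeS (g t).
have e12 : take l t1 = take l (g t).
  have [a Da] := takeS t.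
  apply: lam_inj; rewrite ?szt // -(eqP (sl t)).
  rewrite -(lamS i) ?szt // -Di -Dt1 -fG // Da lamS // szt //.
rewrite e12 in Di; set w := take l (g t) in Di Dj.
have nij : i != j.
  by apply: contraNneq nt => ij; rewrite Dt1 Di Dj ij.
have szw : size w = l by rewrite szt.
have [u uG [u1 u2 uoth]] := lam_swap (w := w) (eq_ind_r (fun a => (a < n)%N) ltn szw) nij.
(* The swap is trivial one level up, since [f] commutes with it and computes the parent from any
   child. *)
have ulow v : size v = l -> u (lam v) = lam v.
  move=> sv; have [vw|nvw] := eqVneq v w.
    by rewrite vw -{1}(lamS i) ?szw // fG // u1 lamS ?szw.
  rewrite -(lamS i) ?sv // fG // uoth ?size_rcons ?sv ?szw //.
    by apply: contraNneq nvw => /rcons_inj[->].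
  by apply: contraNneq nvw => /rcons_inj[->].
have good_su : good (s * u)%g.
  rewrite /good groupM //; apply/forallP => t'.
  by rewrite galM ?memvf // (eqP (sl t')) ulow // szt.
have : (#|agree (s * u)%g| <= #|agree s|)%N := smax _ good_su.
rewrite leqNgt => /negP[]; apply: proper_card.
apply/properP; split; last first.
  by exists t; rewrite !inE // galM ?memvf // Dt1 Di u1 Dj.
(* A leaf that is already correct is not sent to either of the two swapped nodes: otherwise it would
   have the same prefix as [t], which is not correct. *)
apply/subsetP => t'; rewrite !inE => /eqP st'; rewrite galM ?memvf // st'.
apply/eqP/uoth; first by rewrite szt // szw.
  rewrite -Di; apply: contraNneq nt => e.
  have tt' : take l.+1 t' = take l.+1 t.
    apply: lam_inj; rewrite ?szt //.
    have es : s (lam (take l.+1 t')) = s (lam (take l.+1 t)) by rewrite st' Dt1 e.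
    exact: fmorph_inj es.
  by rewrite -tt' st'; apply/eqP; congr lam; apply/eqP; rewrite -gtake // tt'.
rewrite -Dj; apply: contraNneq nt => e.
have /eqP tt' : take l.+1 t' == take l.+1 t by rewrite gtake // e.
by rewrite -tt' st' e.
Qed.

Lemma gal_isog_wreath : (G \isog wreath_power d n)%g.
Proof.
pose F := Morphism act_morph.
suff -> : wreath_power d n = (F @* G)%g.
  by apply: (introT (@isogP _ _ [group of G] [group of (F @* G)%g])); exists F => //; apply/injmP.
apply/esym/eqP; rewrite eqEsubset; apply/andP; split.
  by apply/subsetP => _ /morphimP[s _ sG ->]; apply: act_wreath.
apply/subsetP => g gW; have [s sG sP] := wreath_swap_extension gW (leqnn n).
apply/morphimP; exists s => //; apply/permP => t; apply: lt_inj => /=.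
rewrite -actP //; have := sP t.
by rewrite !take_oversize ?size_tuple // => <-.
Qed.

End WreathGalois.

(** * The tree of iterated preimages of zero *)

Lemma poly_root_seq (F : fieldType) (p : {poly F}) : p != 0 ->
  exists rs : seq F, uniq rs /\ forall z, (z \in rs) = root p z.
Proof.
move: {2}(size p) (leqnn (size p)) => n; elim: n p => [|n IHn] p szp p0.
  by rewrite leqn0 size_poly_eq0 (negPf p0) in szp.
have [[z pz]|noroot] := classic (exists z, root p z); last first.
  exists [::]; split=> // z; rewrite in_nil; apply/esym/negP => pz.
  by apply: noroot; exists z.
have /factor_theorem[q Dp] := pz.
have q0 : q != 0 by apply: contraNneq p0 => q0; rewrite Dp q0 mul0r.
have [|rs [urs rsP]] := IHn q _ q0.
  by move: szp; rewrite Dp size_mul ?polyXsubC_eq0 // size_XsubC addn2.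
exists (undup (z :: rs)); rewrite undup_uniq; split=> // u.
by rewrite mem_undup in_cons rsP Dp rootM root_XsubC orbC.
Qed.

Lemma separable_split (F : fieldType) (p : {poly F}) rs :
  p %= \prod_(z <- rs) ('X - z%:P) -> (forall z, root p z -> p^`().[z] != 0) ->
  separable_poly p.
Proof.
move=> Dp sep; rewrite unlock (eqp_coprimepl _ Dp).
have: all (root p) rs.
  by apply/allP => z rz; rewrite (eqp_root Dp) root_prod_XsubC.
elim: rs {Dp} => [|z rs IHrs]; first by rewrite big_nil coprime1p.
rewrite big_cons /= => /andP[pz prs]; rewrite coprimepMl IHrs // andbT.
by rewrite coprimep_sym coprimep_XsubC /root sep.
Qed.

Lemma sum_le_const (T : eqType) (rs : seq T) (F : T -> nat) c :
  {in rs, forall w, F w <= c}%N -> (\sum_(w <- rs) F w <= c * size rs)%N.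
Proof.
elim: rs => [|a rs IHrs] Fc; first by rewrite big_nil.
rewrite big_cons mulnS leq_add ?Fc ?mem_head // IHrs // => w wr.
by rewrite Fc // in_cons wr orbT.
Qed.

Lemma sum_ge_const (T : eqType) (rs : seq T) (F : T -> nat) c :
  {in rs, forall w, F w <= c}%N -> (c * size rs <= \sum_(w <- rs) F w)%N ->
  {in rs, forall w, F w = c}.
Proof.
elim: rs => [|a rs IHrs] Fc; first by [].
rewrite big_cons mulnS => le w; rewrite in_cons.
have Fr : {in rs, forall w, F w <= c}%N by move=> u ur; rewrite Fc // in_cons ur orbT.
have := sum_le_const Fr; have := Fc a (mem_head _ _) => lea ler.
move: le ler lea; move: (\sum_(u <- rs) F u)%N (c * size rs)%N IHrs => S q IHrs le ler lea.
by case/orP => [/eqP->|wr]; [lia|apply: IHrs wr => //; lia].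
Qed.

Section Tree.
Variables (k : fieldType) (d m : nat) (sh : bool) (NR DR : {poly {mpoly k[m]}}).
Hypothesis gen : generic_pair d sh NR DR.
Hypothesis d1 : (1 < d)%N.
Let K : fieldType := ratfield k m.
Let N : {poly K} := map_poly (@tofrac {mpoly k[m]}) NR.
Let D : {poly K} := map_poly (@tofrac {mpoly k[m]}) DR.
Let A n : {poly K} := (iterpoly d N D n).1.
Variables (L : splittingFieldType K) (n : nat).
Hypothesis splitL : splittingFieldFor 1 (map_poly (in_alg L) (A n)) {:L}.

Let NL := map_poly (in_alg L) N.
Let DL := map_poly (in_alg L) D.
Let fL := frac_map NL DL.
Let T l := root (map_poly (in_alg L) (A l)).

Lemma generic_galois : galois 1 {:L}.
Proof.
have [rs Drs _] := splitL.
apply/splitting_galoisField; exists (map_poly (in_alg L) (A n)).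
split=> //; first by apply/polyOverP => i; rewrite coef_map /= rpredZ ?rpred1.
apply: (separable_split Drs) => z; exact: (generic_separable gen d1).
Qed.

Let T0 z : T 0 z = (z == 0).
Proof. by rewrite /T /A /= map_polyX rootX. Qed.

Let TP l z : T l z <-> (forall i, (i < l)%N -> DL.[iter i fL z] != 0) /\ iter l fL z = 0.
Proof. exact: (generic_root gen d1 (in_alg L)). Qed.

Let TS l z : T l.+1 z = (DL.[z] != 0) && T l (fL z).
Proof.
apply/idP/andP => [/TP[D0 z0]|[Dz /TP[D0 z0]]].
  split; first exact: (D0 0%N).
  by apply/TP; split=> [i lti|]; rewrite -iterSr //; apply: D0.
by apply/TP; split=> [[|i] lti //|]; rewrite iterSr //; apply: D0.
Qed.

Let roots_ex l : exists rs : seq L, uniq rs /\ forall z, (z \in rs) = T l z.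
Proof.
apply: poly_root_seq; rewrite map_poly_eq0 -size_poly_eq0.
by have [_ ->] := generic_leadK gen d1 l.
Qed.

Let roots_at l := projT1 (constructive_indefinite_description _ (roots_ex l)).
Let roots_uniq l : uniq (roots_at l).
Proof. by case: (projT2 (constructive_indefinite_description _ (roots_ex l))). Qed.
Let roots_mem l z : (z \in roots_at l) = T l z.
Proof. by case: (projT2 (constructive_indefinite_description _ (roots_ex l))). Qed.

Let size_roots_le l : (size (roots_at l) <= d ^ l)%N.
Proof.
have [_ szA] := generic_leadK gen d1 l.
rewrite -ltnS -szA -(size_map_poly (in_alg L)); apply: max_poly_roots.
- by rewrite map_poly_eq0 -size_poly_eq0 szA.
- by apply/allP => z; rewrite roots_mem.
- exact: roots_uniq.
Qed.

Let size_roots_n : size (roots_at n) = (d ^ n)%N.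
Proof.
have [_ szA] := generic_leadK gen d1 n; have [rs Drs _] := splitL.
have sz_rs : size rs = (d ^ n)%N.
  apply: succn_inj; rewrite -szA -(size_prod_XsubC rs id) -(eqp_size Drs).
  by rewrite size_map_poly.
have urs : uniq rs.
  rewrite -separable_prod_XsubC -(eqp_separable Drs).
  by apply: (separable_split Drs) => z; apply: (generic_separable gen d1).
rewrite -sz_rs; apply/eqP; rewrite -(uniq_size_uniq urs) ?roots_uniq // => z.
by rewrite roots_mem /T (eqp_root Drs) root_prod_XsubC.
Qed.

Let szNL : (size NL <= d.+1)%N. Proof. by have [] := gen_shapeK gen (in_alg L). Qed.
Let szDL : (size DL <= d.+1)%N. Proof. by have [] := gen_shapeK gen (in_alg L). Qed.

Let fiber_poly w := NL - w *: DL.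

(** Otherwise the map would take the value [w] at every regular point; following the orbit of [w]
    down to [0] gives [w = 0], hence [NL = 0], against [NL] having top coefficient [1]. *)
Let fiber_poly0 l w : T l w -> fiber_poly w != 0.
Proof.
move=> Tw; apply/eqP => /eqP; rewrite subr_eq0 => /eqP ND.
have NL0 : NL != 0.
  have [_ c1 _ _] := gen_shapeK gen (in_alg L).
  by apply: contraTneq (oner_neq0 L) => N0; rewrite -c1 -/NL N0 coef0 eqxx.
suff w0 : w = 0 by rewrite ND w0 scale0r eqxx in NL0.
case: l Tw => [|l]; first by rewrite T0 => /eqP.
move/TP=> [D0 w0]; rewrite -w0; have fw z : DL.[z] != 0 -> fL z = w.
  by move=> Dz; rewrite /fL /frac_map ND hornerZ mulfK.
have iw i : (i <= l.+1)%N -> iter i fL w = w.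
  by elim: i => [|i IHi] // lti; rewrite iterS fw // D0.
by rewrite iw.
Qed.

Let children_ex w : exists rs : seq L, fiber_poly w != 0 ->
  uniq rs /\ forall z, (z \in rs) = (DL.[z] != 0) && (fL z == w).
Proof.
have [p0|] := boolP (fiber_poly w != 0); last by exists [::].
have [rs [urs rsP]] := poly_root_seq p0.
exists [seq z <- rs | DL.[z] != 0] => _; split=> [|z]; first exact: filter_uniq.
rewrite mem_filter rsP; apply: andb_id2l => Dz.
rewrite /root /fiber_poly hornerD hornerN hornerZ subr_eq0 /fL /frac_map.
by apply/eqP/eqP => [->|<-]; rewrite ?mulfK // divfK.
Qed.

Let children w := projT1 (constructive_indefinite_description _ (children_ex w)).
Let childrenP l w : T l w ->
  uniq (children w) /\ forall z, (z \in children w) = (DL.[z] != 0) && (fL z == w).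
Proof.
move/fiber_poly0.
exact: (projT2 (constructive_indefinite_description _ (children_ex w))).
Qed.

Let size_children_le l w : T l w -> (size (children w) <= d)%N.
Proof.
move=> Tw; have [uc cP] := childrenP Tw; have p0 := fiber_poly0 Tw.
rewrite -ltnS (leq_trans _ (_ : (size (fiber_poly w) <= d.+1)%N)) //; last first.
  rewrite (leq_trans (size_polyD _ _)) // geq_max szNL size_polyN.
  exact: leq_trans (size_scale_leq _ _) szDL.
apply: max_poly_roots => //; apply/allP => z; rewrite cP => /andP[Dz /eqP <-].
by rewrite /root /fiber_poly /fL /frac_map hornerD hornerN hornerZ divfK ?subrr.
Qed.

Let size_rootsS l : (size (roots_at l.+1) <= \sum_(w <- roots_at l) size (children w))%N.
Proof.
have -> : (\sum_(w <- roots_at l) size (children w))%N =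
    size (flatten [seq children w | w <- roots_at l]).
  by rewrite size_flatten sumnE /shape !big_map.
apply: uniq_leq_size (roots_uniq _) _ => z; rewrite roots_mem TS => /andP[Dz Tz].
apply/flattenP; exists (children (fL z)); first by apply: map_f; rewrite roots_mem.
by have [_ ->] := childrenP Tz; rewrite Dz eqxx.
Qed.

(** Only level [n] is known to split in [L]. A node has at most [d] children, so a full level forces
    the level above it to be full; the induction therefore runs from [n] towards the root. *)
Let size_roots l : (l <= n)%N -> size (roots_at l) = (d ^ l)%N.
Proof.
move=> len; rewrite -(subKn len); elim: (n - l)%N (leq_subr l n) => [|j IHj] lej.
  by rewrite subn0 size_roots_n.
have := IHj (ltnW lej); rewrite -(subnSK lej); set i := (n - j.+1)%N => e.
apply/eqP; rewrite eqn_leq size_roots_le /=.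
have cd : {in roots_at i, forall w, size (children w) <= d}%N.
  by move=> w; rewrite roots_mem; apply: size_children_le.
have := leq_trans (size_rootsS i) (sum_le_const cd).
by rewrite e expnS leq_pmul2l // ltnW.
Qed.

Let size_children l w : (l < n)%N -> T l w -> size (children w) = d.
Proof.
move=> ltn Tw; apply: (sum_ge_const (rs := roots_at l) (F := fun w => size (children w))).
- by move=> u; rewrite roots_mem; apply: size_children_le.
- by rewrite size_roots ?(ltnW ltn) // -expnS -size_roots.
- by rewrite roots_mem.
Qed.

(** The word lists the choices of a child from the root [0]. For words of length at most [n] the
    default of the list access is never reached, all nodes met having [d] children. *)
Definition label (w : seq 'I_d) : L := foldl (fun z i => (children z)`_(val i)) 0 w.

Let label_rcons w i : label (rcons w i) = (children (label w))`_i.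
Proof. exact: foldl_rcons. Qed.

Let label_root w : (size w <= n)%N -> T (size w) (label w).
Proof.
elim/last_ind: w => [|w i IHw]; first by rewrite T0.
rewrite size_rcons => ltn; have Tw := IHw (ltnW ltn).
have [_ cP] := childrenP Tw; have := mem_nth 0 (s := children (label w)) (n := i).
rewrite (size_children ltn Tw) cP -label_rcons ltn_ord => /(_ isT)/andP[Dz /eqP fz].
by rewrite TS Dz fz.
Qed.

Lemma label_parent w i : (size w < n)%N -> fL (label (rcons w i)) = label w.
Proof.
move=> ltn; have Tw := label_root (ltnW ltn).
have [_ cP] := childrenP Tw; have := mem_nth 0 (s := children (label w)) (n := i).
by rewrite (size_children ltn Tw) cP -label_rcons ltn_ord => /(_ isT)/andP[_ /eqP].
Qed.

Lemma label_inj w w' : size w = size w' -> (size w <= n)%N -> label w = label w' -> w = w'.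
Proof.
elim/last_ind: w w' => [|w i IHw] w'; first by case: w'.
case/lastP: w' => [|w' j]; rewrite !size_rcons // => -[sw] ltn e.
have ww' : w = w'.
  by apply: IHw (ltnW ltn) _ => //; rewrite -(label_parent i) // e label_parent -?sw.
rewrite ww'; congr rcons; apply/val_inj/eqP; move/eqP: e; rewrite !label_rcons ww'.
have Tw := label_root (ltnW ltn); rewrite ww' in Tw ltn.
have [uc _] := childrenP Tw.
by rewrite nth_uniq ?(size_children ltn Tw) // uc.
Qed.

Lemma label_surj l z : (l <= n)%N -> T l z -> exists2 w, size w = l & label w = z.
Proof.
elim: l z => [|l IHl] z ltn; first by rewrite T0 => /eqP->; exists [::].
rewrite TS => /andP[Dz Tf]; have [w sw lw] := IHl _ (ltnW ltn) Tf.
have [_ cP] := childrenP Tf.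
have zc : z \in children (fL z) by rewrite cP Dz eqxx.
have lti : (index z (children (fL z)) < d)%N.
  by rewrite -(size_children ltn Tf) index_mem.
exists (rcons w (Ordinal lti)); first by rewrite size_rcons sw.
by rewrite label_rcons lw nth_index.
Qed.

Let G := 'Gal({:L} / 1%VS)%g.

Let gal_map s (p : {poly K}) z : s \in G ->
  s (map_poly (in_alg L) p).[z] = (map_poly (in_alg L) p).[s z].
Proof.
move=> sG; rewrite -horner_map -map_poly_comp; congr _.[_].
by apply: eq_map_poly => c /=; apply: rmorph_alg.
Qed.

Let gal_frac s z : s \in G -> s (fL z) = fL (s z).
Proof. by move=> sG; rewrite /fL /frac_map fmorph_div /= !gal_map. Qed.

Let gal_root s l z : s \in G -> T l z -> T l (s z).
Proof. by move=> sG /eqP e; rewrite /T /root -gal_map // e rmorph0. Qed.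

Let gal_label s w : s \in G -> (size w <= n)%N ->
  exists2 w', size w' = size w & s (label w) = label w'.
Proof.
move=> sG len; have [w' sw' e] := label_surj len (gal_root sG (label_root len)).
by exists w'.
Qed.

Hypothesis transposition : forall l, (0 < l <= n)%N -> forall x : 'I_(d ^ l) -> L,
  injective x ->
  map_poly (in_alg L) (A l) = (lead_coef (A l))%:A *: \prod_i ('X - (x i)%:P) ->
  exists2 s, s \in G & exists j1 j2, [/\ j1 != j2, s (x j1) = x j2, s (x j2) = x j1 &
    forall j, j != j1 -> j != j2 -> s (x j) = x j].

Let roots_fun l : (l <= n)%N -> exists x : 'I_(d ^ l) -> L, [/\ injective x,
  map_poly (in_alg L) (A l) = (lead_coef (A l))%:A *: \prod_i ('X - (x i)%:P) &
  forall z, T l z -> exists i, z = x i].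
Proof.
move=> len; have sz := size_roots len; exists (fun i => (roots_at l)`_i); split.
- by move=> i j /eqP; rewrite nth_uniq ?sz // => /eqP/val_inj.
- have [_ szA] := generic_leadK gen d1 l.
  rewrite {1}(@all_roots_prod_XsubC _ (map_poly (in_alg L) (A l)) (roots_at l)).
  + by rewrite lead_coef_map (big_nth 0) sz big_mkord.
  + by rewrite size_map_poly szA sz.
  + by apply/allP => z; rewrite roots_mem.
  + by rewrite uniq_rootsE.
- move=> z Tz; have zr : z \in roots_at l by rewrite roots_mem.
  have lti : (index z (roots_at l) < d ^ l)%N by rewrite -sz index_mem.
  by exists (Ordinal lti); rewrite /= nth_index.
Qed.

(** The two transposed nodes are siblings: otherwise a further child of the parent of [x j1] would
    be fixed, hence that parent too, and it would also be the parent of [x j2]. Conjugating by an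
    element that carries this pair to the prescribed one gives the swap. *)
Let label_swap w i j : (size w < n)%N -> i != j -> exists2 s, s \in G &
  [/\ s (label (rcons w i)) = label (rcons w j), s (label (rcons w j)) = label (rcons w i) &
   forall v, size v = (size w).+1 -> v != rcons w i -> v != rcons w j ->
     s (label v) = label v].
Proof.
move=> ltn nij; set l := (size w).+1.
have [x [x_inj Dx xP]] := roots_fun ltn.
have [s sG [j1 [j2 [nj12 s1 s2 soth]]]] := transposition (l := l) ltn x_inj Dx.
have Tx c : T l (x c).
  rewrite /T Dx rootZ ?scaler_eq0 ?oner_eq0 ?orbF; last first.
    by rewrite lead_coef_eq0 -size_poly_eq0; have [_ ->] := generic_leadK gen d1 l.
  by rewrite (bigD1 c) //= rootM root_XsubC eqxx.
have Tf c : T (size w) (fL (x c)) by have := Tx c; rewrite TS => /andP[].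
have fx12 : fL (x j1) = fL (x j2).
  apply/eqP; apply: contraT => nf.
  have [uc cP] := childrenP (Tf j1); have sc := size_children ltn (Tf j1).
  have [g gc g1] : exists2 g, g \in children (fL (x j1)) & g != x j1.
    have : (1 < size (children (fL (x j1))))%N by rewrite sc.
    move: uc; case: (children _) => [|a [|b cs]] //=.
    rewrite in_cons negb_or => /andP[/andP[nab _] _] _.
    have [ea|na] := eqVneq a (x j1); last by exists a; rewrite ?mem_head.
    by exists b; [rewrite !in_cons eqxx orbT|rewrite -ea eq_sym].
  move: gc; rewrite cP => /andP[Dg /eqP fg].
  have Tg : T l g by rewrite TS Dg fg Tf.
  have [c Dc] := xP _ Tg.
  have sg : s g = g.
    rewrite Dc soth //; first by apply: contraNneq g1 => <-; rewrite Dc.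
    by apply: contraNneq nf => cj; rewrite -fg Dc cj.
  by move: nf; rewrite -fg -{1}sg -gal_frac // fg gal_frac // s1 eqxx.
have sib1 : siblings d NR DR l (x j1) (x j2).
  by split; rewrite ?(inj_eq x_inj) //; apply: Tx.
have Tl c : T l (label (rcons w c)).
  by have := @label_root (rcons w c); rewrite size_rcons; apply.
have sib2 : siblings d NR DR l (label (rcons w i)) (label (rcons w j)).
  split; try exact: Tl; last by rewrite -/fL !label_parent.
  by apply: contra nij => /eqP/label_inj; rewrite !size_rcons => /(_ erefl ltn)/rcons_inj[->].
have [u uG [u1 u2]] := sibling_transitivity gen d1 generic_galois (isT : (0 < l)%N) Dx sib1 sib2.
have uV z : (u^-1)%g (u z) = z by rewrite -galM ?memvf // mulgV gal_id.
have Vu z : u ((u^-1)%g z) = z by rewrite -galM ?memvf // mulVg gal_id.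
exists (u^-1 * s * u)%g; first by rewrite !groupM ?groupV.
split=> [||v sv nvi nvj]; rewrite !galM ?memvf //.
- by rewrite -u1 uV s1 u2.
- by rewrite -u2 uV s2 u1.
have Tv : T l (label v) by have := @label_root v; rewrite sv; apply.
have VG : (u^-1)%g \in G by rewrite groupV.
have [c Dc] := xP _ (gal_root VG Tv).
have lab_neq b : v != rcons w b -> label v != label (rcons w b).
  by apply: contra => /eqP/label_inj ->; rewrite ?size_rcons ?sv.
rewrite Dc soth -?Dc ?Vu //.
  by apply: contraNneq (lab_neq _ nvi) => cj; rewrite -u1 -cj -Dc Vu.
by apply: contraNneq (lab_neq _ nvj) => cj; rewrite -u2 -cj -Dc Vu.
Qed.

Lemma tree_galois : (G \isog wreath_power d n)%g.
Proof.
apply: (gal_isog_wreath (f := fL) (lam := label)).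
- by move=> s sG z; apply: gal_frac.
- by move=> w i; apply: label_parent.
- exact: label_inj.
- move=> s sG w sw; have [|w' sw' e] := gal_label (w := w) sG; first by rewrite sw.
  by exists w'; rewrite ?sw'.
- exact: label_swap.
move=> s sG fixl; have [rs Drs gen_rs] := splitL.
apply: (gal_eq1_on_generators gen_rs) => z zr.
have Tz : T n z by rewrite /T (eqp_root Drs) root_prod_XsubC.
by have [w sw <-] := label_surj (leqnn n) Tz; apply: fixl.
Qed.

End Tree.

(** * A one-parameter family joining a special map to the generic one *)

Lemma cong2_coef_top (R : comNzRingType) d (N D : {poly {poly R}}) n :
    (0 < d)%N -> cong2 N`_d 1 -> cong2 D`_d 0 ->
  cong2 (iterpoly d N D n).1`_(d ^ n) 1 /\ cong2 (iterpoly d N D n).2`_(d ^ n) 0.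
Proof.
move=> d_gt0 Nd Dd.
have hv10 (P : {poly {poly R}}) : hval d P 1 0 = P`_d.
  rewrite /hval (bigD1 ord_max) //= subnn expr0 expr1n !mulr1 big1 ?addr0 // => i.
  rewrite -val_eqE /= => nid; rewrite expr0n subn_eq0 leqNgt ltn_neqAle nid.
  by rewrite -ltnS ltn_ord mulr0 mulr0.
elim: n => [|n [IH1 IH2]]; first by rewrite /= coefX coef1 expn0.
have [szA szB] := size_iterpoly d N D n.
rewrite iterpolyS expnS !coef_hval_top //.
by split; [apply: cong2_trans Nd|apply: cong2_trans Dd]; rewrite -hv10; apply: cong2_hval.
Qed.

Lemma iterpoly_shift (F : fieldType) d (N D : {poly F}) t n :
    (size N <= d.+1)%N -> (size D <= d.+1)%N ->
  (iterpoly d ((N - t *: D) \Po ('X + t%:P)) (D \Po ('X + t%:P)) n).1 =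
  ((iterpoly d N D n).1 - t *: (iterpoly d N D n).2) \Po ('X + t%:P).
Proof.
move=> szN szD; have cst (P : {poly F}) :
    map_poly (comp_poly ('X + t%:P)) (map_poly polyC P) = map_poly polyC P.
  by rewrite -map_poly_comp; apply: eq_map_poly => c /=; rewrite comp_polyC.
have szC (P : {poly F}) : (size P <= d.+1 -> size (map_poly polyC P) <= d.+1)%N.
  by rewrite size_map_polyC.
have := ipair_shift t%:P n 'X (szC _ szN) (szC _ szD).
have /= := rmorph_ipair (comp_poly ('X + t%:P)) d (map_poly polyC N) (map_poly polyC D) n 'X.
rewrite !cst comp_polyX => ->.
have mc (P : {poly F}) : map_poly polyC (P \Po ('X + t%:P)) =
    map_poly polyC P \Po ('X + t%:P%:P).
  by rewrite map_comp_poly rmorphD /= map_polyX map_polyC.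
have mND : map_poly polyC (N - t *: D) = map_poly polyC N - t%:P%:P * map_poly polyC D.
  by rewrite -mul_polyC rmorphB rmorphM /= map_polyC.
rewrite {1}/iterpoly !mc mND => -> /=.
by rewrite comp_polyB comp_polyZ mul_polyC.
Qed.

Section SpecialFiber.
Variables (k : fieldType) (d m : nat) (sh : bool) (NR DR : {poly {mpoly k[m]}}).
Hypothesis gen : generic_pair d sh NR DR.
Hypothesis d1 : (1 < d)%N.
Let K : fieldType := ratfield k m.
Let N : {poly K} := map_poly (@tofrac {mpoly k[m]}) NR.
Let D : {poly K} := map_poly (@tofrac {mpoly k[m]}) DR.
Let A n : {poly K} := (iterpoly d N D n).1.
Variables (L : splittingFieldType K) (n : nat).
Hypothesis galL : galois 1 {:L}.
Variables (x : 'I_(d ^ n) -> L).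
Hypothesis x_inj : injective x.
Hypothesis Ax : map_poly (in_alg L) (A n) = (lead_coef (A n))%:A *: \prod_i ('X - (x i)%:P).

Variables (F : fieldType) (kF : {rmorphism K -> F}) (N0 D0 : {poly F}) (t0 : F).
Hypothesis szN0 : (size N0 <= d.+1)%N.
Hypothesis N0d : N0`_d = 1.
Hypothesis szD0 : (size D0 <= d)%N.
Hypothesis shD0 : sh -> D0 = 1.
Let An := (iterpoly d N0 D0 n).1.
Let Bn := (iterpoly d N0 D0 n).2.
Variables (y : 'I_(d ^ n) -> F) (i1 i2 : 'I_(d ^ n)).
Hypothesis Qy : An - t0 *: Bn = \prod_i ('X - (y i)%:P).
Hypothesis y1 : y i1 = 0.
Hypothesis y2 : y i2 = 0.
Hypothesis neq_i12 : i1 != i2.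
Hypothesis y_inj : forall i j, i != j -> y i = y j ->
  (i = i1 /\ j = i2) \/ (i = i2 /\ j = i1).
Hypothesis Bn0 : Bn`_0 != 0.

(* The family [f_t(x) = f(x + t) - t] at [t = t0 + eps], moved off the line of
   conjugates of [f] by a term of order [eps^2] so as to be generic. *)
Let t : {poly F} := t0%:P + 'X.
Let C : {poly F} -> {poly {poly F}} := map_poly polyC.
Let Nt : {poly {poly F}} := (C N0 - t%:P * C D0) \Po ('X + t%:P).
Let Dt : {poly {poly F}} := C D0 \Po ('X + t%:P).
(** It agrees with [P] modulo the square of the parameter, so ramification at [0] is unaffected, and
    equals [C Q] at parameter [1]: the generic map is a fibre of the family, and [generic_embedding]
    applies. *)
Let perturb (P : {poly {poly F}}) (Q : {poly F}) : {poly {poly F}} := P + ('X ^+ 2)%:P * (C Q - P).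
Let Ne : {poly {poly F}} := perturb Nt (map_poly kF N).
Let De : {poly {poly F}} := perturb Dt (map_poly kF D).

Let szC (P : {poly F}) l : (size P <= l -> size (C P) <= l)%N.
Proof. by rewrite size_map_polyC. Qed.

Let szD0' : (size D0 <= d.+1)%N. Proof. exact: leqW. Qed.

Let szND : (size (C N0 - t%:P * C D0)%R <= d.+1)%N.
Proof.
rewrite (leq_trans (size_polyD _ _)) // geq_max szC // size_polyN mul_polyC.
by rewrite (leq_trans (size_scale_leq _ _)) // szC.
Qed.

Let D0d : D0`_d = 0. Proof. by rewrite nth_default. Qed.

Let Nt_shape : (size Nt <= d.+1)%N /\ Nt`_d = 1.
Proof.
have [sz c] := comp_poly_shift_top t szND; split=> //.
by rewrite [LHS]c coefB coefCM !coef_map /= N0d D0d polyC0 mulr0 subr0.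
Qed.

Let Dt_shape : (size Dt <= d.+1)%N /\ Dt`_d = 0.
Proof.
have [sz c] := comp_poly_shift_top t (szC szD0'); split=> //.
by rewrite [LHS]c coef_map /= D0d.
Qed.

Let size_perturb (P : {poly {poly F}}) (Q : {poly F}) :
  (size P <= d.+1 -> size Q <= d.+1 -> size (perturb P Q) <= d.+1)%N.
Proof.
move=> szP szQ; rewrite (leq_trans (size_polyD _ _)) // geq_max szP mul_polyC.
rewrite (leq_trans (size_scale_leq _ _)) // (leq_trans (size_polyD _ _)) //.
by rewrite geq_max szC // size_polyN.
Qed.

Let cong_perturb (P : {poly {poly F}}) (Q : {poly F}) i : cong2 (perturb P Q)`_i P`_i.
Proof.
by rewrite coefD coefCM mulrC; split; rewrite coefD coefMXn addr0.
Qed.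

Let perturb1 (P : {poly {poly F}}) (Q : {poly F}) :
  map_poly (horner_eval 1) (perturb P Q) = Q.
Proof.
have e : horner_eval (1 : F) ('X ^+ 2) = 1 by rewrite /horner_eval hornerXn expr1n.
rewrite /perturb rmorphD rmorphM /= map_polyC /= e.
rewrite mul1r rmorphB /= addrC subrK /C -map_poly_comp map_poly_id // => c _ /=.
by rewrite /horner_eval hornerC.
Qed.

Let perturb0 (P : {poly {poly F}}) (Q : {poly F}) :
  map_poly (horner_eval 0) (perturb P Q) = map_poly (horner_eval 0) P.
Proof.
have e : horner_eval (0 : F) ('X ^+ 2) = 0 by rewrite /horner_eval hornerXn expr0n.
by rewrite /perturb rmorphD rmorphM /= map_polyC /= e mul0r addr0.
Qed.

Let P : {poly {poly F}} := (iterpoly d Ne De n).1.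

Let evC (Q : {poly F}) : map_poly (horner_eval 0) (C Q) = Q.
Proof.
rewrite /C -map_poly_comp map_poly_id // => c _ /=; by rewrite /horner_eval hornerC.
Qed.

Let P0 : map_poly (horner_eval 0) P = \prod_i ('X - (y i - t0)%:P).
Proof.
have := map_iterpoly (horner_eval (0 : F)) d Ne De n; rewrite /Ne /De !perturb0.
have t_0 : horner_eval 0 t = t0 by rewrite /horner_eval /t !hornerE.
have Xt_0 : map_poly (horner_eval 0) ('X + t%:P) = 'X + t0%:P.
  by rewrite rmorphD /= map_polyX map_polyC /= t_0.
have -> : map_poly (horner_eval 0) Nt = (N0 - t0 *: D0) \Po ('X + t0%:P).
  by rewrite /Nt map_comp_poly rmorphB rmorphM /= !evC map_polyC /= t_0 mul_polyC Xt_0.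
have -> : map_poly (horner_eval 0) Dt = D0 \Po ('X + t0%:P).
  by rewrite /Dt map_comp_poly evC Xt_0.
move=> e; have := congr1 fst e; rewrite /= => <-.
rewrite iterpoly_shift // -/An -/Bn Qy rmorph_prod; apply: eq_bigr => i _ /=.
by rewrite comp_polyB comp_polyX comp_polyC polyCB opprB addrA addrAC.
Qed.

(** To first order the value at [- t0] is that of [(An - t0 *: Bn) - 'X * Bn]. The first term has a
    double root at [0], so only minus the constant coefficient of [Bn] remains. *)
Let Pc1 : (P.[(- t0)%:P])`_1 != 0.
Proof.
have [e _] := @cong2_ipair _ d Ne De Nt Dt n (- t0)%:P
  (cong_perturb _ _) (cong_perturb _ _).
rewrite horner_iterpoly1; case: e => _ ->.
have := ipair_shift t n (- t0)%:P (szC szN0) (szC szD0').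
have -> : (- t0)%:P + t = 'X by rewrite /t addrA -polyCD addNr add0r.
rewrite -[ipair _ (C N0) _ _ _]/(iterpoly d N0 D0 n).
rewrite -/(An, Bn) (surjective_pairing (iterpoly d N0 D0 n)) -/An -/Bn => -> /=.
have -> : An - t * Bn = (An - t0 *: Bn) - 'X * Bn.
  by rewrite /t mulrDl mul_polyC opprD addrA.
rewrite coefB coefXM /= Qy (big_split2 _ neq_i12) y1 y2 subr0.
by rewrite -mulrA coefXM /= coefXM /= sub0r oppr_eq0.
Qed.

Lemma special_fiber_transposition : exists2 s, s \in 'Gal({:L} / 1%VS)%g &
  exists j1 j2, [/\ j1 != j2, s (x j1) = x j2, s (x j2) = x j1 &
    forall j, j != j1 -> j != j2 -> s (x j) = x j].
Proof.
pose E : fieldType := {fraction {poly F}}.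
pose f0 := [the {rmorphism {poly F} -> E} of @tofrac {poly F}].
pose kap := [the {rmorphism k -> {poly F}} of
  polyC \o (kF \o ((@tofrac {mpoly k[m]}) \o (@mpolyC m k)))].
have [szN1 N1d szD1 shD1] := gen_shapeK gen kF.
have szNe : (size Ne <= d.+1)%N by apply: size_perturb szN1; case: Nt_shape.
have szDe : (size De <= d.+1)%N by apply: size_perturb szD1; case: Dt_shape.
have Ned : Ne`_d = 1.
  rewrite coefD coefCM coefB coef_map; case: Nt_shape => _ ->.
  by rewrite N1d subrr mulr0 addr0.
have shDe : sh -> De = 1.
  move=> s1; rewrite /De /perturb /Dt shD0 // shD1 // /C !rmorph1.
  by rewrite subrr mulr0 addr0.
have good : good_specialization NR DR kap Ne De f0 kF [the {rmorphism _ -> _} of horner_eval (1 : F)].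
  split.
  - by move=> r /eqP; rewrite tofrac_eq0 => /eqP->; rewrite rmorph0.
  - by move=> c /=; rewrite /horner_eval hornerC.
  - exact: perturb1.
  - exact: perturb1.
have sz_map (Q : {poly {poly F}}) : (size Q <= d.+1 -> size (map_poly f0 Q) <= d.+1)%N.
  exact: leq_trans (size_poly _ _).
have f0Ned : (map_poly f0 Ne)`_d = 1 by rewrite coef_map Ned; exact: tofrac1.
have f0De : sh -> map_poly f0 De = 1 by move=> s1; rewrite shDe //; exact: rmorph1.
have [psi [psiN psiD _]] := generic_embedding gen (sz_map _ szNe) f0Ned (sz_map _ szDe) f0De good.
have psiA : map_poly psi (A n) = map_poly f0 P.
  have := map_iterpoly psi d N D n; rewrite psiN psiD map_iterpoly => e.
  by have := congr1 fst e.
have [l0 szA] := generic_leadK gen d1 n.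
have la0 : lead_coef (A n) != 0 by rewrite lead_coefE szA.
have f0_inj r : f0 r = 0 -> r = 0 by move/eqP; rewrite tofrac_eq0 => /eqP.
have f0_closed : forall t, integralOver f0 t -> exists r, t = f0 r.
  exact: polynomials_integrally_closed.
have PN : cong2 P`_(d ^ n) 1.
  have Ned2 : cong2 Ne`_d 1 by rewrite Ned.
  have Dd0 : cong2 De`_d 0.
    by have := cong_perturb Dt (map_poly kF D) d; case: Dt_shape => _ ->.
  by have [] := @cong2_coef_top _ d Ne De n (ltnW d1) Ned2 Dd0.
have szP : (size P <= (d ^ n).+1)%N by have [] := size_iterpoly d Ne De n.
apply: (transposition_descent galL la0 Ax x_inj f0_inj f0_closed psiA PN szP
  (c := - t0) (i1 := i1) (i2 := i2) P0) => //.
- by rewrite y1 sub0r.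
- by rewrite y2 sub0r.
- by move=> i j nij /addIr; apply: y_inj.
Qed.

End SpecialFiber.

(** * Multiplicities of roots along a critical orbit *)

Lemma mup_prod_ord (F : fieldType) M (y : 'I_M -> F) z :
  mup z (\prod_i ('X - (y i)%:P)) = #|[set i | y i == z]|.
Proof.
rewrite -sum1dep_card [RHS]big_mkcond; set q := \prod_i _.
suff [] : q != 0 /\ mup z q = (\sum_i (if y i == z then 1 else 0))%N by [].
apply: (big_rec2 (fun (a : {poly F}) (b : nat) => a != 0 /\ mup z a = b)) => [|i b a _ [a0 <-]].
  by rewrite oner_neq0 mupNroot // root1.
rewrite mulf_neq0 ?polyXsubC_eq0 // mupM ?polyXsubC_eq0 //.
by rewrite -[X in mup z X]expr1 mup_XsubCX.
Qed.

Lemma mup_exact (F : fieldType) (z : F) e (v : {poly F}) :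
  v.[z] != 0 -> mup z (('X - z%:P) ^+ e * v) = e.
Proof. by move=> vz; rewrite mupMl // mup_XsubCX eqxx. Qed.

Lemma double_root_indices (F : fieldType) M (y : 'I_M -> F) (Q : {poly F}) :
    Q = \prod_i ('X - (y i)%:P) -> root Q 0 ->
    (forall z, root Q z -> mup z Q = (z == 0).+1) ->
  exists i1 i2, [/\ y i1 = 0, y i2 = 0, i1 != i2 &
    forall i j, i != j -> y i = y j -> (i = i1 /\ j = i2) \/ (i = i2 /\ j = i1)].
Proof.
move=> -> Q0 mult.
have /cards2P[i1 [i2 [neq12 E0]]] : #|[set i | y i == 0]| == 2.
  by rewrite -mup_prod_ord mult // eqxx.
have y1 : y i1 = 0 by apply/eqP; have := set21 i1 i2; rewrite -E0 inE.
have y2 : y i2 = 0 by apply/eqP; have := set22 i1 i2; rewrite -E0 inE.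
exists i1, i2; split=> // i j nij yij.
have Qi : root (\prod_i ('X - (y i)%:P)) (y i).
  by rewrite (bigD1 i) //= rootM root_XsubC eqxx.
have [yi0|yi0] := eqVneq (y i) 0.
  have : i \in [set i1; i2] by rewrite -E0 inE yi0.
  have : j \in [set i1; i2] by rewrite -E0 inE -yij yi0.
  rewrite !inE => /orP[] /eqP Dj /orP[] /eqP Di; move: nij; rewrite Di Dj ?eqxx //.
    by right.
  by left.
have /cards1P[l El] : #|[set j | y j == y i]| == 1%N.
  by rewrite -mup_prod_ord mult // (negPf yi0).
have : i \in [set l] by rewrite -El inE.
have : j \in [set l] by rewrite -El inE yij.
by rewrite !inE => /eqP Dj /eqP Di; rewrite Di Dj eqxx in nij.
Qed.

Section RootMultiplicity.
Variable F : fieldType.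
Implicit Types (P N D A B M v : {poly F}) (a z : F).

Let hv d P A B := hval d (map_poly polyC P) A B.

Lemma hval_XsubCX d r M a A B : (size M <= d.+1)%N ->
  hv (r + d) (('X - a%:P) ^+ r * M) A B = (A - a *: B) ^+ r * hv d M A B.
Proof.
move=> szM; elim: r => [|r IHr]; first by rewrite !expr0 !mul1r.
have -> : ('X - a%:P) ^+ r.+1 * M = ('X - a%:P) ^+ r * M * 'X + (- a)%:P * (('X - a%:P) ^+ r * M).
  by rewrite exprS polyCN; ring.
have szr : (size (('X - a%:P) ^+ r * M)%R <= (r + d).+1)%N.
  apply: leq_trans (size_polyMleq _ _) _.
  by rewrite size_exp_XsubC addSn /= -addnS leq_add2l.
rewrite /hv rmorphD !rmorphM /= map_polyX map_polyC /= hvalD addSn hvalMX hvalCM.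
have := hvalS A B (P := map_poly polyC (('X - a%:P) ^+ r * M)).
move/(_ (r + d)%N); rewrite size_map_polyC => /(_ szr).
rewrite /hv in IHr; rewrite -rmorphM /= => ->; rewrite IHr -mul_polyC exprS polyCN.
by ring.
Qed.

(** Local degrees multiply under composition: order [e] for the iterate at [z], order [r] for the
    map at [a]. *)
Lemma mult_step d r M N D A B a b z e v :
    (size M <= d.+1)%N -> N - b *: D = ('X - a%:P) ^+ r * M -> M.[a] != 0 ->
    A - a *: B = ('X - z%:P) ^+ e * v -> v.[z] != 0 ->
    A.[z] = a * B.[z] -> B.[z] != 0 ->
  exists2 v', hv (r + d) N A B - b *: hv (r + d) D A B = ('X - z%:P) ^+ (e * r) * v' &
    v'.[z] != 0.
Proof.
move=> szM EM Ma EA vz Az Bz; exists (v ^+ r * hv d M A B).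
  have -> : hv (r + d) N A B - b *: hv (r + d) D A B = hv (r + d) (N - b *: D) A B.
    rewrite /hv -!mul_polyC -mulNr -polyCN -mulNr -polyCN rmorphD rmorphM /=.
    by rewrite map_polyC hvalD hvalCM.
  by rewrite EM hval_XsubCX // EA exprMn exprM mulrA.
rewrite hornerM horner_exp mulf_neq0 ?expf_neq0 //.
have -> : (hv d M A B).[z] = hval d M A.[z] B.[z].
  have := rmorph_hval (horner_eval z) d (map_poly polyC M) A B.
  by rewrite -map_poly_comp map_poly_id // => c _ /=; rewrite /horner_eval hornerC.
rewrite hval_horner // Az mulfK //.
by rewrite mulf_neq0 ?expf_neq0.
Qed.

(** The expression assumed nonzero is the numerator of the derivative of [N / D], so at such a point
    the local degree is [1]. *)
Lemma factor_root d N D a : (size N <= d.+2)%N -> (size D <= d.+2)%N -> D.[a] != 0 ->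
    N^`().[a] * D.[a] - N.[a] * D^`().[a] != 0 ->
  exists M, [/\ (size M <= d.+1)%N, N - frac_map N D a *: D = ('X - a%:P) ^+ 1 * M & M.[a] != 0].
Proof.
move=> szN szD Da W; set b := frac_map N D a.
have /factor_theorem[M EM] : root (N - b *: D) a.
  by rewrite /root !hornerE /b /frac_map divfK ?subrr.
exists M; split.
- have [->|M0] := eqVneq M 0; first by rewrite size_poly0.
  have := size_Mmonic M0 (monicXsubC a); rewrite -EM size_XsubC addn2 /= => szM.
  rewrite -ltnS -szM (leq_trans (size_polyD _ _)) // geq_max szN size_polyN.
  exact: leq_trans (size_scale_leq _ _) szD.
- by rewrite expr1 mulrC.
have := congr1 (fun p => (p^`()).[a]) EM.
rewrite derivB derivZ derivM derivXsubC !hornerE subrr mulr0 add0r => <-.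
apply: contraNneq W => e; rewrite -[N.[a]](divfK Da) -/(frac_map N D a) -/b.
by apply/eqP; transitivity ((N^`().[a] - b * D^`().[a]) * D.[a]); [ring|rewrite e mul0r].
Qed.

End RootMultiplicity.

Section CriticalOrbit.
Variables (F : fieldType) (d : nat) (N D V : {poly F}).
Hypothesis d1 : (1 < d)%N.
Hypothesis szN : (size N <= d.+1)%N.
Hypothesis Nd : N`_d = 1.
Hypothesis szD : (size D <= d)%N.
Hypothesis coprimeND : forall z, N.[z] = 0 -> D.[z] != 0.
Let f := frac_map N D.
Hypothesis ND0 : N - f 0 *: D = 'X^2 * V.
Hypothesis V0 : V.[0] != 0.
Variable l : nat.
Hypothesis l_gt0 : (0 < l)%N.
Let t0 := iter l f 0.
Hypothesis regular0 : forall i, (i < l)%N -> D.[iter i f 0] != 0.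
Hypothesis orbit_crit : forall c i, c != 0 -> N^`().[c] * D.[c] - N.[c] * D^`().[c] = 0 ->
  (0 < i <= l)%N -> iter i f c != t0.
Hypothesis orbit0 : forall i, (0 < i < l)%N -> iter i f 0 != t0.
Let A i : {poly F} := (iterpoly d N D i).1.
Let B i : {poly F} := (iterpoly d N D i).2.
Let Q := A l - t0 *: B l.

Let szD1 : (size D <= d.+1)%N. Proof. exact: leqW. Qed.

(** Infinity is fixed, because the degree of [D] is less than [d], so an orbit that reached it could
    not end at the finite value [t0]. Coprimality keeps the pair of coordinates away from
    [(0, 0)]. *)
Let no_pole z : root Q z -> forall i, (i <= l)%N -> (ipair d N D i z).2 != 0.
Proof.
move=> Qz i leil; apply/negP => /eqP Bz.
have nz j : (ipair d N D j z).1 != 0 \/ (ipair d N D j z).2 != 0.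
  elim: j => [|j IHj]; first by right; rewrite oner_neq0.
  rewrite /ipair !iterS -!/(ipair _ _ _ _ _) /=; case: (ipair d N D j z) IHj => a b /= ab.
  have [b0|b0] := eqVneq b 0.
    left; case: ab => [a0|]; last by rewrite b0 eqxx.
    rewrite /hval (bigD1 ord_max) //= Nd subnn expr0 mulr1 mul1r big1 ?addr0 ?expf_neq0 //.
    move=> j' /=; rewrite -val_eqE /= => nj.
    rewrite b0 expr0n subn_eq0 leqNgt ltn_neqAle nj -ltnS ltn_ord.
    by rewrite !mulr0.
  rewrite !hval_horner // !mulf_eq0 !expf_eq0 (negPf b0) !andbF /=.
  by have [/coprimeND|] := eqVneq N.[a / b] 0; [right|left].
have stay j : (ipair d N D (j + i) z).2 = 0.
  elim: j => [|j IHj] //; rewrite addSn /ipair iterS -/(ipair _ _ _ _ _) /= IHj.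
  rewrite /hval big1 // => j' _; have [->|nj] := eqVneq (j' : nat) d.
    by rewrite nth_default // mul0r.
  rewrite expr0n subn_eq0 leqNgt ltn_neqAle nj -ltnS ltn_ord.
  by rewrite !mulr0.
have Bl : (ipair d N D l z).2 = 0 by rewrite -(subnK leil).
have := Qz; rewrite /root /Q !hornerE horner_iterpoly1 horner_iterpoly2 Bl mulr0 subr0.
by have := nz l; rewrite Bl eqxx => -[/negPf->|].
Qed.

Let root_regular z : root Q z -> forall i, (i < l)%N -> D.[iter i f z] != 0.
Proof. by move=> Qz; exact: (ipair_neq0_frac_map szN szD1 (no_pole Qz)). Qed.

Let root_iter z : root Q z -> forall i, (i <= l)%N ->
  (A i).[z] = iter i f z * (B i).[z] /\ (B i).[z] != 0.
Proof.
move=> Qz i leil; have [|b0 e] := @ipair_frac_map _ d N D szN szD1 i z.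
  by move=> j ltj; apply: root_regular => //; apply: leq_trans leil.
by rewrite horner_iterpoly1 horner_iterpoly2 mulrC.
Qed.

Let root_target z : root Q z -> iter l f z = t0.
Proof.
move=> Qz; have [e b0] := root_iter Qz (leqnn l).
have := Qz; rewrite /root /Q !hornerE e -mulrBl mulf_eq0 (negPf b0) orbF subr_eq0.
by move/eqP.
Qed.

(** Along the orbit of [z] the local degree is [1] except at critical points. A nonzero one is
    excluded by [orbit_crit], and [0] at a later time by [orbit0]; only the start [z = 0]
    contributes a factor [2]. *)
Let root_mult z : root Q z -> mup z Q = (z == 0).+1.
Proof.
move=> Qz; have H i : (i <= l)%N ->
    exists e v, [/\ A i - iter i f z *: B i = ('X - z%:P) ^+ e * v,
      v.[z] != 0 & e = if i == 0%N then 1%N else (z == 0).+1]; last first.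
  have [e [v [Ev vz De]]] := H _ (leqnn l).
  by rewrite /Q -(root_target Qz) Ev mup_exact // De (gtn_eqF l_gt0).
elim: i => [|i IHi] leil.
  exists 1%N, 1; rewrite hornerC oner_neq0; split=> //.
  by rewrite /A /B /= mulr1 alg_polyC.
have [e [v [Ev vz De]]] := IHi (ltnW leil).
have [Az Bz] := root_iter Qz (ltnW leil).
have Dz := root_regular Qz leil.
set a := iter i f z in Ev Az Dz *.
rewrite iterS -/a /A /B !iterpolyS /= -/(A i) -/(B i).
have [W|W] := eqVneq (N^`().[a] * D.[a] - N.[a] * D^`().[a]) 0.
  have [a0|a0] := eqVneq a 0; last first.
    have := orbit_crit (i := l - i) a0 W; rewrite subn_gt0 leil leq_subr.
    rewrite /a -iterD subnK ?(ltnW leil) // root_target // eqxx.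
    by move=> /(_ isT).
  have i0 : i = 0%N.
    apply/eqP; rewrite -leqn0 leqNgt; apply/negP => i_gt0.
    have := @orbit0 (l - i)%N; rewrite subn_gt0 leil ltn_subrL i_gt0 l_gt0 => /(_ isT).
    by rewrite -a0 /a -iterD subnK ?(ltnW leil) // root_target // eqxx.
  have z0 : z = 0 by rewrite -a0 /a i0.
  have szV : (size V <= (d - 2).+1)%N.
    have V_neq0 : V != 0 by apply: contraNneq V0 => ->; rewrite horner0.
    have := size_monicM (monicXn _ 2) V_neq0; rewrite -ND0 size_polyXn => szV.
    have : (size (N - f 0 *: D)%R <= d.+1)%N.
      rewrite (leq_trans (size_polyD _ _)) // geq_max szN size_polyN.
      exact: leq_trans (size_scale_leq _ _) szD1.
    by rewrite szV; lia.
  have EN : N - f a *: D = ('X - a%:P) ^+ 2 * V by rewrite a0 subr0.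
  have Va : V.[a] != 0 by rewrite a0.
  have [v' Ev' v'z] := mult_step szV EN Va Ev vz Az Bz.
  exists (e * 2)%N, v'; split; [by rewrite -Ev' subnKC|by []|].
  by rewrite De [in LHS]i0 z0 !eqxx.
have szN' : (size N <= d.-1.+2)%N by rewrite prednK // ltnW.
have szD' : (size D <= d.-1.+2)%N by rewrite prednK // ltnW.
have [M [szM EM Ma]] := factor_root szN' szD' Dz W.
have [v' Ev' v'z] := mult_step szM EM Ma Ev vz Az Bz.
exists (e * 1)%N, v'; rewrite -Ev' add1n prednK 1?ltnW //; split=> //.
rewrite muln1 De; case: eqP => // i0.
(* [a] is not critical here, whereas [0] is, by [ND0]. *)
suff /negPf-> : z != 0 by [].
apply: contraNneq W => z0; rewrite /a i0 z0 /=.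
have D0 : D.[0] != 0 by rewrite (regular0 l_gt0).
have : (N - f 0 *: D)^`().[0] = 0.
  by rewrite ND0 derivM derivXn !hornerE expr0n /= !(mul0rn, mul0r, mulr0, addr0).
rewrite derivB derivZ !hornerE => e0; apply/eqP.
transitivity (D.[0] * (N^`().[0] - f 0 * D^`().[0])); last by rewrite e0 mulr0.
rewrite -{1}[N.[0]](divfK D0) -/(frac_map N D 0) -/f.
by ring.
Qed.

Lemma critical_orbit_roots M (y : 'I_M -> F) : Q = \prod_i ('X - (y i)%:P) ->
  (exists i1 i2, [/\ y i1 = 0, y i2 = 0, i1 != i2 &
    forall i j, i != j -> y i = y j -> (i = i1 /\ j = i2) \/ (i = i2 /\ j = i1)]) /\
  (B l)`_0 != 0.
Proof.
have [b0 e] := ipair_frac_map szN szD1 regular0.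
move=> Qy; split; last by rewrite -horner_coef0 horner_iterpoly2.
apply: (double_root_indices Qy); last by move=> z /root_mult.
by rewrite /root /Q !hornerE horner_iterpoly1 horner_iterpoly2 e mulrC subrr.
Qed.

End CriticalOrbit.

(** * Special maps with a prescribed critical orbit *)

(** [sp_coprime] and [sp_crit] range over all extensions: the other critical points, and the roots
    of the equation to be studied, need not lie in [F]. *)
Record special_map (F : fieldType) (d : nat) (sh : bool) (N D : {poly F}) (l : nat) : Prop :=
  SpecialMap {
  sp_szN : (size N <= d.+1)%N;
  sp_Nd : N`_d = 1;
  sp_szD : (size D <= d)%N;
  sp_sh : sh -> D = 1;
  sp_double : exists2 V, N - frac_map N D 0 *: D = 'X^2 * V & V.[0] != 0;
  sp_regular0 : forall i, (i < l)%N -> D.[iter i (frac_map N D) 0] != 0;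
  sp_orbit0 : forall i, (0 < i < l)%N -> iter i (frac_map N D) 0 != iter l (frac_map N D) 0;
  sp_coprime : forall (E : fieldType) (j : {rmorphism F -> E}) z,
    (map_poly j N).[z] = 0 -> (map_poly j D).[z] != 0;
  sp_crit : forall (E : fieldType) (j : {rmorphism F -> E}) c i,
    let N' := map_poly j N in let D' := map_poly j D in
    c != 0 -> N'^`().[c] * D'.[c] - N'.[c] * D'^`().[c] = 0 -> (0 < i <= l)%N ->
    iter i (frac_map N' D') c != j (iter l (frac_map N D) 0)
}.

Lemma map_frac_map (F E : fieldType) (j : {rmorphism F -> E}) N D i z :
  iter i (frac_map (map_poly j N) (map_poly j D)) (j z) = j (iter i (frac_map N D) z).
Proof. by elim: i => [|i IHi] //; rewrite !iterS IHi /frac_map !horner_map fmorph_div. Qed.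

Section SpecialTransposition.
Variables (k : fieldType) (d m : nat) (sh : bool) (NR DR : {poly {mpoly k[m]}}).
Hypothesis gen : generic_pair d sh NR DR.
Hypothesis d1 : (1 < d)%N.
Let K : fieldType := ratfield k m.
Let N : {poly K} := map_poly (@tofrac {mpoly k[m]}) NR.
Let D : {poly K} := map_poly (@tofrac {mpoly k[m]}) DR.
Let A n : {poly K} := (iterpoly d N D n).1.
Variables (L : splittingFieldType K) (l : nat).
Hypothesis galL : galois 1 {:L}.
Hypothesis l_gt0 : (0 < l)%N.
Variables (x : 'I_(d ^ l) -> L).
Hypothesis x_inj : injective x.
Hypothesis Ax : map_poly (in_alg L) (A l) = (lead_coef (A l))%:A *: \prod_i ('X - (x i)%:P).
Variables (F : fieldType) (kF : {rmorphism K -> F}) (N0 D0 : {poly F}).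
Hypothesis special : special_map d sh N0 D0 l.

Lemma special_transposition : exists2 s, s \in 'Gal({:L} / 1%VS)%g &
  exists j1 j2, [/\ j1 != j2, s (x j1) = x j2, s (x j2) = x j1 &
    forall j, j != j1 -> j != j2 -> s (x j) = x j].
Proof.
have [szN0 N0d szD0 shD0 [V ND0 V0] reg0 orb0 cop crit] := special.
set t0 := iter l (frac_map N0 D0) 0 in orb0 crit.
pose Q := (iterpoly d N0 D0 l).1 - t0 *: (iterpoly d N0 D0 l).2.
have [lA lB] : (iterpoly d N0 D0 l).1`_(d ^ l) = 1 /\ (iterpoly d N0 D0 l).2`_(d ^ l) = 0.
  by apply: coef_iterpoly_top; rewrite ?(ltnW d1) // nth_default.
have Qd : Q`_(d ^ l) = 1 by rewrite coefB coefZ lA lB mulr0 subr0.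
have szQ : size Q = (d ^ l).+1.
  have [szA szB] := size_iterpoly d N0 D0 l.
  apply/eqP; rewrite eqn_leq (leq_trans (size_polyD _ _)) /=; last first.
    by rewrite geq_max szA size_polyN (leq_trans (size_scale_leq _ _)).
  by rewrite ltnNge; apply: contra (oner_neq0 F) => le; rewrite -Qd nth_default.
have [E [y [j Qy]]] : exists (E : fieldType) (y : 'I_(d ^ l) -> E) (j : {rmorphism F -> E}),
    map_poly j Q = \prod_i ('X - (y i)%:P).
  have [E [y Qy]] := splitting_roots szQ; exists E, y, [the {rmorphism F -> E} of in_alg E].
  by rewrite Qy lead_coefE szQ /= Qd scale1r scale1r.
have jA : iterpoly d (map_poly j N0) (map_poly j D0) l =
  (map_poly j (iterpoly d N0 D0 l).1, map_poly j (iterpoly d N0 D0 l).2) by exact: map_iterpoly.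
have jt : iter l (frac_map (map_poly j N0) (map_poly j D0)) 0 = j t0.
  by rewrite -map_frac_map rmorph0.
have szj (P : {poly F}) n : (size P <= n -> size (map_poly j P) <= n)%N.
  by rewrite size_map_poly.
have QyE : (iterpoly d (map_poly j N0) (map_poly j D0) l).1 -
    j t0 *: (iterpoly d (map_poly j N0) (map_poly j D0) l).2 = \prod_i ('X - (y i)%:P).
  by rewrite -Qy jA /= -map_polyZ -rmorphB.
have jd : (map_poly j N0)`_d = 1 by rewrite coef_map N0d; exact: rmorph1.
have jND : map_poly j N0 - frac_map (map_poly j N0) (map_poly j D0) 0 *: map_poly j D0 =
    'X^2 * map_poly j V.
  have -> : frac_map (map_poly j N0) (map_poly j D0) 0 = j (frac_map N0 D0 0).
    by rewrite -(map_frac_map j N0 D0 1) rmorph0.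
  by rewrite -map_polyZ -rmorphB ND0 rmorphM /= map_polyXn.
have jV : (map_poly j V).[0] != 0 by rewrite -[X in _.[X]](rmorph0 j) horner_map fmorph_eq0.
have [||||[i1 [i2 [y1 y2 n12 y_inj]]] B0] :=
  @critical_orbit_roots E d (map_poly j N0) (map_poly j D0) (map_poly j V) d1
    (szj _ _ szN0) jd (szj _ _ szD0) (cop _ j) jND jV l l_gt0 _ _ _ (d ^ l)%N y.
- by move=> i lti; rewrite -[X in iter _ _ X](rmorph0 j) map_frac_map horner_map fmorph_eq0 reg0.
- by move=> c i c0 W lei; rewrite jt; apply: crit.
- by move=> i lti; rewrite jt -(rmorph0 j) map_frac_map (inj_eq (fmorph_inj _)) orb0.
- by rewrite jt.
apply: (special_fiber_transposition gen d1 galL x_inj Ax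
  [the {rmorphism K -> E} of j \o kF] (szj _ _ szN0) jd (szj _ _ szD0) _ QyE
  y1 y2 n12 y_inj B0).
by move=> s; rewrite shD0 // rmorph1.
Qed.

End SpecialTransposition.

(** For [d = 2], [h = 1]. For larger [d], [h] is [x^(d-2) + e x + 1] with [e = 1] exactly when
    [d - 2] is zero in [K], and [n.+1] is [d - 2]. Its derivative has no zero other than [0], so [h]
    has simple roots and a nonzero critical point of [x^2 h] is not a root. *)
Lemma double_critical_poly (K : fieldType) d : (1 < d)%N -> ~ (d = 2%N /\ 2%:R = 0 :> K) ->
  exists h : {poly K}, let g := 'X^2 * h in
    [/\ size g = d.+1, g`_d = 1, h.[0] != 0, g^`() != 0 &
     forall (E : fieldType) (j : {rmorphism K -> E}) c, c != 0 ->
       (map_poly j g)^`().[c] = 0 -> (2 < d)%N /\ (map_poly j g).[c] != 0].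
Proof.
case: d => [|[|[|n]]] // _ not22.
  exists 1; cbv zeta; rewrite mulr1 size_polyXn coefXn hornerC oner_neq0 derivXn expr1.
  have two0 : 2%:R != 0 :> K by apply/eqP => two0; apply: not22.
  split=> //; first by rewrite -scaler_nat scaler_eq0 negb_or two0 polyX_eq0.
  move=> E j c c0; rewrite map_polyXn derivXn hornerMn hornerXn expr1 => /eqP.
  by rewrite -mulr_natl mulf_eq0 (negPf c0) orbF -(rmorph_nat j) fmorph_eq0 (negPf two0).
pose e : K := ((n.+1%:R : K) == 0)%:R.
pose h : {poly K} := 'X^(n.+1) + (e *: 'X + 1).
have sz_h : size h = n.+2.
  rewrite size_polyDl ?size_polyXn // (leq_ltn_trans (size_polyD _ _)) // gtn_max size_poly1 andbT.
  rewrite /e; case: eqP => [n0|_]; last by rewrite scale0r size_poly0.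
  rewrite scale1r size_polyX; case: n n0 {e h not22} => // /eqP.
  by rewrite oner_eq0.
have lead_h : h`_n.+1 = 1.
  rewrite !coefD coefXn eqxx coefZ coefX coef1 /= addr0 eqSS /e.
  case: eqVneq => [n0|_]; last by rewrite mul0r addr0.
  by case: (n) n0 => [/eqP|n' _]; rewrite ?oner_eq0 // mulr0 addr0.
have h'E (E : fieldType) (j : {rmorphism K -> E}) :
    (map_poly j h)^`() = (n.+1%:R : E)%:P * 'X^n + (j e)%:P.
  rewrite deriv_map /h !derivD derivXn derivZ derivX derivC addr0 alg_polyC.
  by rewrite rmorphD rmorphMn /= map_polyXn map_polyC /= -mulr_natl polyC_natr.
have n_or_e (E : fieldType) (j : {rmorphism K -> E}) :
    ((n.+1%:R : E) != 0) && (j e == 0) || ((n.+1%:R : E) == 0) && (j e == 1).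
  rewrite -(rmorph_nat j) fmorph_eq0 /e; case: eqP => _ /=.
    by rewrite rmorph1 eqxx.
  by rewrite rmorph0 eqxx.
have g'E (E : fieldType) (j : {rmorphism K -> E}) c :
    (map_poly j ('X^2 * h))^`().[c] = c * (2%:R * (map_poly j h).[c] + c * (map_poly j h)^`().[c]).
  rewrite rmorphM /= map_polyXn derivM derivXn !hornerE.
  by ring.
have h0 : h.[0] != 0 by rewrite !hornerE expr0n /= ?mulr0 ?add0r oner_neq0.
exists h; cbv zeta; split=> //.
- by rewrite size_monicM ?monicXn ?size_polyXn ?sz_h // -size_poly_eq0 sz_h.
- by rewrite mulrC coefMXn /= !subSS subn0.
- pose q := 2%:R * h + 'X * h^`().
  have gq : ('X^2 * h)^`() = 'X * q by rewrite derivM derivXn /q; ring.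
  rewrite gq mulf_neq0 ?polyX_eq0 //; apply/eqP => q0.
  have two0 : 2%:R = 0 :> K.
    apply/eqP; have := congr1 (horner^~ 0) q0.
    rewrite /q -polyC_natr hornerD !hornerM hornerC hornerX mul0r addr0 horner0 => /eqP.
    by rewrite mulf_eq0 (negPf h0) orbF.
  have /eqP : 'X * h^`() = 0 by rewrite -q0 /q -polyC_natr two0 mul0r add0r.
  rewrite mulf_eq0 polyX_eq0 /= => /eqP h'0.
  have := h'E _ [the {rmorphism K -> K} of idfun]; rewrite map_poly_id // h'0.
  move/(congr1 (horner^~ 1)); rewrite !hornerE expr1n mulr1 => /eqP.
  have := n_or_e _ [the {rmorphism K -> K} of idfun].
  by rewrite /= => /orP[] /andP[n0 /eqP->]; rewrite ?addr0 ?(eqP n0) ?add0r eq_sym ?(negPf n0) ?oner_eq0.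
move=> E j c c0 /eqP; rewrite g'E mulf_eq0 (negPf c0) /= => /eqP gc; split=> //.
rewrite rmorphM hornerM /= map_polyXn hornerXn mulf_neq0 ?expf_neq0 //.
apply/eqP => hc; move: gc; rewrite hc mulr0 add0r h'E => /eqP.
rewrite mulf_eq0 (negPf c0) /= !hornerE.
have := n_or_e _ j => /orP[] /andP[n0 /eqP->].
  by rewrite addr0 mulf_eq0 (negPf n0) expf_eq0 (negPf c0) andbF.
by rewrite (eqP n0) mul0r add0r oner_eq0.
Qed.

Section PolynomialSpecialMap.
Variables (K : fieldType) (d : nat) (h : {poly K}).
Hypothesis d1 : (1 < d)%N.
Let g : {poly K} := 'X^2 * h.
Hypothesis szg : size g = d.+1.
Hypothesis gd : g`_d = 1.
Hypothesis h0 : h.[0] != 0.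
Hypothesis crit_rational : forall (E : fieldType) (j : {rmorphism K -> E}) u,
  (map_poly j g)^`().[u] = 0 -> exists c, u = j c.
Hypothesis crit_nonzero : forall c, c != 0 -> g^`().[c] = 0 -> (2 < d)%N /\ g.[c] != 0.

(* The conjugate of [mu^(d-1) g(x) + mu] by the scaling [x -> mu x]. *)
Let G : {poly {poly K}} := \poly_(i < d.+1) (g`_i *: 'X^(d - i)).
Let N0 : {poly {poly K}} := G + ('X^2)%:P.
(** The map before scaling: [N0] sends ['X * u] to ['X * T u]. The factor ['X^(d.-1)] separates the
    orbits. With it, the size of [iter i.+1 T] is [2 * d ^ i] at [0] and [d ^ i.+1] at a constant
    [c] with [g.[c] != 0], when [d > 2]; without it both would have degree [d ^ i]. *)
Let T (u : {poly K}) := 'X^(d.-1) * (g \Po u) + 'X.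

Let g00 : g.[0] = 0. Proof. by rewrite hornerM hornerXn expr0n mul0r. Qed.

Let G_scale : G \Po (('X : {poly K})%:P * 'X) = ('X^d : {poly K})%:P * map_poly polyC g.
Proof.
have szg' : (size (map_poly polyC g) <= d.+1)%N by rewrite size_map_polyC szg.
have szG : (size G <= d.+1)%N by exact: size_poly.
rewrite (poly_widen szg') (poly_widen szG) rmorph_sum mulr_sumr; apply: eq_bigr => i _.
rewrite rmorphM rmorphXn /= comp_polyC comp_polyX exprMn coef_poly ltn_ord coef_map /=.
have -> : ('X^d : {poly K}) = 'X^(d - i) * 'X^i by rewrite -exprD subnK // -ltnS.
rewrite -mul_polyC !polyCM !polyC_exp.
by ring.
Qed.

Let N0_scale u : N0.['X * u] = 'X * T u.
Proof.
have -> : N0.['X * u] = (G \Po (('X : {poly K})%:P * 'X)).[u] + 'X^2.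
  by rewrite hornerD hornerC horner_comp hornerM hornerC hornerX.
rewrite G_scale hornerM hornerC -[(map_poly polyC g).[u]]/(g \Po u) /T.
by rewrite mulrDr mulrA -exprS prednK ?expr2 // ltnW.
Qed.

Let size_T (u : {poly K}) : (1 < size u)%N -> size (T u) = (d * size u)%N.
Proof.
move=> szu; have szc : size (g \Po u) = (d * (size u).-1).+1.
  have := size_comp_poly g u; rewrite szg /= => e.
  by rewrite -e prednK // lt0n; apply: contraTneq szu => s0; move: e;
    rewrite s0 -leqNgt; case: (size u) => [|[|s]] //=; nia.
have sz : size ('X^(d.-1) * (g \Po u)) = (d * size u)%N.
  rewrite size_monicM ?monicXn // -?size_poly_eq0 szc // size_polyXn.
  by move: szu; case: (size u) => // s _; rewrite mulnS; lia.
by rewrite /T size_polyDl // sz size_polyX; nia.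
Qed.

Let T0 : T 0 = 'X.
Proof. by rewrite /T comp_poly0r -horner_coef0 g00 polyC0 mulr0 add0r. Qed.

Let size_T0 i : size (iter i.+1 T 0) = (2 * d ^ i)%N.
Proof.
elim: i => [|i IHi]; first by rewrite /= T0 size_polyX.
by rewrite iterS size_T IHi ?expnS 1?mulnCA //; have := expn_gt0 d i; lia.
Qed.

Let size_Tc c i : (2 < d)%N -> g.[c] != 0 -> size (iter i.+1 T c%:P) = (d ^ i.+1)%N.
Proof.
move=> d2 gc; elim: i => [|i IHi].
  have sz : size ('X^(d.-1) * (g \Po c%:P)) = d.
    rewrite comp_polyCr mulrC mul_polyC size_scale // size_polyXn prednK // ltnW //.
  by rewrite /= /T size_polyDl sz ?size_polyX ?expn1.
rewrite iterS size_T IHi -?expnS //.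
by rewrite (leq_trans d1) // -{1}[d]expn1 leq_pexp2l // ltnW.
Qed.

Let iter_N0 (E : fieldType) (j : {rmorphism {poly K} -> E}) i u :
  iter i (frac_map (map_poly j N0) 1) (j ('X * u)) = j ('X * iter i T u).
Proof.
elim: i => [|i IHi] //; rewrite !iterS IHi /frac_map hornerC divr1 horner_map /=.
by rewrite N0_scale.
Qed.

Lemma polynomial_special_map sh l : (0 < l)%N ->
  special_map d sh (map_poly (@tofrac {poly K}) N0) 1 l.
Proof.
move=> l_gt0; pose F := {fraction {poly K}}.
pose t := [the {rmorphism {poly K} -> F} of @tofrac {poly K}].
have neq (E : fieldType) (j : {rmorphism {poly K} -> E}) (u v : {poly K}) :
    (forall r, j r = 0 -> r = 0) -> size u != size v -> j ('X * u) != j ('X * v).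
  move=> j0; apply: contraNneq => e; have : 'X * u = 'X * v.
    by apply/eqP; rewrite -subr_eq0; apply/eqP/j0; rewrite rmorphB e subrr.
  by move/(mulfI (negbT (polyX_eq0 _)))->.
have t_inj r : t r = 0 -> r = 0 by move/eqP; rewrite tofrac_eq0 => /eqP.
have it0 (E : fieldType) (j : {rmorphism {poly K} -> E}) i :
    iter i (frac_map (map_poly j N0) 1) 0 = j ('X * iter i T 0).
  by rewrite -iter_N0 mulr0 rmorph0.
have szG : (size G <= d.+1)%N by exact: size_poly.
split=> //.
- apply: leq_trans (size_poly _ _) _; apply: leq_trans (size_polyD _ _) _.
  by rewrite geq_max szG (leq_trans (size_polyC_leq1 _)).
- rewrite coef_map coefD coefC coef_poly ltnSn subnn gd expr0 scale1r.
  by rewrite (gtn_eqF (ltnW d1)) addr0; exact: tofrac1.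
- by rewrite size_poly1 ltnW.
- pose V : {poly {poly K}} := \poly_(i < d.-1) (h`_i *: 'X^(d - 2 - i)).
  exists (map_poly t V).
    have -> : frac_map (map_poly t N0) 1 0 = t ('X * 'X).
      by have := it0 F t 1%N; rewrite -[iter 1 T 0]/(T 0) T0.
    have -> : map_poly t N0 - t ('X * 'X) *: 1 = map_poly t G.
      by rewrite rmorphD /= map_polyC alg_polyC expr2 addrK.
    have -> : G = 'X^2 * V.
      apply/polyP => i; rewrite coefXnM !coef_poly /g coefXnM.
      case: i => [|[|i]] /=; rewrite ?scale0r ?if_same // !subSS subn0 ltn_predRL.
      by rewrite -subnDA add2n.
    by rewrite rmorphM /= map_polyXn.
  rewrite -[X in _.[X]](rmorph0 t) horner_map horner_coef0 coef_poly -subn1 subn_gt0 d1.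
  rewrite -horner_coef0; apply: contra h0 => /eqP/t_inj/eqP.
  by rewrite scaler_eq0 -size_poly_eq0 size_polyXn orbF.
- by move=> i _; rewrite hornerC oner_neq0.
- move=> [|i] // lti; rewrite !it0; apply: (neq _ t) => //; case: (l) lti => // l'; rewrite ltnS => lti.
  by rewrite !size_T0 eqn_pmul2l // eqn_exp2l // ltn_eqF.
- by move=> E j z _; rewrite rmorph1 hornerC oner_neq0.
move=> E j c i N' D' c0.
pose jt := [the {rmorphism {poly K} -> E} of j \o t].
pose jc := [the {rmorphism K -> E} of jt \o polyC].
have jt_inj r : jt r = 0 -> r = 0 by move/eqP; rewrite /= fmorph_eq0 => /eqP/t_inj.
have m0 : jt 'X != 0 by apply/eqP => /jt_inj/eqP; rewrite polyX_eq0.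
have N'E : N' = map_poly jt N0 by rewrite /N' -map_poly_comp.
have D'E : D' = 1 by rewrite /D' rmorph1.
rewrite D'E N'E hornerC derivC horner0 mulr1 mulr0 subr0.
have -> : (map_poly jt N0)^`() = (map_poly jt G)^`().
  by rewrite rmorphD /= derivD map_polyC derivC addr0.
rewrite -[c](mulfVK m0) [_ * jt _]mulrC; set u := c / jt 'X => Gu.
have Dg : map_poly jt G \Po ((jt 'X)%:P * 'X) = (jt 'X^d)%:P * map_poly jc g.
  have := congr1 (map_poly jt) G_scale.
  rewrite map_comp_poly rmorphM /= map_polyC map_polyX => ->.
  by rewrite rmorphM /= map_polyC -map_poly_comp.
have gu : (map_poly jc g)^`().[u] = 0.
  have := congr1 (fun p => (p^`()).[u]) Dg.
  rewrite deriv_comp !derivM !derivC derivX !mul0r !add0r mulr1.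
  rewrite !hornerM !hornerC horner_comp hornerM hornerC hornerX Gu mul0r => /esym/eqP.
  rewrite mulf_eq0 rmorphXn expf_eq0 (negPf m0) andbF /= => /eqP //.
have [c1 Du] := crit_rational gu.
have c10 : c1 != 0.
  by apply: contraNneq c0 => c10; rewrite -[c](mulfVK m0) -/u Du c10 rmorph0 mul0r.
have [d2 gc1] : (2 < d)%N /\ g.[c1] != 0.
  apply: crit_nonzero => //; apply/eqP; rewrite -(fmorph_eq0 jc) -horner_map -deriv_map -Du.
  by apply/eqP.
rewrite Du -[jc c1]/(jt c1%:P) -rmorphM iter_N0 (it0 _ t) -[j (t _)]/(jt _) => /andP[i_gt0 leil].
apply: (neq _ jt) => //.
case: (i) i_gt0 leil => // i' _; case: (l) => // l'; rewrite ltnS => leil.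
(* The sizes compared are [d ^ i'.+1] and [2 * d ^ l'] with [i' <= l']. They differ because [d > 2]
   when [i' = l'], and because of the factor [2] otherwise. *)
rewrite size_Tc // size_T0; move: leil; rewrite leq_eqVlt => /orP[/eqP->|lti].
  by rewrite expnS eqn_pmul2r ?expn_gt0 ?(ltnW d1) // gtn_eqF.
rewrite neq_ltn (leq_ltn_trans (leq_pexp2l (ltnW d1) lti)) //.
by rewrite mul2n -addnn -[X in (X < _)%N]addn0 ltn_add2l expn_gt0 ltnW.
Qed.

End PolynomialSpecialMap.

(** Over the field [L] that splits [g'], the critical points are constants with respect to the
    parameter, so their orbits can be compared by degree. *)
Lemma polynomial_special (K : fieldType) d sh l : (1 < d)%N -> (0 < l)%N ->
    ~ (d = 2%N /\ 2%:R = 0 :> K) ->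
  exists (F : fieldType) (kF : {rmorphism K -> F}) (N D : {poly F}), special_map d sh N D l.
Proof.
move=> d1 l_gt0 /(double_critical_poly d1)[h]; set g := 'X^2 * h => -[szg gd h0 g'0 crit].
have [L [rs Drs]] := splits_in_extension g'0.
pose i := [the {rmorphism K -> L} of in_alg L].
have Drs' : map_poly i g^`() %= \prod_(z <- rs) ('X - z%:P) by [].
have ig : map_poly i g = 'X^2 * map_poly i h by rewrite rmorphM /= map_polyXn.
have i0 : (map_poly i h).[0] != 0 by rewrite -[X in _.[X]](rmorph0 i) horner_map fmorph_eq0.
move: i ig i0 Drs' => i ig i0 Drs'.
pose t := [the {rmorphism {poly L} -> {fraction {poly L}}} of @tofrac {poly L}].
exists {fraction {poly L}}, [the {rmorphism K -> {fraction {poly L}}} of t \o (polyC \o i)].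
eexists; exists 1; apply: (polynomial_special_map (h := map_poly i h)) => //.
- by rewrite -ig size_map_poly.
- by rewrite -ig coef_map gd; exact: rmorph1.
- move=> E j u; rewrite -ig deriv_map => /eqP; rewrite -/(root _ _).
  rewrite deriv_map; have : map_poly j (map_poly i g^`()) %= map_poly j (\prod_(z <- rs) ('X - z%:P)).
    by rewrite eqp_map.
  move/eqp_root->; rewrite rmorph_prod /=.
  under eq_bigr do rewrite rmorphB /= map_polyX map_polyC /=.
  rewrite -(big_map j predT (fun z => 'X - z%:P)) root_prod_XsubC => /mapP[c _ ->].
  by exists c.
move=> c c0; rewrite -ig => e; exact: crit e.
Qed.

Section QuadraticSpecialMap.
Variables (K : fieldType) (R : idomainType) (a nu : R) (e : {rmorphism R -> {poly K}}).
Hypothesis two0 : 2%:R = 0 :> R.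
Hypothesis nu_neq0 : nu != 0.
Hypothesis e_nu : e nu = 0.
Hypothesis e_a : e a = 'X.

(* In characteristic 2 a separable quadratic polynomial has no finite critical point.
   The only finite one of [(x^2 + a nu x + a) / (nu x + 1)] is [0], and [nu = 0] gives [x^2 + a]. *)
Let N0 : {poly R} := 'X^2 + (a * nu)%:P * 'X + a%:P.
Let D0 : {poly R} := nu%:P * 'X + 1.

Let u i : {poly K} := iter i (fun q => 'X^2 \Po q + 'X) 0.

Let ipair_nu0 i : e (ipair 2 N0 D0 i 0).1 = u i /\ e (ipair 2 N0 D0 i 0).2 = 1.
Proof.
have eN : map_poly e N0 = map_poly polyC 'X^2 + ('X : {poly K})%:P.
  rewrite /N0 !rmorphD rmorphM /= !map_polyXn !map_polyC map_polyX /=.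
  by rewrite rmorphM /= e_nu e_a mulr0 mul0r addr0.
have eD : map_poly e D0 = 1.
  rewrite /D0 rmorphD rmorphM rmorph1 /= map_polyX map_polyC /=.
  by rewrite e_nu mul0r add0r.
have := rmorph_ipair e 2 N0 D0 i 0; rewrite eN eD rmorph0.
have szN : (size (map_poly polyC 'X^2 + ('X : {poly K})%:P)%R <= 3)%N.
  rewrite (leq_trans (size_polyD _ _)) // geq_max size_map_polyC size_polyXn.
  by rewrite (leq_trans (size_polyC_leq1 _)).
rewrite -horner_iterpoly iterpoly_comp //= hornerC horner_iter_comp => -[<- <-].
by split=> //; apply: eq_iter => q; rewrite hornerD hornerC.
Qed.

(** [N0 - a D0] is exactly [x^2], and in characteristic 2 the numerator of the derivative is
    [nu x^2]. Setting [nu = 0] makes all denominators [1] and the orbit of [0] that of [x^2 + a],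
    whose points have distinct degrees in [a]; hence the orbit of [0] meets no pole and does not
    reach its [l]-th point earlier. *)
Lemma quadratic_special_map (F : fieldType) (t : {rmorphism R -> F}) l :
    (forall r, t r = 0 -> r = 0) -> (0 < l)%N ->
  special_map 2 false (map_poly t N0) (map_poly t D0) l.
Proof.
move=> t_inj l_gt0.
have szN : (size (map_poly t N0) <= 3)%N.
  apply: leq_trans (size_poly _ _) _; apply: leq_trans (size_polyD _ _) _.
  rewrite geq_max (leq_trans (size_polyC_leq1 _)) // andbT.
  apply: leq_trans (size_polyD _ _) _; rewrite geq_max size_polyXn mul_polyC.
  by rewrite (leq_trans (size_scale_leq _ _)) // size_polyX.
have szD : (size (map_poly t D0) <= 2)%N.
  apply: leq_trans (size_poly _ _) _; apply: leq_trans (size_polyD _ _) _.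
  rewrite geq_max size_poly1 andbT mul_polyC.
  by rewrite (leq_trans (size_scale_leq _ _)) // size_polyX.
have tip i : ipair 2 (map_poly t N0) (map_poly t D0) i 0 =
    (t (ipair 2 N0 D0 i 0).1, t (ipair 2 N0 D0 i 0).2).
  by rewrite -(rmorph_ipair t) rmorph0.
have B0 i : (ipair 2 (map_poly t N0) (map_poly t D0) i 0).2 != 0.
  rewrite tip /=; apply/eqP => /t_inj B0; have [_] := ipair_nu0 i; rewrite B0 rmorph0 => /eqP.
  by rewrite eq_sym oner_eq0.
have reg i : (map_poly t D0).[iter i (frac_map (map_poly t N0) (map_poly t D0)) 0] != 0.
  by apply: (ipair_neq0_frac_map szN (leqW szD) (n := i.+1)).
have itE i := @ipair_frac_map _ 2 _ _ szN (leqW szD) i 0 (fun j _ => reg j).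
have evN (E : fieldType) (j : {rmorphism R -> E}) z :
    (map_poly j N0).[z] = z ^+ 2 + j a * j nu * z + j a.
  rewrite /N0 !rmorphD /= map_polyXn rmorphM /= !map_polyC map_polyX /=.
  by rewrite !hornerE /= rmorphM.
have evD (E : fieldType) (j : {rmorphism R -> E}) z : (map_poly j D0).[z] = j nu * z + 1.
  by rewrite /D0 rmorphD rmorphM rmorph1 /= map_polyC map_polyX !hornerE.
split=> //.
- rewrite coef_map !coefD coefXn coefCM coefX coefC /= mulr0 !addr0; exact: rmorph1.
- exists 1; last by rewrite hornerC oner_neq0.
  have -> : frac_map (map_poly t N0) (map_poly t D0) 0 = t a.
    by rewrite /frac_map evN evD !mulr0 expr0n /= !add0r divr1.
  rewrite -map_polyZ -rmorphB mulr1 -(map_polyXn t); congr map_poly.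
  by rewrite /N0 /D0 -mul_polyC polyCM; ring.
- move=> i /andP[i_gt0 ltil]; apply/eqP => e1.
  have [Bi Ei] := itE i; have [Bl El] := itE l.
  have e2 : (ipair 2 N0 D0 i 0).1 * (ipair 2 N0 D0 l 0).2 =
            (ipair 2 N0 D0 l 0).1 * (ipair 2 N0 D0 i 0).2.
    apply/eqP; rewrite -subr_eq0; apply/eqP/t_inj/eqP; rewrite rmorphB !rmorphM subr_eq0.
    by move: Ei El; rewrite !tip /= => -> ->; rewrite e1 mulrAC; apply/eqP; ring.
  have := congr1 e e2; rewrite !rmorphM.
  have [-> ->] := ipair_nu0 i; have [-> ->] := ipair_nu0 l; rewrite !mulr1.
  have sz n : size (u n.+1) = (2 ^ n).+1.
    by apply: size_orbit0; rewrite ?size_polyXn // hornerXn expr0n.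
  move/(congr1 (fun q : {poly K} => size q)); case: (l) ltil => // l'; case: (i) i_gt0 => // i' _.
  by rewrite ltnS !sz => lti /eqP; rewrite eqSS eqn_exp2l // ltn_eqF.
- move=> E j z; have j0 := evN E [the {rmorphism R -> E} of j \o t] z.
  have jD := evD E [the {rmorphism R -> E} of j \o t] z.
  rewrite -!map_poly_comp j0 jD /= => Nz; apply/eqP => Dz.
  have z0 : z = 0.
    apply/eqP; rewrite -[_ == 0]/(true && (z == 0)) -(expf_eq0 _ 2); apply/eqP.
    transitivity (z ^+ 2 + j (t a) * j (t nu) * z + j (t a) - j (t a) * (j (t nu) * z + 1)).
      by ring.
    by rewrite Nz Dz mulr0 subr0.
  by move/eqP: Dz; rewrite z0 mulr0 add0r oner_eq0.
move=> E j c i N' D' c0 W; exfalso.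
have twoE : 2%:R = 0 :> E by rewrite -(rmorph_nat j) -(rmorph_nat t) two0 !rmorph0.
have dN (jt : {rmorphism R -> E}) : (map_poly jt N0)^`().[c] = 2%:R * c + jt a * jt nu.
  rewrite /N0 !rmorphD /= map_polyXn rmorphM /= !map_polyC map_polyX /=.
  by rewrite !derivD derivM !derivC derivXn derivX !hornerE rmorphM /=; ring.
have dD (jt : {rmorphism R -> E}) : (map_poly jt D0)^`().[c] = jt nu.
  rewrite /D0 rmorphD rmorphM rmorph1 /= map_polyC map_polyX.
  by rewrite derivD derivM !derivC derivX !hornerE; ring.
have [jN jD] := (evN E [the {rmorphism R -> E} of j \o t] c, evD E [the {rmorphism R -> E} of j \o t] c).
have [jN' jD'] := (dN [the {rmorphism R -> E} of j \o t], dD [the {rmorphism R -> E} of j \o t]).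
move: W; rewrite /N' /D' -!map_poly_comp jN jD jN' jD' /= => W.
have /eqP : j (t nu) * c ^+ 2 = 0.
  rewrite -[RHS]W -[LHS]addr0 -(mul0r c) -twoE; ring.
rewrite mulf_eq0 fmorph_eq0 expf_eq0 (negPf c0) andbF orbF => /eqP/t_inj/eqP.
by rewrite (negPf nu_neq0).
Qed.

End QuadraticSpecialMap.

Lemma exists_special_map (K : fieldType) d (sh : bool) l : (1 < d)%N -> (0 < l)%N ->
    ~ (sh /\ d = 2%N /\ 2%:R = 0 :> K) ->
  exists (F : fieldType) (kF : {rmorphism K -> F}) (N D : {poly F}), special_map d sh N D l.
Proof.
move=> d1 l_gt0 not22; have [[d2 two0]|?] := classic (d = 2%N /\ 2%:R = 0 :> K); last first.
  exact: polynomial_special.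
have -> : sh = false by case: (sh) not22 => // not22; case: not22.
(* The outer variable of [R] is [nu] and the inner one is [a]. *)
rewrite d2; pose R : idomainType := {poly {poly K}}.
pose t := [the {rmorphism R -> {fraction R}} of @tofrac R].
pose e := [the {rmorphism R -> {poly K}} of horner_eval (0 : {poly K})].
have two0R : 2%:R = 0 :> R by rewrite -!polyC_natr two0 !polyC0.
have nu0 : ('X : {poly {poly K}}) != 0 by rewrite polyX_eq0.
have e_nu : e 'X = 0 by rewrite /= /horner_eval hornerX.
have e_a : e 'X%:P = 'X by rewrite /= /horner_eval hornerC.
have t_inj r : t r = 0 -> r = 0 by move/eqP; rewrite tofrac_eq0 => /eqP.
have sp := quadratic_special_map two0R nu0 e_nu e_a t_inj l_gt0.
exists {fraction R}, [the {rmorphism K -> {fraction R}} of t \o (polyC \o polyC)].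
by do 2!eexists; exact: sp.
Qed.

(** * The Galois group of a generic map *)

Section GenericGalois.
Variables (k : fieldType) (d m : nat) (sh : bool) (NR DR : {poly {mpoly k[m]}}).
Hypothesis gen : generic_pair d sh NR DR.
Hypothesis d1 : (1 < d)%N.
Hypothesis not22 : ~ (sh /\ d = 2%N /\ (2%N \in [pchar k])).
Let K : fieldType := ratfield k m.
Let N : {poly K} := map_poly (@tofrac {mpoly k[m]}) NR.
Let D : {poly K} := map_poly (@tofrac {mpoly k[m]}) DR.
Let A n : {poly K} := (iterpoly d N D n).1.
Variables (L : splittingFieldType K) (n : nat).
Hypothesis splitL : splittingFieldFor 1 (map_poly (in_alg L) (A n)) {:L}.

Lemma generic_tree_galois : ('Gal({:L} / 1%VS) \isog wreath_power d n)%g.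
Proof.
have galL : galois 1 {:L} by exact: (generic_galois gen d1 splitL).
have not22K : ~ (sh /\ d = 2%N /\ 2%:R = 0 :> K).
  move=> [s [d2 two0]]; apply: not22; split=> //; split=> //.
  apply/andP; split=> //; apply/eqP.
  have : (tofrac (2%:R)%:MP : K) = 0 by rewrite !rmorph_nat.
  by move/eqP; rewrite tofrac_eq0 mpolyC_eq0 => /eqP.
apply: (tree_galois gen d1 splitL) => l /andP[l_gt0 _] x x_inj Ax.
have [F [kF [N0 [D0 sp]]]] := exists_special_map d1 l_gt0 not22K.
exact: (special_transposition gen d1 galL l_gt0 x_inj Ax kF sp).
Qed.

End GenericGalois.

(** * The two maps of the theorem as generic pairs *)

Lemma mpoly_rmorph_ext n (R : nzRingType) (S : comNzRingType)
    (g h : {rmorphism {mpoly R[n]} -> S}) :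
  (forall c, g c%:MP = h c%:MP) -> (forall i, g 'X_i = h 'X_i) -> g =1 h.
Proof.
move=> ghC ghX p; rewrite (mpoly_rmorphE (f := fun c => h c%:MP) (h := fun i => h 'X_i)) //.
by rewrite (mpoly_rmorphE (f := fun c => h c%:MP) (h := fun i => h 'X_i)).
Qed.

Section MonicSum.
Variables (R : nzRingType) (d : nat) (c : 'I_d -> R).

Let P : {poly R} := 'X^d + \sum_(i < d) (c i)%:P * 'X^i.

Let lower i : (\sum_(i < d) (c i)%:P * 'X^i)`_i = if insub i is Some j then c j else 0.
Proof.
rewrite coef_sum; case: insubP => [j _ <-|].
  rewrite (bigD1 j) //= coefCM coefXn eqxx mulr1 big1 ?addr0 // => l nlj.
  by rewrite coefCM coefXn eq_sym (negPf (_ : l != j :> nat)) ?mulr0.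
rewrite -leqNgt => ledi; apply: big1 => l _; rewrite coefCM coefXn.
by rewrite gtn_eqF ?mulr0 // (leq_trans (ltn_ord l)).
Qed.

Lemma coef_monic_sum (i : 'I_d) : P`_i = c i.
Proof. by rewrite coefD lower coefXn ltn_eqF ?ltn_ord // add0r valK. Qed.

Lemma coef_monic_sum_top : P`_d = 1.
Proof. by rewrite coefD lower coefXn eqxx insubF ?ltnn // addr0. Qed.

Lemma size_monic_sum : (size P <= d.+1)%N.
Proof.
apply/leq_sizeP => i ltdi; rewrite coefD lower coefXn gtn_eqF // add0r.
by rewrite insubF //; apply/negbTE; rewrite -leqNgt ltnW.
Qed.

End MonicSum.

Lemma monic_sum_coef (R : nzRingType) d (P : {poly R}) : (size P <= d.+1)%N -> P`_d = 1 ->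
  P = 'X^d + \sum_(i < d) (P`_i)%:P * 'X^i.
Proof.
move=> szP Pd; apply/polyP => i; have [ltid|ledi] := ltnP i d.
  by rewrite (coef_monic_sum (fun i => P`_i) (Ordinal ltid)).
move: ledi; rewrite leq_eqVlt => /orP[/eqP<-|ltdi]; first by rewrite coef_monic_sum_top.
have szS := size_monic_sum (fun i : 'I_d => P`_i).
by rewrite !nth_default // (leq_trans szS, leq_trans szP).
Qed.

Lemma map_monic_sum (R S : nzRingType) (f : {rmorphism R -> S}) d (c : 'I_d -> R) :
  map_poly f ('X^d + \sum_(i < d) (c i)%:P * 'X^i) = 'X^d + \sum_(i < d) (f (c i))%:P * 'X^i.
Proof.
rewrite rmorphD rmorph_sum /= map_polyXn; congr (_ + _); apply: eq_bigr => i _.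
by rewrite rmorphM /= map_polyC map_polyXn.
Qed.

Lemma map_sum_poly (R S : nzRingType) (f : {rmorphism R -> S}) d (c : 'I_d -> R) :
  map_poly f (\sum_(i < d) (c i)%:P * 'X^i) = \sum_(i < d) (f (c i))%:P * 'X^i.
Proof.
rewrite rmorph_sum /=; apply: eq_bigr => i _.
by rewrite rmorphM /= map_polyC map_polyXn.
Qed.

Lemma coef_sum_ord (R : nzRingType) d (c : 'I_d -> R) (i : 'I_d) :
  (\sum_(j < d) (c j)%:P * 'X^j)`_i = c i.
Proof.
have := coef_monic_sum c i; rewrite coefD coefXn ltn_eqF ?ltn_ord //.
by rewrite add0r.
Qed.

Lemma generic_pair_polynomial (k : fieldType) d :
  generic_pair d true ('X^d + \sum_(i < d) ('X_i : {mpoly k[d]})%:P * 'X^i) 1.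
Proof.
split.
- exact: size_monic_sum.
- exact: coef_monic_sum_top.
- by rewrite size_poly1.
- by [].
- move=> Z g h ghC; rewrite !map_monic_sum => e _; apply: mpoly_rmorph_ext => // i.
  have := congr1 (fun P : {poly Z} => P`_i) e.
  by rewrite !(coef_monic_sum (fun i => _ 'X_i)).
move=> R kap N' D'.
exists [the {rmorphism {mpoly k[d]} -> R} of mmap kap (fun i => N'`_i)]; split=> [c|Z f].
  by rewrite /= mmapC.
move=> szN Nd _ /(_ isT) ->; split; last by rewrite rmorph1.
rewrite map_monic_sum [RHS](monic_sum_coef szN Nd); congr (_ + _); apply: eq_bigr => i _.
by rewrite /= mmapX mmap1U coef_map.
Qed.

Lemma generic_pair_rational (k : fieldType) d :
  generic_pair d false
    ('X^d + \sum_(i < d) ('X_(lshift d.+1 i) : {mpoly k[d + d.+1]})%:P * 'X^i)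
    (\sum_(j < d.+1) ('X_(rshift d j) : {mpoly k[d + d.+1]})%:P * 'X^j).
Proof.
split.
- exact: size_monic_sum.
- exact: coef_monic_sum_top.
- rewrite (leq_trans (size_sum _ _ _)) //; apply/bigmax_leqP => j _; rewrite mul_polyC.
  by rewrite (leq_trans (size_scale_leq _ _)) // size_polyXn.
- by [].
- move=> Z g h ghC; rewrite !map_monic_sum !map_sum_poly => eN eD.
  apply: mpoly_rmorph_ext => // l; case: (splitP l) => i Di.
    have -> : l = lshift d.+1 i by apply: val_inj.
    have := congr1 (fun P : {poly Z} => P`_i) eN.
    by rewrite !(coef_monic_sum (fun i => _ 'X_(lshift d.+1 i))).
  have -> : l = rshift d i by apply: val_inj.
  have := congr1 (fun P : {poly Z} => P`_i) eD.
  by rewrite !(coef_sum_ord (fun i => _ 'X_(rshift d i))).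
move=> R kap N' D'.
pose v l := match @split d d.+1 l with inl i => N'`_i | inr j => D'`_j end.
exists [the {rmorphism {mpoly k[d + d.+1]} -> R} of mmap kap v]; split=> [c|Z f].
  by rewrite /= mmapC.
move=> szN Nd szD _; rewrite map_monic_sum map_sum_poly.
split.
  rewrite [RHS](monic_sum_coef szN Nd); congr (_ + _); apply: eq_bigr => i _.
  by rewrite /= mmapX mmap1U coef_map /v (unsplitK (inl i)).
rewrite [RHS](poly_widen szD); apply: eq_bigr => i _.
by rewrite /= mmapX mmap1U coef_map /v (unsplitK (inr i)).
Qed.

Lemma splittingFieldFor_eqp (K : fieldType) (L : fieldExtType K) (p q : {poly K}) U E :
  p %= q -> splittingFieldFor U (map_poly (in_alg L) p) E ->
  splittingFieldFor U (map_poly (in_alg L) q) E.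
Proof.
move=> pq [rs Dp gen]; exists rs => //; apply: eqp_trans Dp.
by rewrite eqp_map eqp_sym.
Qed.

Lemma coprimep_root_free (K : fieldType) (p q : {poly K}) : p != 0 ->
    (forall (L : fieldExtType K) z, root (map_poly (in_alg L) p) z ->
      ~~ root (map_poly (in_alg L) q) z) ->
  coprimep p q.
Proof.
move=> p0 pq; have g0 : gcdp p q != 0 by rewrite gcdp_eq0 negb_and p0.
have [L [[|z rs] Dg]] := splits_in_extension g0.
  by rewrite /coprimep -(size_map_poly (in_alg L)) (eqp_size Dg) big_nil size_poly1.
have : root (map_poly (in_alg L) (gcdp p q)) z.
  by rewrite (eqp_root Dg) big_cons rootM root_XsubC eqxx.
by rewrite gcdp_map root_gcd => /andP[/pq/negPf->].
Qed.

(** By nondegeneracy the two iterated polynomials have no common root in any extension, so passing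
    to lowest terms only divides by a constant. *)
Lemma PhiIterNumer_eqp (k : fieldType) d n : (1 < d)%N ->
  PhiIterNumer k d n %= (iterpoly d (PhiNum k d) (PhiDen k d) n).1.
Proof.
move=> d1; pose gen := generic_pair_rational k d.
have [l0 szA] := generic_leadK gen d1 n.
rewrite /PhiIterNumer PhiIterPair_iterpoly /=; move: l0 szA.
rewrite map_monic_sum map_sum_poly -/(PhiNum k d) -/(PhiDen k d) => l0 szA.
set A := (iterpoly _ _ _ n).1 in l0 szA *; set B := (iterpoly _ _ _ n).2.
have A0 : A != 0 by rewrite -size_poly_gt0 szA.
have cop : coprimep A B.
  apply: coprimep_root_free => // L z Az.
  have [|nd _] := @generic_nondegenerate _ _ _ _ _ _ gen d1 n L
      [the {rmorphism PhiField k d -> L} of in_alg L] z.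
    move: Az; rewrite /A /PhiNum /PhiDen -map_monic_sum -map_sum_poly map_iterpoly.
    by rewrite -map_poly_comp.
  have := nd n; rewrite /B /root /PhiNum /PhiDen -map_monic_sum -map_sum_poly map_iterpoly.
  by rewrite -map_poly_comp.
have /size_poly1P[c c0 Dc] : size (gcdp A B) == 1%N by [].
have := divpK (dvdp_gcdl A B); rewrite Dc mulrC mul_polyC => eA.
by rewrite -[X in _ %= X]eA eqp_sym eqp_scale.
Qed.

Theorem theorem1p1 (k : fieldType) (d n : nat) (hd : (1 < d)%N) (hn : (0 < n)%N) :
  (forall L : splittingFieldType (PhiField k d),
     splittingFieldFor (1%VS : {vspace L}) (map_poly (in_alg L) (PhiIterNumer k d n)) {:L} ->
     ('Gal({:L} / 1%VS) \isog wreath_power d n)%g)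
  /\
  (~ (d = 2%N /\ (2%N \in [pchar k])) ->
   forall L : splittingFieldType (ratfield k d),
     splittingFieldFor (1%VS : {vspace L}) (map_poly (in_alg L) (Giter k d n)) {:L} ->
     ('Gal({:L} / 1%VS) \isog wreath_power d n)%g).
Proof.
split=> [L splitL|not22 L splitL].
  (* Here [sh] is [false], so the exclusion of [d = p = 2] is vacuous. *)
  apply: (generic_tree_galois (generic_pair_rational k d) hd); first by case.
  rewrite map_monic_sum map_sum_poly.
  exact: splittingFieldFor_eqp (PhiIterNumer_eqp k n hd) splitL.
apply: (generic_tree_galois (generic_pair_polynomial k d) hd); first by case.
(* With denominator [1] the homogeneous iteration is ordinary composition. *)
rewrite rmorph1 map_monic_sum iterpoly_comp //.
exact: size_monic_sum.
Qed.
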